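(* Let $\alpha\ge0$, $\boldsymbol\theta^0\in\Theta\subset\mathbb R^p$, and let $\widehat{\boldsymbol\theta}_\alpha$ be the minimum Rényi pseudodistance (RP) estimator based on independent, not necessarily identically distributed observations $Y_1,\dots,Y_n$ with densities $f_i(y,\boldsymbol\theta)$. Under the null hypothesis $H_0:\boldsymbol\theta=\boldsymbol\theta^0$ (i.e. the true parameter value is $\boldsymbol\theta^*=\boldsymbol\theta^0$) the Wald-type test statistic $$\boldsymbol W_n^0(\boldsymbol\theta^0)=n(\widehat{\boldsymbol\theta}_\alpha-\boldsymbol\theta^0)^T\boldsymbol\Sigma_\alpha^{-1}(\boldsymbol\theta^0)(\widehat{\boldsymbol\theta}_\alpha-\boldsymbol\theta^0)$$ converges in law, as $n\to\infty$, to a chi-square distribution with $p$ degrees of freedom.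
   Context: All densities are with respect to a common dominating measure (written $dy$), $\alpha\ge0$ is fixed, and $Y_i$ has density $f_i(\cdot,\boldsymbol\theta^* )$ with common true value $\boldsymbol\theta^*$. For $\alpha>0$ put $$V_i(y,\boldsymbol\theta)=\frac{f_i(y,\boldsymbol\theta)^\alpha}{\left(\int f_i(y,\boldsymbol\theta)^{\alpha+1}dy\right)^{\alpha/(\alpha+1)}},$$ and for $\alpha=0$ put $V_i(y,\boldsymbol\theta)=\log f_i(y,\boldsymbol\theta)$. The objective function is $H_n^\alpha(\boldsymbol\theta)=\frac1n\sum_{i=1}^n V_i(Y_i,\boldsymbol\theta)$. The minimum RP estimator $\widehat{\boldsymbol\theta}_\alpha$ is the maximizer of $H_n^\alpha$ over $\Theta$; for the asymptotic theory it is understood as a consistent sequence ($\widehat{\boldsymbol\theta}_\alpha\to\boldsymbol\theta^*$ in probability) of solutions, with probability tending to one, of $\partial H_n^\alpha(\boldsymbol\theta)/\partial\boldsymbol\theta=\boldsymbol0_p$. $E_{\boldsymbol\theta^*}$ and $Var_{\boldsymbol\theta^*}$ denote expectation and covariance matrix when $Y$ (in a term with index $i$) has density $f_i(\cdot,\boldsymbol\theta^* )$. Define $$\boldsymbol J^{(i)}=\left(-E_{\boldsymbol\theta^*}\left[\frac{\partial^2V_i(Y;\boldsymbol\theta)}{\partial\theta_j\partial\theta_k}\Big|_{\boldsymbol\theta=\boldsymbol\theta^*}\right]\right)_{j,k=1,\dots,p},\quad \boldsymbol\Psi_n(\boldsymbol\theta^* )=\frac1n\sum_{i=1}^n\boldsymbol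 J^{(i)},\quad \boldsymbol\Omega_n(\boldsymbol\theta^* )=\frac1n\sum_{i=1}^nVar_{\boldsymbol\theta^*}\left[\frac{\partial V_i(Y;\boldsymbol\theta)}{\partial\boldsymbol\theta}\Big|_{\boldsymbol\theta=\boldsymbol\theta^*}\right],$$ $$\boldsymbol\Sigma_\alpha(\boldsymbol\theta^* )=\lim_{n\to\infty}\boldsymbol\Psi_n^{-1}(\boldsymbol\theta^* )\boldsymbol\Omega_n(\boldsymbol\theta^* )\boldsymbol\Psi_n^{-1}(\boldsymbol\theta^* ).$$ Standing assumptions: the limit $\boldsymbol\Sigma_\alpha(\boldsymbol\theta^0)$ exists and is invertible, and the following conditions hold at the true value $\boldsymbol\theta^*$: C1. The support $\mathcal X$ of $f_i(\cdot,\boldsymbol\theta)$ is the same for all $i$ and does not depend on $\boldsymbol\theta$. C2. There is an open subset $\Theta^\ast\subset\Theta$ containing $\boldsymbol\theta^*$ such that for almost all $y\in\mathcal X$ and all $i$, $f_i(y,\boldsymbol\theta)$ admits all third derivatives with respect to $\boldsymbol\theta\in\Theta^\ast$. C3. For each $i$ the integral $\int f_i(y,\boldsymbol\theta)^{1+\alpha}dy$ can be differentiated three times with respect to $\boldsymbol\theta$, and integration and differentiation can be interchanged. C4. Each $\boldsymbol J^{(i)}$ is positive definite, and, with $\lambda_n$ the minimum eigenvalue of $\boldsymbol\Psi_n$, $\lambda_0=\inf_n\lambda_n>0$. C5. There are functions $M^{(i)}_{jkl}$ with $\left|\frac{\partial^3V_i(y;\boldsymbol\theta)}{\partial\theta_j\partial\theta_k\partial\theta_l}\right|\le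 M^{(i)}_{jkl}(y)$ for all $\boldsymbol\theta\in\Theta^\ast$ and all $j,k,l$, and $E_{\boldsymbol\theta^*}[M^{(i)}_{jkl}(Y)]=m_{jkl}<\infty$ for all $j,k,l$ (with $m_{jkl}$ not depending on $i$). C6. For all $j,k,l$, the sequences (in $i$) of first, second and third partial derivatives $\partial V_i/\partial\theta_j$, $\partial^2V_i/\partial\theta_j\partial\theta_k$, $\partial^3V_i/\partial\theta_j\partial\theta_k\partial\theta_l$, evaluated at $(Y_i,\boldsymbol\theta^* )$, are uniformly integrable in the Cesàro sense: if $D_i$ denotes any one of these derivatives of $V_i$, then $\lim_{N\to\infty}\sup_{n>1}\frac1n\sum_{i=1}^nE_{\boldsymbol\theta^*}\left[|D_i(Y)|\,I_{\{|D_i(Y)|>N\}}\right]=0$. C7. ($\boldsymbol\Omega_n$ is invertible and) for all $\varepsilon>0$, with $\boldsymbol\xi_{i,n}=\boldsymbol\Omega_n^{-1/2}\frac{\partial V_i(Y,\boldsymbol\theta)}{\partial\boldsymbol\theta}\big|_{\boldsymbol\theta=\boldsymbol\theta^*}$, $\lim_{n\to\infty}\frac1n\sum_{i=1}^nE_{\boldsymbol\theta^*}\left[\|\boldsymbol\xi_{i,n}\|_2^2\,I_{\{\|\boldsymbol\xi_{i,n}\|_2>\varepsilon\sqrt n\}}\right]=0$. *)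

(* Defs.v *)
From HB Require Import structures.
From mathcomp Require Import all_boot all_order all_algebra finmap.
From mathcomp Require Import all_classical all_reals all_analysis.
From mathcomp Require Import measurable_realfun.

Set Implicit Arguments.
Unset Strict Implicit.
Unset Printing Implicit Defensive.

Import Order.TTheory GRing.Theory Num.Theory.
Import numFieldNormedType.Exports.

Local Open Scope classical_set_scope.
Local Open Scope ring_scope.

Section calculus.
Context {R : realType} {p : nat}.
Implicit Types (g : 'rV[R]_p -> R) (t x : 'rV[R]_p).

Definition partial (j : 'I_p) g t : R := 'D_(delta_mx 0 j) g t.

Definition thrice_derivable (U : set 'rV[R]_p) g :=
  forall t, U t -> forall j k l : 'I_p,
    [/\ derivable g t (delta_mx 0 l),
        derivable (partial l g) t (delta_mx 0 k) &
        derivable (partial k (partial l g)) t (delta_mx 0 j)].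

(* The library norm `|x| on row vectors is the sup norm. *)
Definition norm2 x : R := Num.sqrt (\sum_j x 0 j ^+ 2).

End calculus.

Section matrices.
Context {R : realType} {p : nat}.
Implicit Types A B : 'M[R]_p.

Definition posdefmx A :=
  A^T = A /\ forall x : 'rV[R]_p, x != 0 -> 0 < (x *m A *m x^T) 0 0.

Definition min_eigenvalue A : R := inf [set a | eigenvalue A a].

(* B is A^(-1/2), the positive definite square root of A^-1. *)
Definition is_invsqrtmx A B :=
  [/\ A \in unitmx, posdefmx B & B *m B = invmx A].

End matrices.

Section chi_square.
Context {R : realType}.

Definition add_sq (x : measurableTypeR R * measurableTypeR R) :
  measurableTypeR R := x.1 + x.2 ^+ 2.

Lemma measurable_add_sq : measurable_fun [set: _] add_sq.
Proof.
apply: measurable_funD => /=; first exact: measurable_fst.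
by apply: measurable_funX; exact: measurable_snd.
Qed.

HB.instance Definition _ :=
  isMeasurableFun.Build _ _ _ _ add_sq measurable_add_sq.

(* The law of the sum of the squares of k independent standard normal
   variables. *)
Fixpoint chi_square (k : nat) : probability (measurableTypeR R) R :=
  if k is k'.+1 then
    distribution (chi_square k' \x normal_prob 0 1)%E add_sq
  else \d_(0 : measurableTypeR R).

End chi_square.

Section convergence.
Context {d} {T : measurableType d} {R : realType} (P : probability T R).

(* The events A n need not be measurable. *)
Definition with_probability_tending_to_one (A : nat -> set T) :=
  exists B : nat -> set T,
    [/\ forall n, measurable (B n), forall n, B n `<=` A n &
        P (B n) @[n --> \oo] --> 1%E].

Definition cvg_in_probability {p : nat}
    (X : nat -> T -> 'rV[R]_p) (x : 'rV[R]_p) :=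
  forall e : R, 0 < e -> P [set w | e < norm2 (X n w - x)] @[n --> \oo] --> 0%E.

Definition cvg_in_law (X : nat -> T -> R)
    (Q : probability (measurableTypeR R) R) :=
  forall x : R, {for x, continuous (fun t : R => Q `]-oo, t]%classic)} ->
    P [set w | X n w <= x] @[n --> \oo] --> Q `]-oo, x]%classic.

Definition mutually_independent {d'} {S : measurableType d'}
    (X : nat -> T -> S) :=
  forall (I : {fset nat}) (A : nat -> set S),
    (forall i, measurable (A i)) ->
    fine (P (\bigcap_(i in [set` I]) X i @^-1` A i)) =
    \prod_(i <- I) fine (P (X i @^-1` A i)).

End convergence.

Section renyi.
Context {d} {S : measurableType d} {R : realType} {p : nat}.
Variables (mu : {measure set S -> \bar R}) (f : nat -> S -> 'rV[R]_p -> R).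

(* Indices start at 0: f i is the density of the (i+1)-th observation. *)
Definition density_model (Theta : set 'rV[R]_p) :=
  forall i t, Theta t ->
    [/\ measurable_fun [set: S] (f i ^~ t), forall y, 0 <= f i y t &
        (\int[mu]_y (f i y t)%:E = 1)%E].

Definition expect (i : nat) (t : 'rV[R]_p) (g : S -> R) : \bar R :=
  (\int[mu]_y (g y * f i y t)%:E)%E.

Definition covar (i : nat) (t : 'rV[R]_p) (g h : S -> R) : R :=
  fine (expect i t (fun y =>
    (g y - fine (expect i t g)) * (h y - fine (expect i t h)))).

Variable alpha : R.

Definition power_int (i : nat) (t : 'rV[R]_p) : R :=
  \int[mu]_y (f i y t `^ (alpha + 1)).

Definition V (i : nat) (y : S) (t : 'rV[R]_p) : R :=
  if alpha == 0 then ln (f i y t)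
  else f i y t `^ alpha / power_int i t `^ (alpha / (alpha + 1)).

Definition H (n : nat) (y : n.-tuple S) (t : 'rV[R]_p) : R :=
  n%:R^-1 * \sum_(i < n) V i (tnth y i) t.

Definition gradV (i : nat) (t : 'rV[R]_p) (y : S) : 'rV[R]_p :=
  \row_j partial j (V i y) t.

Definition J (i : nat) (t : 'rV[R]_p) : 'M[R]_p :=
  \matrix_(j, k) - fine (expect i t (fun y => partial j (partial k (V i y)) t)).

Definition Psi (n : nat) (t : 'rV[R]_p) : 'M[R]_p :=
  n%:R^-1 *: \sum_(i < n) J i t.

Definition Omega (n : nat) (t : 'rV[R]_p) : 'M[R]_p :=
  n%:R^-1 *: \sum_(i < n) \matrix_(j, k)
    covar i t (fun y => gradV i t y 0 j) (fun y => gradV i t y 0 k).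

Definition sandwich (n : nat) (t : 'rV[R]_p) : 'M[R]_p :=
  invmx (Psi n t) *m Omega n t *m invmx (Psi n t).

(* Meaningful only when the limit exists. *)
Definition Sigma (t : 'rV[R]_p) : 'M[R]_p := lim (sandwich n t @[n --> \oo]).

Section conditions.
Variables (Theta U : set 'rV[R]_p) (X : set S) (ts : 'rV[R]_p).

Definition C1_common_support := forall i t, Theta t -> [set y | 0 < f i y t] = X.

Definition C2_smooth_densities :=
  [/\ open U, U `<=` Theta, U ts &
      {ae mu, forall y, X y -> forall i, thrice_derivable U (f i y)}].

(* The left-hand sides below are real numbers, and the library sets
   +oo - +oo = -oo, so each equality forces both the positive and the negative
   part of the integrand to have a finite integral. *)
Definition C3_differentiation_under_integral := forall i,
  [/\ forall t, U t -> (\int[mu]_y (f i y t `^ (alpha + 1))%:E < +oo)%E,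
      thrice_derivable U (power_int i) &
      forall t, U t -> forall j k l : 'I_p,
        let fa y s := f i y s `^ (alpha + 1) in
        [/\ ((partial l (power_int i) t)%:E
              = \int[mu]_y (partial l (fa y) t)%:E)%E,
            ((partial k (partial l (power_int i)) t)%:E
              = \int[mu]_y (partial k (partial l (fa y)) t)%:E)%E &
            ((partial j (partial k (partial l (power_int i))) t)%:E
              = \int[mu]_y (partial j (partial k (partial l (fa y))) t)%:E)%E]].

Definition C4_positive_definite :=
  (forall i, posdefmx (J i ts)) /\
  0 < inf [set min_eigenvalue (Psi n ts) | n in [set n | (0 < n)%N]].

Definition C5_dominated_third_derivatives :=
  exists (M : nat -> 'I_p -> 'I_p -> 'I_p -> S -> R)
         (m : 'I_p -> 'I_p -> 'I_p -> R),
    [/\ forall i j k l, measurable_fun [set: S] (M i j k l),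
        {ae mu, forall y, X y -> forall i t, U t -> forall j k l,
          `|partial j (partial k (partial l (V i y))) t| <= M i j k l y} &
        forall i j k l, expect i ts (M i j k l) = (m j k l)%:E].

Definition cesaro_uniformly_integrable (D : nat -> S -> R) :=
  ereal_sup [set ((n%:R^-1)%:E * \sum_(i < n)
      expect i ts (fun y =>
        `|D i y| * \1_[set z | (N < `|D i z|)%R] y)%R)%E
    | n in [set n | (1 < n)%N]] @[N --> +oo%R] --> 0%E.

Definition C6_uniform_integrability := forall j k l : 'I_p,
  [/\ cesaro_uniformly_integrable (fun i y => partial j (V i y) ts),
      cesaro_uniformly_integrable
        (fun i y => partial j (partial k (V i y)) ts) &
      cesaro_uniformly_integrable
        (fun i y => partial j (partial k (partial l (V i y))) ts)].

(* B n is Omega_n^(-1/2), and xi is the transpose of the usual column vector. *)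
Definition C7_lindeberg := exists B : nat -> 'M[R]_p,
  (forall n, (0 < n)%N -> is_invsqrtmx (Omega n ts) (B n)) /\
  forall eps : R, 0 < eps ->
    let xi i n y := gradV i ts y *m (B n)^T in
    ((n%:R^-1)%:E * \sum_(i < n)
      expect i ts (fun y => norm2 (xi i n y) ^+ 2 *
        \1_[set z | (eps * Num.sqrt n%:R < norm2 (xi i n z))%R] y)%R)%E
    @[n --> \oo] --> 0%E.

End conditions.

(* An estimator is a sequence of statistics of the first n observations. Being
   a root includes differentiability of the objective there. *)
Definition min_RP_estimator {d'} {T : measurableType d'} (P : probability T R)
    (Y : nat -> T -> S) (Theta : set 'rV[R]_p) (ts : 'rV[R]_p)
    (est : forall n, n.-tuple S -> 'rV[R]_p) :=
  let obs n w := [tuple Y i w | i < n] in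
  [/\ forall n (j : 'I_p),
        measurable_fun [set: n.-tuple S] (fun y => est n y 0 j),
      cvg_in_probability P (fun n w => est n (obs n w)) ts &
      with_probability_tending_to_one P (fun n => [set w |
        Theta (est n (obs n w)) /\ forall j : 'I_p,
          is_derive (est n (obs n w)) (delta_mx 0 j) (H (obs n w)) 0])].

Definition wald_stat (n : nat) (th t0 : 'rV[R]_p) : R :=
  n%:R * ((th - t0) *m invmx (Sigma t0) *m (th - t0)^T) 0 0.

End renyi.

(* Main.v *)
(* Let S_i be the gradient of V_i(Y_i, .) at theta0. By C3 it has mean zero, so
   Z_n = n^(-1/2) sum_i B_n S_i, with B_n = Omega_n^(-1/2), is a normalized sum of
   independent centred vectors. The one-dimensional Lindeberg theorem for
   E cos(<t, Z_n>), averaged over a Gaussian t, gives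
   E exp(- l |Z_n|^2) -> int exp(- l s) dchi2_p(s), and approximating indicators
   by polynomials in exp(- l s) turns this into convergence of the distribution
   functions of |Z_n|^2; in particular Z_n is tight.
   Expanding the estimating equation around theta0 gives
   u_n (Psi_n + E_n) = Z_n B_n^(-1) for u_n = sqrt n (est_n - theta0), where E_n
   tends to 0 in probability by the weak law of large numbers for the uniformly
   integrable second derivatives and by the domination of the third ones. Since
   Psi_n^(-1) is bounded by 1/lambda_0 and the sandwich matrices tend to Sigma, the
   quadratic form u_n Sigma^(-1) u_n^T differs from |Z_n|^2 by o_P(1). *)
Require Import Defs.
From HB Require Import structures.
From mathcomp Require Import all_boot all_order all_algebra finmap.
From mathcomp Require Import all_classical all_reals all_analysis.
From mathcomp Require Import measurable_realfun.
From mathcomp Require Import ring lra.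

Set Implicit Arguments.
Unset Strict Implicit.
Unset Printing Implicit Defensive.

Import Order.TTheory GRing.Theory Num.Theory.
Import numFieldNormedType.Exports.

Local Open Scope classical_set_scope.
Local Open Scope ring_scope.

(** * Transfer of integrals and expectation *)

(** Only the law of |Z_n|^2 is needed, and a nonnegative variable is controlled by its Laplace
    transform; hence cosines of linear forms suffice and no continuity theorem for characteristic
    functions in dimension p enters. Independence is given on events, so it is turned into a
    factorization rule for bounded functions of partial sums. Several obstacles shape the
    statistical half. The derivatives of V exist only off a null set and their measurability is not
    assumed, so every integrand is replaced by a measurable one that agrees with it on a set of full
    probability. Total differentiability is not assumed either, so the expansion moves one
    coordinate at a time and its remainder is kept inside the matrix E_n. The matrix Psi_n + E_n is
    never inverted: |u_n| is bounded by absorbing the E_n term, using the bound on Psi_n^(-1) and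
    the smallness of E_n. The event that the estimator solves its equation need not be measurable,
    so high probability is expressed by measurable covers of complements. *)

Section transfer.
Context {d d'} {T : measurableType d} {S : measurableType d'} {R : realType}.
Local Open Scope ereal_scope.
Import HBNNSimple.

(** The right-hand side depends on [m], [Y] and [h] only through the set function sending A to the
    integral of [h] over the preimage of A. Two triples with the same set function therefore give
    the same integrals of [g]. The proof is monotone convergence along the simple approximations of
    [g]. *)
Lemma ge0_integral_lim_simple (m : {measure set T -> \bar R}) (Y : T -> S)
    (h : T -> R) (g : S -> \bar R) (mg : measurable_fun [set: S] g) :
  measurable_fun [set: T] Y -> measurable_fun [set: T] h ->
  (forall w, 0 <= h w)%R -> (forall y, 0 <= g y) ->
  \int[m]_w (g (Y w) * (h w)%:E) =
  lim ((\sum_(r \in range (nnsfun_approx measurableT mg n))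
     (r%:E * \int[m]_(w in Y @^-1` (nnsfun_approx measurableT mg n @^-1` [set r]))
        (h w)%:E)) @[n --> \oo]).
Proof.
move=> mY mh h0 g0; pose a := nnsfun_approx measurableT mg.
have maY n : measurable_fun [set: T] (fun w => a n (Y w)).
  exact: measurableT_comp.
have mhE : measurable_fun [set: T] (EFin \o h) by exact/measurable_EFinP.
have -> : \int[m]_w (g (Y w) * (h w)%:E) =
    lim (\int[m]_w ((a n (Y w))%:E * (h w)%:E) @[n --> \oo]).
  have fg w : g (Y w) * (h w)%:E = lim (((a n (Y w))%:E * (h w)%:E) @[n --> \oo]).
    apply/esym/cvg_lim => //; apply: cvgeZr => //.
    exact: (cvg_nnsfun_approx measurableT mg (fun x _ => g0 x)).
  under eq_integral => w _ do rewrite fg.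
  apply: monotone_convergence => //.
  - by move=> n; apply: emeasurable_funM => //; exact/measurable_EFinP.
  - by move=> n x _; rewrite mule_ge0 ?lee_fin.
  - move=> x _ u v uv; rewrite lee_wpmul2r ?lee_fin//.
    exact/lefP/nd_nnsfun_approx.
congr (lim (_ @ \oo)); apply/funext => n; rewrite -/a.
have mset r : measurable (Y @^-1` (a n @^-1` [set r])).
  by rewrite -[X in measurable X]setTI; exact: (maY n measurableT).
transitivity (\int[m]_w (\sum_(r \in range (a n))
    (r * \1_(a n @^-1` [set r]) (Y w))%:E * (h w)%:E)).
  apply: eq_integral => w _.
  rewrite -ge0_mule_fsuml => [|y]; last exact: nnfun_muleindic_ge0.
  by rewrite fsumEFin // -(fimfunE _ (Y w)).
have mind r : measurable_fun [set: T]
    (fun w => (\1_(a n @^-1` [set r]) (Y w))%:E : \bar R).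
  rewrite (_ : (fun w => _) = EFin \o \1_(Y @^-1` (a n @^-1` [set r]))) //.
  by apply/measurable_EFinP; exact: measurable_indic.
rewrite ge0_integral_fsum//; last 2 first.
- move=> y; apply: emeasurable_funM => //.
  by under eq_fun do rewrite EFinM; apply: emeasurable_funM.
- move=> r w _; rewrite mule_ge0 ?lee_fin//.
  by have := nnfun_muleindic_ge0 (a n) r (Y w); rewrite -EFinM lee_fin.
apply: eq_fsbigr => r; rewrite inE => -[y _ <-{r}].
under eq_integral do rewrite EFinM -muleA.
rewrite ge0_integralZl//.
- congr (_ * _); rewrite [RHS]integral_mkcond.
  apply: eq_integral => w _; rewrite patchE indicE.
  rewrite (_ : (w \in Y @^-1` _) = (Y w \in a n @^-1` [set a n y])); last first.
    by apply/idP/idP; rewrite !inE.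
  by case: (Y w \in _); rewrite ?mul1e ?mul0e.
- by apply: emeasurable_funM.
- by move=> w _; rewrite mule_ge0 ?lee_fin.
- by rewrite lee_fin.
Qed.


End transfer.

Section transfer2.
Context {d1 d2 d'} {T1 : measurableType d1} {T2 : measurableType d2}
  {S : measurableType d'} {R : realType}.
Import HBNNSimple.
Variables (m1 : {measure set T1 -> \bar R}) (m2 : {measure set T2 -> \bar R}).
Variables (Y1 : T1 -> S) (Y2 : T2 -> S) (h1 : T1 -> R) (h2 : T2 -> R).
Hypotheses (mY1 : measurable_fun [set: T1] Y1) (mY2 : measurable_fun [set: T2] Y2).
Hypotheses (mh1 : measurable_fun [set: T1] h1) (mh2 : measurable_fun [set: T2] h2).
Hypotheses (h10 : forall w, 0 <= h1 w) (h20 : forall w, 0 <= h2 w).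
Hypothesis eqA : forall A, measurable A ->
  (\int[m1]_(w in Y1 @^-1` A) (h1 w)%:E = \int[m2]_(w in Y2 @^-1` A) (h2 w)%:E)%E.

(** Weights on both sides let one statement serve three purposes: passing from [Y i] under P to its
    density under [mu], from the normal law to its density (with [id] as the variable), and
    factoring an expectation under independence. *)
Lemma ge0_integral_transfer (g : S -> \bar R) :
  measurable_fun [set: S] g -> (forall y, 0 <= g y)%E ->
  (\int[m1]_w (g (Y1 w) * (h1 w)%:E) = \int[m2]_w (g (Y2 w) * (h2 w)%:E))%E.
Proof.
move=> mg g0; rewrite (ge0_integral_lim_simple _ mg)// (ge0_integral_lim_simple _ mg)//.
congr (lim (_ @ \oo)); apply/funext => n; apply: eq_fsbigr => r _.
by rewrite eqA.
Qed.

(** No integrability is involved: both sides are differences of integrals of positive and negative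
    parts, and a nonnegative weight factors out of either part. *)
Lemma integral_transfer (g : S -> R) : measurable_fun [set: S] g ->
  (\int[m1]_w (g (Y1 w) * h1 w)%:E = \int[m2]_w (g (Y2 w) * h2 w)%:E)%E.
Proof.
move=> mg; rewrite integralE [RHS]integralE.
have pE (U : Type) (Y : U -> S) (h : U -> R) : (forall w, 0 <= h w) ->
  (((fun w => (g (Y w) * h w)%:E) ^\+ = (fun w => ((EFin \o g)^\+ (Y w)) * (h w)%:E))%E
  * ((fun w => (g (Y w) * h w)%:E) ^\- = (fun w => ((EFin \o g)^\- (Y w)) * (h w)%:E))%E)%type.
  move=> h0; split; apply/funext => w.
    by rewrite !funeposE /= maxe_pMl ?lee_fin// mul0e EFinM.
  by rewrite !funenegE /= maxe_pMl ?lee_fin// mul0e -mulNr EFinM.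
rewrite !(pE _ _ _ h10) !(pE _ _ _ h20).
congr (_ - _)%E; apply: ge0_integral_transfer => //.
- by apply: measurable_funepos; exact/measurable_EFinP.
- by apply: measurable_funeneg; exact/measurable_EFinP.
Qed.

Lemma Rintegral_transfer (g : S -> R) : measurable_fun [set: S] g ->
  \int[m1]_w (g (Y1 w) * h1 w) = \int[m2]_w (g (Y2 w) * h2 w).
Proof. by move=> mg; rewrite /Rintegral integral_transfer. Qed.

Lemma integrable_transfer (g : S -> R) : measurable_fun [set: S] g ->
  m2.-integrable [set: T2] (fun w => (g (Y2 w) * h2 w)%:E) ->
  m1.-integrable [set: T1] (fun w => (g (Y1 w) * h1 w)%:E).
Proof.
move=> mg /integrableP[_ i2]; apply/integrableP; split.
  by apply/measurable_EFinP/measurable_funM => //; exact: measurableT_comp.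
have H : (\int[m1]_x `|g (Y1 x) * h1 x|%:E = \int[m2]_x `|g (Y2 x) * h2 x|%:E)%E.
  transitivity (\int[m1]_w (`|g (Y1 w)|%:E * (h1 w)%:E))%E.
    by apply: eq_integral => w _; rewrite normrM (ger0_norm (h10 _)) EFinM.
  rewrite (ge0_integral_transfer (g := fun y => `|g y|%:E)) //.
    by apply: eq_integral => w _; rewrite normrM (ger0_norm (h20 _)) EFinM.
  by apply/measurable_EFinP; exact: measurableT_comp.
by rewrite [X in (X < _)%E]H.
Qed.

End transfer2.

Lemma cvg_ext (R : realType) (u v : nat -> R) (l : R) :
  (forall n, u n = v n) -> u n @[n --> \oo] --> l -> v n @[n --> \oo] --> l.
Proof. by move=> /funext ->. Qed.

Section expectation_tools.
Context {d} {T : measurableType d} {R : realType} (P : probability T R).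
Implicit Types F G : T -> R.

Definition bounded_measurable F :=
  measurable_fun [set: T] F /\ exists M : R, forall w, `|F w| <= M.

Definition intble F := P.-integrable [set: T] (EFin \o F).

Lemma intble_measurable F : intble F -> measurable_fun [set: T] F.
Proof. by move=> /integrableP[/measurable_EFinP]. Qed.

Lemma intble_cst c : intble (fun=> c).
Proof. exact: finite_measure_integrable_cst. Qed.

Lemma le_intble F G : measurable_fun [set: T] F ->
  (forall w, `|F w| <= G w) -> intble G -> intble F.
Proof.
move=> mF FG iG; apply: le_integrable iG => //; first exact/measurable_EFinP.
by move=> w _ /=; rewrite lee_fin (le_trans (FG w))// ler_norm.
Qed.

Lemma bm_intble F : bounded_measurable F -> intble F.
Proof. by move=> [mF [M FM]]; apply: le_intble mF FM (intble_cst M). Qed.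

Lemma intbleD F G : intble F -> intble G -> intble (fun w => F w + G w).
Proof. by move=> iF iG; exact: (integrableD measurableT iF iG). Qed.

Lemma intbleB F G : intble F -> intble G -> intble (fun w => F w - G w).
Proof. by move=> iF iG; exact: (integrableB measurableT iF iG). Qed.

Lemma intbleZ c F : intble F -> intble (fun w => c * F w).
Proof. by move=> iF; exact: (integrableZl measurableT c iF). Qed.

Lemma intble_norm F : intble F -> intble (fun w => `|F w|).
Proof. by move=> iF; exact: integrable_norm. Qed.

Lemma intble_sum (I : Type) (s : seq I) (F : I -> T -> R) :
  (forall i, intble (F i)) -> intble (fun w => \sum_(i <- s) F i w).
Proof.
move=> iF; elim: s => [|i s IH].
  by rewrite (_ : (fun w => _) = (fun=> 0)); [exact: intble_cst|apply/funext => w; rewrite big_nil].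
rewrite (_ : (fun w => _) = (fun w => F i w + \sum_(i <- s) F i w)).
  exact: intbleD.
by apply/funext => w; rewrite big_cons.
Qed.

Lemma intble_bmM F G : bounded_measurable F -> intble G ->
  intble (fun w => F w * G w).
Proof.
move=> [mF [M FM]] iG.
have iG' : intble (fun w => M * `|G w|) by exact/intbleZ/intble_norm.
apply: le_intble iG' => [|w].
  by apply: measurable_funM => //; exact: intble_measurable.
by rewrite normrM ler_wpM2r.
Qed.

Lemma ExD F G : intble F -> intble G ->
  \int[P]_w (F w + G w) = \int[P]_w F w + \int[P]_w G w.
Proof. exact: RintegralD. Qed.

Lemma ExB F G : intble F -> intble G ->
  \int[P]_w (F w - G w) = \int[P]_w F w - \int[P]_w G w.
Proof. exact: RintegralB. Qed.

Lemma ExZ c F : intble F -> \int[P]_w (c * F w) = c * \int[P]_w F w.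
Proof. exact: RintegralZl. Qed.

Lemma Ex_cst c : \int[P]_w c = c.
Proof. rewrite Rintegral_cst//; transitivity (c * fine (1%E : \bar R)).
  by congr (_ * fine _); exact: probability_setT.
by rewrite mulr1. Qed.

Lemma Ex_sum (I : Type) (s : seq I) (F : I -> T -> R) :
  (forall i, intble (F i)) ->
  \int[P]_w (\sum_(i <- s) F i w) = \sum_(i <- s) \int[P]_w F i w.
Proof.
move=> iF; elim: s => [|i s IH].
  by rewrite big_nil; under eq_Rintegral do rewrite big_nil; rewrite Ex_cst.
rewrite big_cons -IH -ExD//; last exact: intble_sum.
by apply: eq_Rintegral => w _; rewrite big_cons.
Qed.

Lemma le_Ex F G : intble F -> intble G -> (forall w, F w <= G w) ->
  \int[P]_w F w <= \int[P]_w G w.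
Proof. by move=> iF iG FG; exact: le_Rintegral. Qed.

Lemma Ex_ge0 F : (forall w, 0 <= F w) -> 0 <= \int[P]_w F w.
Proof. by move=> F0; exact: Rintegral_ge0. Qed.

Lemma Ex_norm F : intble F -> `|\int[P]_w F w| <= \int[P]_w `|F w|.
Proof. by move=> iF; exact: le_normr_Rintegral. Qed.

Lemma Ex_norm_le F G : intble F -> intble G -> (forall w, `|F w| <= G w) ->
  `|\int[P]_w F w| <= \int[P]_w G w.
Proof.
move=> iF iG FG; apply: (le_trans (Ex_norm iF)); apply: le_Ex => //.
exact: intble_norm.
Qed.

Lemma bm_cst c : bounded_measurable (fun=> c).
Proof. by split; [exact: measurable_cst|exists `|c|]. Qed.

Lemma bmD F G : bounded_measurable F -> bounded_measurable G ->
  bounded_measurable (fun w => F w + G w).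
Proof.
move=> [mF [M FM]] [mG [N GN]]; split; first exact: measurable_funD.
by exists (M + N) => w; rewrite (le_trans (ler_normD _ _))// lerD.
Qed.

Lemma bmM F G : bounded_measurable F -> bounded_measurable G ->
  bounded_measurable (fun w => F w * G w).
Proof.
move=> [mF [M FM]] [mG [N GN]]; split; first exact: measurable_funM.
by exists (M * N) => w; rewrite normrM ler_pM.
Qed.

Lemma bmZ c F : bounded_measurable F -> bounded_measurable (fun w => c * F w).
Proof. by move=> bF; exact/bmM/bF/bm_cst. Qed.

Lemma bm_indic A : measurable A -> bounded_measurable \1_A.
Proof.
move=> mA; split; first exact: measurable_indic.
by exists 1 => w; rewrite indicE; case: (w \in A); rewrite ?normr1 ?normr0.
Qed.

Lemma measurable_cos (X : T -> R) : measurable_fun [set: T] X ->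
  measurable_fun [set: T] (fun w => cos (X w)).
Proof.
move=> mX; apply: (measurableT_comp (f := @cos R)) => //.
by apply: continuous_measurable_fun; exact: continuous_cos.
Qed.

Lemma measurable_sin (X : T -> R) : measurable_fun [set: T] X ->
  measurable_fun [set: T] (fun w => sin (X w)).
Proof.
move=> mX; apply: (measurableT_comp (f := @sin R)) => //.
by apply: continuous_measurable_fun; exact: continuous_sin.
Qed.

Lemma bm_cos (X : T -> R) : measurable_fun [set: T] X ->
  bounded_measurable (fun w => cos (X w)).
Proof.
by move=> mX; split; [exact: measurable_cos|exists 1 => w; exact: cos_max].
Qed.

Lemma bm_sin (X : T -> R) : measurable_fun [set: T] X ->
  bounded_measurable (fun w => sin (X w)).
Proof.
by move=> mX; split; [exact: measurable_sin|exists 1 => w; exact: sin_max].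
Qed.

Lemma measurable_expR (X : T -> R) : measurable_fun [set: T] X ->
  measurable_fun [set: T] (fun w => expR (X w)).
Proof. by move=> mX; exact: measurableT_comp. Qed.

Lemma bm_expRN (X : T -> R) : measurable_fun [set: T] X ->
  (forall w, 0 <= X w) -> bounded_measurable (fun w => expR (- X w)).
Proof.
move=> mX X0; split; first by apply: measurable_expR; exact: measurable_funN.
by exists 1 => w; rewrite ger0_norm ?expR_ge0// expR_le1 oppr_le0.
Qed.

Lemma Ex_indic A : measurable A -> \int[P]_w \1_A w = fine (P A).
Proof. by move=> mA; rewrite /Rintegral integral_indic// setIT. Qed.

Lemma measurable_set_le F G : measurable_fun [set: T] F ->
  measurable_fun [set: T] G -> measurable [set w | F w <= G w].
Proof.
by move=> mF mG; rewrite -[X in measurable X]setTI; exact: measurable_fun_le.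
Qed.

Lemma measurable_set_lt F G : measurable_fun [set: T] F ->
  measurable_fun [set: T] G -> measurable [set w | F w < G w].
Proof.
move=> mF mG; rewrite (_ : [set _ | _] = ~` [set w | G w <= F w]).
  by apply: measurableC; exact: measurable_set_le.
by apply/seteqP; split => w /=; [rewrite ltNge => /negP|move=> /negP; rewrite -ltNge].
Qed.

Lemma Ex_eq_ae (A : set T) F G : measurable A -> P (~` A) = 0%E ->
  measurable_fun [set: T] F -> measurable_fun [set: T] G ->
  (forall w, A w -> F w = G w) -> \int[P]_w F w = \int[P]_w G w.
Proof.
move=> mA A0 mF mG FG; congr fine; apply: ae_eq_integral => //.
- exact/measurable_EFinP.
- exact/measurable_EFinP.
- exists (~` A); split => //; first exact: measurableC.
  by move=> w /= h Aw; apply: h => _; rewrite FG.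
Qed.

Lemma le_Ex_ae (A : set T) F G : measurable A -> P (~` A) = 0%E ->
  intble F -> intble G -> (forall w, A w -> F w <= G w) ->
  \int[P]_w F w <= \int[P]_w G w.
Proof.
move=> mA A0 iF iG FG.
have iA H : intble H -> intble (fun w => \1_A w * H w).
  by apply: intble_bmM; exact: bm_indic.
have EA H : intble H -> \int[P]_w H w = \int[P]_w (\1_A w * H w).
  move=> iH; apply: (Ex_eq_ae mA A0); try exact: intble_measurable.
    exact/intble_measurable/iA.
  by move=> w Aw; rewrite indicE mem_set// mul1r.
rewrite EA// [leRHS]EA//; apply: le_Ex; [exact: iA|exact: iA|] => w.
rewrite indicE; case: (boolP (w \in A)); rewrite ?mul0r// inE => Aw.
by rewrite !mul1r FG.
Qed.

Lemma Ex_markov F c : intble F -> (forall w, 0 <= F w) -> 0 < c ->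
  fine (P [set w | c <= F w]) <= (\int[P]_w F w) / c.
Proof.
move=> iF F0 c0.
have mA : measurable [set w | c <= F w].
  by apply: measurable_set_le => //; exact: intble_measurable.
rewrite -Ex_indic// ler_pdivlMr// mulrC -ExZ; last exact/bm_intble/bm_indic.
apply: le_Ex => //; first exact/intbleZ/bm_intble/bm_indic.
move=> w; rewrite indicE; case: (boolP (w \in _)); rewrite ?mulr1 ?mulr0//.
by rewrite inE.
Qed.

End expectation_tools.

(** * Independence and the Lindeberg theorem *)

Section independence.
Context {d d'} {T : measurableType d} {S : measurableType d'} {R : realType}.
Variables (P : probability T R) (Y : nat -> {RV P >-> S}).
Hypothesis hindep : mutually_independent P Y.

Let evt (I : {fset nat}) (A : nat -> set S) :=
  \bigcap_(i in [set` I]) Y i @^-1` A i.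

Let pr (I : {fset nat}) (A : nat -> set S) : R :=
  \prod_(i <- I) fine (P (Y i @^-1` A i)).

Let mY k : measurable_fun [set: T] (Y k).
Proof. exact: measurable_funPT. Qed.

Let mevt I A : (forall i, measurable (A i)) -> measurable (evt I A).
Proof.
by move=> mA; apply: bigcap_measurableType => i _; exact: measurable_funPTI.
Qed.

Lemma integral_EFin_indic (F : T -> R) (D : set T) : measurable D -> intble P F ->
  (\int[P]_(w in D) (F w)%:E = (\int[P]_w (F w * \1_D w))%:E)%E.
Proof.
move=> mD iF.
have iFD : intble P (fun w => F w * \1_D w).
  rewrite (_ : (fun w => _) = (fun w => \1_D w * F w)).
    by apply: intble_bmM => //; exact: bm_indic.
  by apply/funext => w; rewrite mulrC.
rewrite /Rintegral fineK; last exact: integrable_fin_num.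
rewrite [LHS]integral_mkcond; apply: eq_integral => w _.
by rewrite patchE indicE; case: (w \in D); rewrite ?mulr1 ?mulr0.
Qed.

(** Independence of F from the sigma-algebra of Y_k, Y_(k+1), ..., tested on generating events only.
    This form is linear in F and survives multiplication by a bounded function of Y_k at the price
    of raising k by one, which is what inductions over partial sums require. *)
Definition independent_of_tail (k : nat) (F : T -> R) :=
  bounded_measurable F /\
  forall (I : {fset nat}) (A : nat -> set S), (forall i, measurable (A i)) ->
    (forall i, i \in I -> (k <= i)%N) ->
    \int[P]_w (F w * \1_(evt I A) w) = (\int[P]_w F w) * pr I A.

Lemma iot_bm k F : independent_of_tail k F -> bounded_measurable F.
Proof. by case. Qed.

Lemma iot_cst k c : independent_of_tail k (fun=> c).
Proof.
split; first exact: bm_cst.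
move=> I A mA _; rewrite ExZ; last exact/bm_intble/bm_indic/mevt.
by rewrite Ex_indic; [rewrite Ex_cst hindep|exact: mevt].
Qed.

Lemma iotD k F G : independent_of_tail k F -> independent_of_tail k G ->
  independent_of_tail k (fun w => F w + G w).
Proof.
move=> [bF hF] [bG hG]; split; first exact: bmD.
move=> I A mA Ik; under eq_Rintegral do rewrite mulrDl.
have bI := bm_indic (R := R) (mevt I mA).
by rewrite !ExD ?hF ?hG ?mulrDl//; do ?exact: bm_intble;
  apply: bm_intble; exact: bmM.
Qed.

Lemma iotZ k c F : independent_of_tail k F ->
  independent_of_tail k (fun w => c * F w).
Proof.
move=> [bF hF]; split; first exact: bmZ.
move=> I A mA Ik; under eq_Rintegral do rewrite -mulrA.
have bI := bm_indic (R := R) (mevt I mA).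
rewrite !ExZ ?hF ?mulrA//; first exact: bm_intble.
by apply: bm_intble; exact: bmM.
Qed.

Lemma iotB k F G : independent_of_tail k F -> independent_of_tail k G ->
  independent_of_tail k (fun w => F w - G w).
Proof.
move=> hF hG; rewrite (_ : (fun w => _) = (fun w => F w + (-1) * G w)).
  by apply: iotD => //; exact: iotZ.
by apply/funext => w; rewrite mulN1r.
Qed.

(** With I and A fixed, the hypothesis on F applied to the index set I enlarged by k, with the event
    [B] placed at index k, says that the integral of F times the indicator of the tail event over
    {Y_k in B} is a constant times P(Y_k in B). Transfer of integrals extends this from [B] to [g];
    it needs a nonnegative weight, hence the sign condition on F. *)
Let ge0_step k F (g : S -> R) (I : {fset nat}) (A : nat -> set S) :
  independent_of_tail k F -> (forall w, 0 <= F w) -> measurable_fun [set: S] g ->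
  (forall i, measurable (A i)) -> (forall i, i \in I -> (k < i)%N) ->
  intble P (g \o Y k) ->
  \int[P]_w (g (Y k w) * (F w * \1_(evt I A) w)) =
    (\int[P]_w F w) * (\int[P]_w g (Y k w)) * pr I A.
Proof.
move=> [bF hF] F0 mg mA Ik ig.
have bI := bm_indic (R := R) (mevt I mA).
have pr0 : 0 <= pr I A by apply: prodr_ge0 => i _; rewrite fine_ge0.
rewrite (@Rintegral_transfer _ _ _ T T S R P P (Y k) (Y k)
  (fun w => F w * \1_(evt I A) w) (fun=> (\int[P]_w F w) * pr I A)) //.
- under eq_Rintegral do rewrite mulrC.
  by rewrite ExZ// mulrAC.
- by case: (bmM bF bI).
- by move=> w; rewrite mulr_ge0// indicE.
- by move=> w; rewrite mulr_ge0// Ex_ge0.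
- move=> B mB.
  have mYB : measurable (Y k @^-1` B) by exact: measurable_funPTI.
  rewrite !integral_EFin_indic//; first last.
  + exact/bm_intble/bmM.
  + exact: intble_cst.
  congr EFin; rewrite ExZ; last exact/bm_intble/bm_indic.
  rewrite Ex_indic//.
  pose A' i := if i == k then B else A i.
  have kI : k \notin I by apply/negP => /Ik; rewrite ltnn.
  have := hF (k |` I)%fset A'; rewrite /pr big_fsetU1//=.
  rewrite (eq_big_seq (fun i => fine (P (Y i @^-1` A i)))); last first.
    move=> i iI; rewrite /A'; case: eqP => // ik.
    by move: kI; rewrite -ik iI.
  rewrite (_ : A' k = B); last by rewrite /A' eqxx.
  move=> H; rewrite -mulrA [X in _ * X]mulrC -H; last 2 first.
  + by move=> i; rewrite /A'; case: ifP.
  + by move=> i; rewrite !inE => /orP[/eqP ->//|/Ik /ltnW].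
  apply: eq_Rintegral => w _; rewrite -mulrA; congr (_ * _).
  rewrite -[RHS](_ : \1_(evt I A `&` Y k @^-1` B) w = _); last first.
    congr (\1_ _ w); rewrite predeqE => t; rewrite /evt; split.
    * move=> [h1 h2] i/=; rewrite !inE => /orP[/eqP ->|iI].
        by rewrite /A' eqxx.
      rewrite /A'; case: eqP => [ik|_]; last exact: h1.
      by move: kI; rewrite -ik iI.
    * move=> h; split.
        move=> i/= iI; have := h i; rewrite /= !inE iI orbT => /(_ isT).
        rewrite /A'; case: eqP => // ik.
        by move: kI; rewrite -ik iI.
      by have := h k; rewrite /= !inE eqxx => /(_ isT); rewrite /A' eqxx.
  by rewrite indicI.
Qed.

Let step k F (g : S -> R) (I : {fset nat}) (A : nat -> set S) :
  independent_of_tail k F -> bounded_measurable g ->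
  (forall i, measurable (A i)) -> (forall i, i \in I -> (k < i)%N) ->
  \int[P]_w (F w * g (Y k w) * \1_(evt I A) w) =
    (\int[P]_w F w) * (\int[P]_w g (Y k w)) * pr I A.
Proof.
move=> hF [mg [N gN]] mA Ik; have [mF [M FM]] := iot_bm hF.
have bg : bounded_measurable (g \o Y k).
  by split; [exact: measurableT_comp|exists N => w; exact: gN].
have bI := bm_indic (R := R) (mevt I mA).
have bF : bounded_measurable F by exact: iot_bm hF.
(* Shifting F by the constant [|M|] makes it nonnegative. The constant is itself independent of the
   tail, so its contribution can be subtracted again. *)
have M0 w : 0 <= F w + `|M|.
  have := FM w; rewrite ler_norml => /andP[+ _]; have := ler_norm M; lra.
have H1 := ge0_step (iotD hF (iot_cst k `|M|)) M0 mg mA Ik (bm_intble P bg).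
have H2 := ge0_step (iot_cst k `|M|) (fun=> normr_ge0 M) mg mA Ik (bm_intble P bg).
transitivity (\int[P]_w (g (Y k w) * ((F w + `|M|) * \1_(evt I A) w)) -
   \int[P]_w (g (Y k w) * (`|M| * \1_(evt I A) w))).
  rewrite -ExB.
  - by apply: eq_Rintegral => w _; ring.
  - apply/bm_intble/(bmM bg)/bmM => //; exact/bmD/bm_cst.
  - by apply/bm_intble/(bmM bg)/bmM => //; exact: bm_cst.
rewrite H1 H2 -mulrBl -mulrBl ExD ?Ex_cst ?addrK//; last exact: intble_cst.
exact: bm_intble.
Qed.

Lemma Ex_iotM k F (g : S -> R) :
  independent_of_tail k F -> bounded_measurable g ->
  \int[P]_w (F w * g (Y k w)) = (\int[P]_w F w) * (\int[P]_w g (Y k w)).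
Proof.
move=> hF bg.
have := @step k F g fset0 (fun=> setT) hF bg (fun=> measurableT).
rewrite /pr big_seq_fset0 mulr1 => <- //.
apply: eq_Rintegral => w _; rewrite /evt indicE mem_set ?mulr1//.
Qed.

Lemma iotM k F (g : S -> R) :
  independent_of_tail k F -> bounded_measurable g ->
  independent_of_tail k.+1 (fun w => F w * g (Y k w)).
Proof.
move=> hF bg; split.
  apply: bmM; first exact: iot_bm hF.
  case: bg => mg [N gN].
  by split; [exact: measurableT_comp|exists N => w; exact: gN].
by move=> I A mA Ik; rewrite step// Ex_iotM.
Qed.

End independence.

(** * Taylor bounds for cosine, sine and the exponential *)

Section elementary_bounds.
Context {R : realType}.
Implicit Types x s : R.

(** The Taylor bounds below form chains in which each expression is the derivative of the next and
    all vanish at 0, so their signs propagate. *)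
Lemma derive_ge0_from0 (f f' : R -> R) : (forall x, is_derive x 1 f (f' x)) ->
  f 0 = 0 -> (forall x, 0 <= x -> 0 <= f' x) -> forall x, 0 <= x -> 0 <= f x.
Proof.
move=> df f0 f'0 x; rewrite le_eqVlt => /orP[/eqP <-|x0]; first by rewrite f0.
have cf : {within `[0, x], continuous f}.
  by apply: derivable_within_continuous => y _; exact: ex_derive.
have [c + ] := MVT x0 (fun y _ => df y) cf.
rewrite in_itv /= => /andP[c0 _]; rewrite f0 !subr0 => ->.
by rewrite mulr_ge0 ?(ltW x0)// f'0// ltW.
Qed.

Lemma le_sin_id x : 0 <= x -> 0 <= x - sin x.
Proof.
apply: (@derive_ge0_from0 (fun x => x - sin x) (fun x => 1 - cos x)).
- by rewrite sin0 subr0.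
- by move=> y _; rewrite subr_ge0 cos_le1.
Qed.

Lemma cos_ge_2 x : 0 <= x -> 0 <= cos x - 1 + x ^+ 2 / 2.
Proof.
apply: (@derive_ge0_from0 (fun x => cos x - 1 + x ^+ 2 / 2) (fun x => x - sin x)).
- move=> y; apply: is_derive_eq.
  by rewrite !scaler1 /GRing.scale /=; lra.
- by rewrite cos0; lra.
- exact: le_sin_id.
Qed.

Lemma sin_ge_3 x : 0 <= x -> 0 <= sin x - x + x ^+ 3 / 6.
Proof.
apply: (@derive_ge0_from0 (fun x => sin x - x + x ^+ 3 / 6)
  (fun x => cos x - 1 + x ^+ 2 / 2)).
- move=> y; apply: is_derive_eq.
  by rewrite !scaler1 /GRing.scale /=; lra.
- by rewrite sin0; lra.
- exact: cos_ge_2.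
Qed.

Lemma cos_le_4 x : 0 <= x -> 0 <= x ^+ 4 / 24 - x ^+ 2 / 2 + 1 - cos x.
Proof.
apply: (@derive_ge0_from0 (fun x => x ^+ 4 / 24 - x ^+ 2 / 2 + 1 - cos x)
  (fun x => sin x - x + x ^+ 3 / 6)).
- move=> y; apply: is_derive_eq.
  by rewrite !scaler1 /GRing.scale /=; lra.
- by rewrite cos0; lra.
- exact: sin_ge_3.
Qed.

Lemma cos_ge_1 x : 0 <= x -> 0 <= x - 1 + cos x.
Proof.
apply: (@derive_ge0_from0 (fun x => x - 1 + cos x) (fun x => 1 - sin x)).
- move=> y; apply: is_derive_eq.
  by rewrite /=; lra.
- by rewrite cos0; lra.
- by move=> y _; rewrite subr_ge0 sin_le1.
Qed.

Lemma sin_ge_2 x : 0 <= x -> 0 <= x ^+ 2 / 2 - x + sin x.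
Proof.
apply: (@derive_ge0_from0 (fun x => x ^+ 2 / 2 - x + sin x)
  (fun x => x - 1 + cos x)).
- move=> y; apply: is_derive_eq.
  by rewrite !scaler1 /GRing.scale /=; lra.
- by rewrite sin0; lra.
- exact: cos_ge_1.
Qed.

Lemma expRN_ge_1 s : 0 <= s -> 0 <= expR (- s) - 1 + s.
Proof. by have := expR_ge1Dx (- s); lra. Qed.

Lemma expRN_le_2 s : 0 <= s -> 0 <= s ^+ 2 / 2 - (expR (- s) - 1 + s).
Proof.
apply: (@derive_ge0_from0 (fun s => s ^+ 2 / 2 - (expR (- s) - 1 + s))
  (fun s => expR (- s) - 1 + s)).
- move=> y; apply: is_derive_eq.
  by rewrite !scaler1 /GRing.scale /=; lra.
- by rewrite oppr0 expR0; lra.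
- exact: expRN_ge_1.
Qed.

(** For |x| <= e the remainder is at most x^4/24, and x^2 <= e because e <= 1; for larger |x| the
    crude bound x^2/2 suffices. The last term is shaped like a summand of the Lindeberg
    condition. *)
Lemma cos_taylor_lindeberg e x : 0 < e -> e <= 1 ->
  `|cos x - 1 + x ^+ 2 / 2| <= e * x ^+ 2 + x ^+ 2 * (e < `|x|)%R%:R.
Proof.
move=> e0 e1; wlog x0 : x / 0 <= x.
  move=> H; have [/H//|x0] := leP 0 x.
  by have := H (- x); rewrite cosN sqrrN normrN; apply; rewrite oppr_ge0 ltW.
have h2 := cos_ge_2 x0; have h4 := cos_le_4 x0.
rewrite ger0_norm// ger0_norm//; case: ltP => /= [ex|xe].
  by have := cos_le1 x; have := sqr_ge0 x; nra.
have := sqr_ge0 x; rewrite mulr0 addr0.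
have xx : x ^+ 2 <= e by rewrite expr2; nra.
move: h4; have -> : x ^+ 4 = x ^+ 2 * x ^+ 2 by ring.
by set q := x ^+ 2 in xx h2 *; nra.
Qed.

Lemma sin_taylor_lindeberg e x : 0 < e ->
  `|sin x - x| <= e * x ^+ 2 + x ^+ 2 * (e < `|x|)%R%:R.
Proof.
move=> e0; wlog x0 : x / 0 <= x.
  move=> H; have [/H//|x0] := leP 0 x.
  have := H (- x); rewrite sinN sqrrN normrN -opprD normrN; apply.
  by rewrite oppr_ge0 ltW.
have h1 := le_sin_id x0; have h2 := sin_ge_2 x0; have h3 := sin_ge_3 x0.
rewrite distrC ger0_norm// ger0_norm//; case: ltP => /= [ex|xe].
  by have := sqr_ge0 x; nra.
have := sqr_ge0 x; rewrite mulr0 addr0.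
move: h3; have -> : x ^+ 3 = x ^+ 2 * x by ring.
by nra.
Qed.

End elementary_bounds.

(** * The Lindeberg theorem for triangular arrays, in cosine form *)

Section lindeberg.
Context {d d'} {T : measurableType d} {S : measurableType d'} {R : realType}.
Variables (P : probability T R) (Y : nat -> {RV P >-> S}).
Hypothesis hindep : mutually_independent P Y.

Let mY k : measurable_fun [set: T] (Y k).
Proof. exact: measurable_funPT. Qed.

Section partial_sums.
Variables (x : nat -> S -> R) (delta s : nat -> R).
Hypothesis mx : forall i, measurable_fun [set: S] (x i).
Hypothesis hs : forall i, 0 <= s i.
Hypothesis hcos : forall i,
  `|\int[P]_w cos (x i (Y i w)) - expR (- s i)| <= delta i.
Hypothesis hsin : forall i, `|\int[P]_w sin (x i (Y i w))| <= delta i.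

Let Sum k w := \sum_(i < k) x i (Y i w).

Let SumS k w : Sum k.+1 w = Sum k w + x k (Y k w).
Proof. by rewrite /Sum big_ord_recr. Qed.

(** Cosine and sine must be carried together because the addition formulas mix them. *)
Lemma iot_cos_sin_sum k : independent_of_tail Y k (fun w => cos (Sum k w)) /\
  independent_of_tail Y k (fun w => sin (Sum k w)).
Proof.
elim: k => [|k [IHc IHs]].
  split.
    rewrite (_ : (fun w => _) = (fun=> cos 0)); first exact: iot_cst.
    by apply/funext => w; rewrite /Sum big_ord0.
  rewrite (_ : (fun w => _) = (fun=> sin 0)); first exact: iot_cst.
  by apply/funext => w; rewrite /Sum big_ord0.
have bc := bm_cos (mx k); have bs := bm_sin (mx k).
split.
  rewrite (_ : (fun w => _) = (fun w => cos (Sum k w) * (cos \o x k) (Y k w)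
     - sin (Sum k w) * (sin \o x k) (Y k w))).
    by apply: iotB => //; exact: iotM.
  by apply/funext => w; rewrite SumS cosD.
rewrite (_ : (fun w => _) = (fun w => sin (Sum k w) * (cos \o x k) (Y k w)
     + cos (Sum k w) * (sin \o x k) (Y k w))).
  by apply: iotD => //; exact: iotM.
by apply/funext => w; rewrite SumS sinD.
Qed.

(** The telescoping comparison of products of characteristic functions, written in real terms. Each
    new summand costs the sine one [delta]. It costs the cosine two: one for replacing E cos(x_k) by
    exp(-s_k), and one for the product of the two sine expectations in the addition formula. *)
Lemma Ex_cos_sum k :
  `|\int[P]_w cos (Sum k w) - expR (- \sum_(i < k) s i)| <= 2 * \sum_(i < k) delta i
  /\ `|\int[P]_w sin (Sum k w)| <= \sum_(i < k) delta i.
Proof.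
elim: k => [|k [IHc IHs]].
  rewrite !big_ord0 oppr0 expR0 mulr0.
  under eq_Rintegral do rewrite /Sum big_ord0 cos0.
  under [in X in _ /\ X]eq_Rintegral do rewrite /Sum big_ord0 sin0.
  by rewrite !Ex_cst subrr normr0.
have bc := bm_cos (mx k); have bs := bm_sin (mx k).
have [ic is_] := iot_cos_sin_sum k.
have bSc := iot_bm ic; have bSs := iot_bm is_.
have bxc := bm_cos (measurableT_comp (mx k) (mY k)).
have bxs := bm_sin (measurableT_comp (mx k) (mY k)).
under eq_Rintegral do rewrite SumS cosD.
under [in X in _ /\ X]eq_Rintegral do rewrite SumS sinD.
rewrite ExB ?ExD; try by apply: bm_intble; exact: bmM.
rewrite (Ex_iotM hindep ic bc) (Ex_iotM hindep is_ bs).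
rewrite (Ex_iotM hindep is_ bc) (Ex_iotM hindep ic bs) !big_ord_recr /=.
have hc1 : `|\int[P]_w cos (Sum k w)| <= 1.
  rewrite -[leRHS](Ex_cst P 1); apply: Ex_norm_le.
  - exact: bm_intble.
  - exact: intble_cst.
  - by move=> w; exact: cos_max.
have hc2 : `|\int[P]_w cos (x k (Y k w))| <= 1.
  rewrite -[leRHS](Ex_cst P 1); apply: Ex_norm_le.
  - exact: bm_intble.
  - exact: intble_cst.
  - by move=> w; exact: cos_max.
have e1 : expR (- s k) <= 1 by rewrite expR_le1 oppr_le0.
have e0 : 0 < expR (- s k) := expR_gt0 _.
move: (hcos k) (hsin k) IHc IHs => /=; rewrite opprD expRD.
have d0 : 0 <= delta k := le_trans (normr_ge0 _) (hsin k).
set A := Rintegral _ _ _ in hc2 *; set D := Rintegral _ _ _.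
set C := Rintegral _ _ _ in hc1 *; set E := expR (- \sum_(i < k) _).
set e := expR (- s k) in e1 e0 *.
set B := Rintegral _ _ _ => h1 h2 h3 h4.
split; last first.
  rewrite (le_trans (ler_normD _ _))// !normrM lerD//.
    by rewrite (le_trans _ h4)// ler_piMr.
  by rewrite (le_trans _ h2)// ler_piMl.
rewrite (_ : _ - _ = (C - E) * e + C * (A - e) - B * D); last by ring.
have b1 : `|B| <= 1.
  rewrite -[leRHS](Ex_cst P 1); apply: Ex_norm_le.
  - exact: bm_intble.
  - exact: intble_cst.
  - by move=> w; exact: sin_max.
rewrite (le_trans (ler_normB _ _))//.
rewrite [leRHS](_ : _ = 2 * \sum_(i < k) delta i + delta k + delta k); last by ring.
rewrite lerD//; last by rewrite normrM (le_trans _ h2)// ler_piMl.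
rewrite (le_trans (ler_normD _ _))// !normrM lerD//.
  by rewrite (le_trans _ h3)// ler_piMr// ger0_norm// ltW.
by rewrite (le_trans _ h1)// ler_piMl.
Qed.

End partial_sums.

(** The part e s + L is the expected Taylor remainder. The part s (e^2 + L) bounds the distance
    s^2/8 between exp(-s/2) and 1 - s/2, where s <= e^2 + L follows by splitting at |X| = e. The
    sine receives the same bound so that a single [delta] can feed [Ex_cos_sum]. *)
Lemma Ex_trig_lindeberg (X : T -> R) e : measurable_fun [set: T] X ->
  intble P (fun w => X w ^+ 2) -> \int[P]_w X w = 0 -> 0 < e -> e <= 1 ->
  let s := \int[P]_w X w ^+ 2 in
  let L := \int[P]_w (X w ^+ 2 * \1_[set w | e < `|X w|] w) in
  [/\ `|\int[P]_w cos (X w) - expR (- (s / 2))| <= e * s + L + s * (e ^+ 2 + L),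
      `|\int[P]_w sin (X w)| <= e * s + L + s * (e ^+ 2 + L) & 0 <= L].
Proof.
move=> mX iX2 X0 e0 e1 s L.
have iX : intble P X.
  have : intble P (fun w => 1 + X w ^+ 2) by apply: intbleD => //; exact: intble_cst.
  apply: le_intble => // w; rewrite ler_norml; have := sqr_ge0 (X w - 1).
  by have := sqr_ge0 (X w + 1); rewrite !expr2; nra.
have mE : measurable [set w | e < `|X w|].
  by apply: measurable_set_lt => //; exact: measurableT_comp.
have iL : intble P (fun w => X w ^+ 2 * \1_[set w | e < `|X w|] w).
  under [X in intble _ X]eq_fun do rewrite mulrC.
  by apply: intble_bmM => //; exact: bm_indic.
have s0 : 0 <= s by apply: Ex_ge0 => w; exact: sqr_ge0.
have L0 : 0 <= L by apply: Ex_ge0 => w; rewrite mulr_ge0// ?sqr_ge0// indicE.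
have iD : intble P (fun w => e * X w ^+ 2 + X w ^+ 2 * \1_[set w | e < `|X w|] w).
  by apply: intbleD => //; exact: intbleZ.
have ED : \int[P]_w (e * X w ^+ 2 + X w ^+ 2 * \1_[set w | e < `|X w|] w) = e * s + L.
  by rewrite ExD ?ExZ//; exact: intbleZ.
have indE w : \1_[set w | e < `|X w|] w = (e < `|X w|)%R%:R :> R.
  rewrite indicE; congr (_ %:R); congr nat_of_bool.
  by apply/idP/idP; rewrite inE.
have icos : intble P (fun w => cos (X w)) by apply/bm_intble/bm_cos.
have isin : intble P (fun w => sin (X w)) by apply/bm_intble/bm_sin.
have sle : s <= e ^+ 2 + L.
  rewrite -[e ^+ 2](Ex_cst P) -ExD//; last exact: intble_cst.
  apply: le_Ex => //; first by apply: intbleD => //; exact: intble_cst.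
  move=> w; rewrite indE; case: ltP => /= [_|xe].
    by rewrite mulr1 lerDr sqr_ge0.
  by rewrite mulr0 addr0 -real_normK ?num_real// lerXn2r// nnegrE ltW.
split => //; last first.
  rewrite -[X in `|X|]subr0 -X0 -ExB//.
  apply: (@le_trans _ _ (e * s + L)); last first.
    by rewrite lerDl mulr_ge0// (le_trans s0).
  rewrite -ED; apply: Ex_norm_le => //; first exact: intbleB.
  by move=> w; rewrite indE; exact: sin_taylor_lindeberg.
rewrite (_ : _ - _ = (\int[P]_w (cos (X w) - 1 + X w ^+ 2 / 2)) -
   (expR (- (s / 2)) - 1 + s / 2)); last first.
  rewrite ExD; first last.
  - by under [X in intble _ X]eq_fun do rewrite mulrC; exact: intbleZ.
  - by apply: intbleB => //; exact: intble_cst.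
  rewrite ExB//; last exact: intble_cst.
  under [\int[P]_w (X w ^+ 2 / 2)]eq_Rintegral do rewrite mulrC.
  by rewrite ExZ// Ex_cst -/s; ring.
rewrite (le_trans (ler_normB _ _))// lerD//.
  rewrite -ED; apply: Ex_norm_le => //.
    apply: intbleD; first by apply: intbleB => //; exact: intble_cst.
    by under [X in intble _ X]eq_fun do rewrite mulrC; exact: intbleZ.
  by move=> w; rewrite indE; exact: cos_taylor_lindeberg.
have s20 : 0 <= s / 2 by rewrite divr_ge0.
rewrite ger0_norm; last exact: expRN_ge_1.
by have := expRN_le_2 s20; rewrite !expr2; nra.
Qed.

Theorem lindeberg_cos (x : nat -> nat -> S -> R) (s2 : R) :
  (forall n i, measurable_fun [set: S] (x n i)) ->
  (forall n i, (i < n)%N -> intble P (fun w => x n i (Y i w) ^+ 2)) ->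
  (forall n i, (i < n)%N -> \int[P]_w x n i (Y i w) = 0) ->
  (forall n, (0 < n)%N -> \sum_(i < n) \int[P]_w (x n i (Y i w) ^+ 2) = s2) ->
  (forall e, 0 < e -> \sum_(i < n) \int[P]_w (x n i (Y i w) ^+ 2 *
      \1_[set w | e < `|x n i (Y i w)|] w) @[n --> \oo] --> 0) ->
  \int[P]_w cos (\sum_(i < n) x n i (Y i w)) @[n --> \oo] --> expR (- (s2 / 2)).
Proof.
move=> mx ix2 x0 hs2 hL.
have s20 : 0 <= s2.
  rewrite -(hs2 1%N)//; apply: sumr_ge0 => i _; apply: Ex_ge0 => w; exact: sqr_ge0.
apply/cvgrPdist_le => /= r r0.
(* The total error will be at most 2 (e s2 + LL + s2 (e^2 + LL)), with LL the Lindeberg sum at level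
   e. This choice of e spends half of r on the terms without LL; the bound r / (4 (1 + s2)) on LL
   spends the other half. *)
pose e := Num.min 1 (r / (4 * (1 + 2 * s2))).
have e0 : 0 < e by rewrite lt_min ltr01/= divr_gt0// mulr_gt0//; lra.
have e1 : e <= 1 by rewrite ge_min lexx.
have er : 2 * (e * s2 + s2 * e ^+ 2) <= r / 2.
  have : e <= r / (4 * (1 + 2 * s2)) by rewrite ge_min lexx orbT.
  rewrite ler_pdivlMr; last by nra.
  by have := ltW e0; rewrite expr2; nra.
have r' : 0 < r / (4 * (1 + s2)) by rewrite divr_gt0//; lra.
have /cvgrPdist_le /(_ _ r') := hL _ e0.
move=> H; near=> n; have n0 : (0 < n)%N by near: n; exact: nbhs_infty_gt.
have : `|0 - \sum_(i < n) \int[P]_w (x n i (Y i w) ^+ 2 *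
      \1_[set w | e < `|x n i (Y i w)|] w)| <= r / (4 * (1 + s2)).
  by near: n.
set LL := \sum_(i < n) _; rewrite sub0r normrN => LLr.
pose s i := \int[P]_w (x n i (Y i w) ^+ 2).
pose L i := \int[P]_w (x n i (Y i w) ^+ 2 * \1_[set w | e < `|x n i (Y i w)|] w).
have B i : (i < n)%N -> _ := fun h => Ex_trig_lindeberg
  (measurableT_comp (mx n i) (mY i)) (ix2 n i h) (x0 n i h) e0 e1.
(* [Ex_cos_sum] asks for bounds at all indices while row n is controlled only for i < n, so the row
   is extended by zero. *)
pose y i := if (i < n)%N then x n i else cst 0.
pose sy i := if (i < n)%N then s i / 2 else 0.
pose dy i := if (i < n)%N then e * s i + L i + s i * (e ^+ 2 + L i) else 0.
have my i : measurable_fun [set: S] (y i) by rewrite /y; case: ifP.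
have sy0 i : 0 <= sy i.
  rewrite /sy; case: ifP => // _; rewrite divr_ge0//.
  by apply: Ex_ge0 => w; exact: sqr_ge0.
have hcy i : `|\int[P]_w cos (y i (Y i w)) - expR (- sy i)| <= dy i.
  rewrite /y /sy /dy; case: ifP => [|_]; first by move/B => [].
  under eq_Rintegral do rewrite /cst cos0.
  by rewrite Ex_cst oppr0 expR0 subrr normr0.
have hsy i : `|\int[P]_w sin (y i (Y i w))| <= dy i.
  rewrite /y /dy; case: ifP => [|_]; first by move/B => [].
  under eq_Rintegral do rewrite /cst sin0.
  by rewrite Ex_cst normr0.
have [+ _] := Ex_cos_sum my sy0 hcy hsy n.
have -> : \sum_(i < n) sy i = s2 / 2.
  rewrite -(hs2 n n0) mulr_suml; apply: eq_bigr => i _.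
  by rewrite /sy ltn_ord.
have -> : (fun w => cos (\sum_(i < n) y i (Y i w))) =
    (fun w => cos (\sum_(i < n) x n i (Y i w))).
  apply/funext => w; congr cos; apply: eq_bigr => i _.
  by rewrite /y ltn_ord.
rewrite distrC => /le_trans; apply.
have L0 (i : 'I_n) : 0 <= L i by have [] := B i (ltn_ord i).
have LLE : LL = \sum_(i < n) L i by [].
have LL0 : 0 <= LL by rewrite LLE sumr_ge0.
have -> : \sum_(i < n) dy i = \sum_(i < n) (e * s i + L i + s i * (e ^+ 2 + L i)).
  by apply: eq_bigr => i _; rewrite /dy ltn_ord.
apply: (@le_trans _ _ (2 * (e * s2 + LL + s2 * (e ^+ 2 + LL)))).
  rewrite ler_pM2l// -(hs2 n n0) mulr_sumr LLE -big_split/= mulr_suml -big_split/=.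
  apply: ler_sum => i _; rewrite lerD// ler_wpM2l//.
    by apply: Ex_ge0 => w; exact: sqr_ge0.
  by rewrite lerD// (bigD1 i)//= lerDl sumr_ge0.
move: LLr; rewrite ger0_norm// ler_pdivlMr; last by lra.
by nra.
Unshelve. all: by end_near. Qed.

End lindeberg.

(** * Laplace transforms of Gaussian squares *)

Lemma Rintegral_dominated_cvg d (T : measurableType d) (R : realType)
    (mu : {measure set T -> \bar R}) (F_ : nat -> T -> R) (F G : T -> R) :
  (forall n, measurable_fun [set: T] (F_ n)) -> measurable_fun [set: T] F ->
  (forall w, F_ n w @[n --> \oo] --> F w) ->
  mu.-integrable [set: T] (EFin \o G) -> (forall n w, `|F_ n w| <= G w) ->
  \int[mu]_w F_ n w @[n --> \oo] --> \int[mu]_w F w.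
Proof.
move=> mF_ mF cF iG FG.
have cE w : [set: T] w -> (F_ n w)%:E @[n --> \oo] --> (EFin \o F) w.
  by move=> _; apply/fine_cvgP; split; [exact: nearW|exact: cF].
have mE_ n : measurable_fun [set: T] (EFin \o F_ n) by exact/measurable_EFinP.
have mE : measurable_fun [set: T] (EFin \o F) by exact/measurable_EFinP.
have bE : {ae mu, forall w n, [set: T] w -> (`|(F_ n w)%:E| <= (EFin \o G) w)%E}.
  by apply: aeW => w n _ /=; rewrite lee_fin.
have [iF _ H] := dominated_convergence measurableT mE_ mE (aeW _ cE) iG bE.
rewrite /Rintegral; apply: fine_cvg.
by rewrite fineK//; exact: integrable_fin_num.
Qed.

Section gaussian.
Context {R : realType}.
Local Notation leb := (@lebesgue_measure R).
Local Notation gauss := (@normal_prob R 0 1).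
Local Notation pdf := (@normal_pdf R 0 1).

Let one0 : (1 : R) != 0. Proof. exact: oner_neq0. Qed.

Let mpdf : measurable_fun [set: R] pdf.
Proof. exact: measurable_normal_pdf. Qed.

Let eqpdf (A : set R) : measurable A ->
  (\int[gauss]_(w in id @^-1` A) 1%:E = \int[leb]_(w in id @^-1` A) (pdf w)%:E)%E.
Proof. by move=> mA; rewrite integral_cst// mul1e. Qed.

Lemma Rintegral_normal (g : R -> R) : measurable_fun [set: R] g ->
  \int[gauss]_x g x = \int[leb]_x (g x * pdf x).
Proof.
move=> mg; rewrite -(@Rintegral_transfer _ _ _ (measurableTypeR R) _ (measurableTypeR R) _
  gauss leb id id (fun=> 1) pdf)//.
- by apply: eq_Rintegral => x _; rewrite mulr1.
- by move=> x; exact: normal_pdf_ge0.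
Qed.

Lemma integrable_normal (g : R -> R) : measurable_fun [set: R] g ->
  leb.-integrable [set: R] (fun x => (g x * pdf x)%:E) ->
  gauss.-integrable [set: R] (EFin \o g).
Proof.
move=> mg ig.
have := (@integrable_transfer _ _ _ (measurableTypeR R) _ (measurableTypeR R) _
  gauss leb id id (fun=> 1) pdf).
move=> /(_ _ _ _ _ _ _ _ g mg ig) H.
rewrite (_ : EFin \o g = (fun w => (g w * 1)%:E)); last first.
  by apply/funext => x; rewrite /= mulr1.
apply: H => //.
by move=> x; exact: normal_pdf_ge0.
Qed.

(** Since |x| <= 1 + x^2/4 <= exp(x^2/4), the integrand is dominated by a multiple of the normal
    density of variance 2. *)
Let integrable_id_pdf : leb.-integrable [set: R] (fun x => (`|x| * pdf x)%:E).
Proof.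
have s2 : Num.sqrt 2 != 0 :> R by rewrite gt_eqF// sqrtr_gt0.
have := integrable_normal_pdf 0 (Num.sqrt 2 : R).
move=> /(integrableZl measurableT (normal_peak 1 / normal_peak (Num.sqrt 2))).
apply: le_integrable => //.
  by apply/measurable_EFinP; apply: measurable_funM.
move=> x _ /=; rewrite lee_fin !normal_pdfE// /normal_fun.
rewrite normrM normr_id ger0_norm; last first.
  by rewrite mulr_ge0// ?normal_peak_ge0// expR_ge0.
rewrite [in leRHS]mulrA divfK ?gt_eqF ?normal_peak_gt0//.
rewrite [leRHS]ger0_norm; last first.
  by rewrite mulr_ge0// ?normal_peak_ge0// expR_ge0.
rewrite mulrCA ler_wpM2l ?normal_peak_ge0// subr0 sqr_sqrtr//.
rewrite (_ : - x ^+ 2 / (1 ^+ 2 *+ 2) = - (x ^+ 2 / 2)); last by field.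
rewrite (_ : - x ^+ 2 / (2 *+ 2) = x ^+ 2 / 4 - x ^+ 2 / 2); last by field.
rewrite expRD ler_wpM2r ?expR_ge0//.
rewrite (le_trans _ (expR_ge1Dx _))//.
have := sqr_ge0 (`|x| - 2); rewrite sqrrB real_normK ?num_real//.
by rewrite -mulr_natr; lra.
Qed.

Lemma intble_gauss_id : gauss.-integrable [set: R] (fun x => `|x|%:E).
Proof. by apply: (@integrable_normal (fun x => `|x|)). Qed.

Let is_derive_pdf (x : R) : is_derive x 1 pdf (- x * pdf x).
Proof.
rewrite normal_pdfE// /normal_fun.
apply: is_derive_eq.
by rewrite /GRing.scale /=; field.
Qed.

(** Stein's identity: against Lebesgue measure the integrand is the derivative of pdf(x) sin(t x +
    c). The fundamental theorem of calculus on [-(n+1), n+1] leaves boundary terms of order 1/(n+1),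
    and dominated convergence removes the truncation. *)
Lemma gauss_stein (t c : R) :
  \int[gauss]_x (t * cos (t * x + c) - x * sin (t * x + c)) = 0.
Proof.
have mc : measurable_fun [set: R] (fun x => t * x + c).
  by apply: measurable_funD => //; exact: measurable_funM.
have mcos := measurable_cos mc; have msin := measurable_sin mc.
set g := fun x : R => _.
have mg : measurable_fun [set: R] g.
  by apply: measurable_funB; exact: measurable_funM.
rewrite Rintegral_normal//.
pose F x := pdf x * sin (t * x + c).
have dF (x : R) : is_derive x 1 F (g x * pdf x).
  have h := is_derive_pdf x; rewrite /F /g; apply: is_derive_eq.
  by rewrite /GRing.scale /=; ring.
have cg : continuous (fun x => g x * pdf x).
  move=> x; apply: cvgM; last exact: continuous_normal_pdf.
  apply: cvgB.
    apply: cvgM; first exact: cvg_cst.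
    apply: continuous_comp; last exact: continuous_cos.
    by apply: cvgD; [apply: cvgM; [exact: cvg_cst|exact: cvg_id]|exact: cvg_cst].
  apply: cvgM; first exact: cvg_id.
  apply: continuous_comp; last exact: continuous_sin.
  by apply: cvgD; [apply: cvgM; [exact: cvg_cst|exact: cvg_id]|exact: cvg_cst].
have ig : leb.-integrable [set: R] (fun x => (g x * pdf x)%:E).
  have := integrableD measurableT
    (integrableZl measurableT `|t| (integrable_normal_pdf 0 (1 : R))) integrable_id_pdf.
  apply: le_integrable => //.
    by apply/measurable_EFinP; exact: measurable_funM.
  move=> x _; rewrite /= lee_fin normrM.
  rewrite [X in _ * X]ger0_norm ?normal_pdf_ge0//.
  rewrite -mulrDl [leRHS]ger0_norm; last by rewrite mulr_ge0// normal_pdf_ge0.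
  rewrite ler_wpM2r ?normal_pdf_ge0// (le_trans (ler_normB _ _))//.
  by rewrite !normrM lerD// ler_piMr// ?cos_max ?sin_max.
have mgp : measurable_fun [set: R] (fun x => g x * pdf x) by exact: measurable_funM.
pose I n : set R := `[- n.+1%:R, n.+1%:R]%classic.
have FI n : \int[leb]_x (g x * pdf x * \1_(I n) x) = F n.+1%:R - F (- n.+1%:R).
  rewrite /Rintegral.
  transitivity (fine (\int[leb]_(x in I n) (g x * pdf x)%:E)%E).
    congr fine; rewrite [RHS]integral_mkcond; apply: eq_integral => x _.
    by rewrite patchE indicE; case: (x \in I n); rewrite ?mulr1 ?mulr0.
  rewrite /I (@continuous_FTC2 _ _ F)//.
  - by rewrite -subr_gt0 opprK addr_gt0.
  - by apply: continuous_subspaceT => x; exact: cg.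
  - split=> [x _|//|]; first exact: ex_derive.
    + apply: cvg_at_right_filter; apply: differentiable_continuous.
      by apply/derivable1_diffP; exact: ex_derive.
    + apply: cvg_at_left_filter; apply: differentiable_continuous.
      by apply/derivable1_diffP; exact: ex_derive.
  - by move=> x _; rewrite derive1E; exact: derive_val.
have F0 : F n.+1%:R - F (- n.+1%:R) @[n --> \oo] --> 0.
  have pdfle n (x : R) : `|x| = n.+1%:R -> `|F x| <= normal_peak 1 * 2 * harmonic n.
    move=> xn; rewrite /F normrM ger0_norm ?normal_pdf_ge0//.
    rewrite (le_trans (ler_piMr (normal_pdf_ge0 _ _ _) (sin_max _)))//.
    rewrite normal_pdfE// /normal_fun -mulrA ler_wpM2l ?normal_peak_ge0//.
    rewrite subr0 (_ : - x ^+ 2 / (1 ^+ 2 *+ 2) = - (`|x| ^+ 2 / 2)); last first.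
      by rewrite real_normK ?num_real//; field.
    rewrite xn expRN /harmonic /= -[leLHS]div1r ler_pdivrMr ?expR_gt0//.
    rewrite mulrAC ler_pdivlMr// mul1r.
    have := expR_ge1Dx ((n.+1%:R : R) ^+ 2 / 2).
    have : (1 : R) <= n.+1%:R by rewrite ler1n.
    by rewrite expr2; nra.
  apply/norm_cvg0P.
  apply: (@squeeze_cvgr _ _ _ _ (cst 0) (fun n => (normal_peak 1 * 2 * harmonic n) *+ 2)).
  - apply: nearW => n /=; rewrite normr_ge0/= (le_trans (ler_normB _ _))//.
    by rewrite mulr2n lerD// pdfle// ?normrN normr_nat.
  - exact: cvg_cst.
  - rewrite [X in _ --> X](_ : 0 = (normal_peak 1 * 2 * 0 : R) *+ 2); last by rewrite mulr0 mul0rn.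
    by apply: cvgMn; apply: cvgM; [exact: cvg_cst|exact: cvg_harmonic].
suff H : F n.+1%:R - F (- n.+1%:R) @[n --> \oo] --> \int[leb]_x (g x * pdf x).
  by rewrite -[LHS](cvg_lim _ H)//; exact: cvg_lim.
under eq_fun do rewrite -FI.
apply: (@Rintegral_dominated_cvg _ (measurableTypeR R) R leb
  (fun n x => g x * pdf x * \1_(I n) x) (fun x => g x * pdf x)
  (fun x => `|g x * pdf x|)) => //.
- by move=> n; apply: (measurable_funM mgp); apply: measurable_indic; exact: measurable_itv.
- move=> x; apply: cvg_near_cst; near=> n.
  rewrite indicE mem_set ?mulr1// /I /= in_itv /= -ler_norml.
  apply: (@le_trans _ _ n%:R); last by rewrite ler_nat.
  by near: n; exact: nbhs_infty_ger.
- exact: (integrable_norm ig).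
- move=> n x; rewrite normrM ler_piMr// indicE; case: (_ \in _); rewrite ?normr1 ?normr0//.
Unshelve. all: end_near. Qed.

(** As a function of t the left-hand side satisfies phi' = - t phi, by differentiation under the
    integral and Stein's identity; hence phi(t) exp(t^2/2) is constant. The phase c makes a
    companion formula for the sine unnecessary. *)
Lemma gauss_cos (t c : R) :
  \int[gauss]_x cos (t * x + c) = cos c * expR (- (t ^+ 2 / 2)).
Proof.
pose phi t := \int[gauss]_x cos (t * x + c).
have mc s : measurable_fun [set: R] (fun x => s * x + c).
  by apply: measurable_funD => //; exact: measurable_funM.
have d1E : partial1of2 (fun s x => cos (s * x + c)) = fun s x => - (x * sin (s * x + c)).
  apply/funext => s; apply/funext => x; rewrite partial1of2E.
  apply: derive_val; apply: is_derive_eq.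
  by rewrite !scaler1 /GRing.scale /=; ring.
have dphi (s : R) : is_derive s 1 phi (- s * phi s).
  have Is : `]s - 1, s + 1[%classic s by rewrite /= in_itv/=; apply/andP; split; lra.
  have i1 (x : R) : `]s - 1, s + 1[%classic x ->
      gauss.-integrable [set: R] (EFin \o (fun y => cos (x * y + c))).
    by move=> _; exact: (@bm_intble _ _ R gauss _ (bm_cos (mc x))).
  have ms : measurable_fun [set: R] (fun w => w * sin (s * w + c)).
    by apply: measurable_funM => //; exact: measurable_sin.
  have d1 (x y : R) : `]s - 1, s + 1[%classic x -> [set: R] y ->
      derivable ((fun s x => cos (s * x + c))^~ y) x 1.
    by move=> _ _; exact: ex_derive.
  have ub (x y : R) : `]s - 1, s + 1[%classic x -> [set: R] y ->
      `|partial1of2 (fun s x => cos (s * x + c)) x y| <= `|y|.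
    by move=> _ _; rewrite d1E normrN normrM ler_piMr// sin_max.
  apply: DeriveDef.
    exact: (derivable_under_integral measurableT Is i1 d1 (fun=> normr_ge0 _) intble_gauss_id ub).
  rewrite -derive1E.
  rewrite (differentiation_under_integral measurableT Is i1 d1 (fun=> normr_ge0 _) intble_gauss_id ub) d1E.
  have := gauss_stein s c; rewrite ExB; last 2 first.
  - by apply: intbleZ; exact: (bm_intble gauss (bm_cos (mc s))).
  - apply: le_intble intble_gauss_id.
      exact: ms.
    by move=> w; rewrite normrM ler_piMr// sin_max.
  rewrite ExZ; last by exact: (bm_intble gauss (bm_cos (mc s))).
  move/eqP; rewrite subr_eq0 => /eqP H.
  rewrite mulNr /phi H -mulN1r -ExZ; last first.
    apply: le_intble intble_gauss_id.
      exact: ms.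
    by move=> w; rewrite normrM ler_piMr// sin_max.
  by apply: eq_Rintegral => x _; rewrite mulN1r.
have dpsi (s : R) : is_derive s 1 (fun s => phi s * expR (s ^+ 2 / 2)) 0.
  apply: is_derive_eq.
  by rewrite !scaler1 /GRing.scale /=; field.
have := is_derive_0_is_cst t 0 dpsi.
rewrite expr0n mul0r expR0 mulr1 [phi 0]/phi.
under [X in _ = X -> _]eq_Rintegral do rewrite mul0r add0r.
by rewrite Ex_cst expRN => <-; rewrite mulfK// gt_eqF ?expR_gt0.
Qed.

End gaussian.

Section fubini_bounded.
Context {d1 d2} {T1 : measurableType d1} {T2 : measurableType d2} {R : realType}.
Variables (P1 : probability T1 R) (P2 : probability T2 R) (f : T1 * T2 -> R).
Hypothesis mf : measurable_fun [set: T1 * T2] f.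
Variable M : R.
Hypothesis fM : forall z, `|f z| <= M.

Let ifx : (P1 \x P2)%E.-integrable [set: T1 * T2] (EFin \o f).
Proof. by apply: (@bm_intble _ _ R (P1 \x P2)%E); split => //; exists M. Qed.

Let mfx x : measurable_fun [set: T2] (fun y => f (x, y)).
Proof. exact: (measurableT_comp mf (measurable_pair1 x)). Qed.

Let mfy y : measurable_fun [set: T1] (fun x => f (x, y)).
Proof. exact: (measurableT_comp mf (measurable_pair2 y)). Qed.

Let inx x : intble P2 (fun y => f (x, y)).
Proof. by apply: bm_intble; split; [|exists M]. Qed.

Let iny y : intble P1 (fun x => f (x, y)).
Proof. by apply: bm_intble; split; [|exists M]. Qed.

Lemma measurable_Rintegral_section :
  measurable_fun [set: T2] (fun y => \int[P1]_x f (x, y)).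
Proof.
have := measurable_fubini_G ifx.
move=> h; exact: measurableT_comp h.
Qed.

Lemma Rintegral_prod1 : \int[(P1 \x P2)%E]_z f z = \int[P1]_x \int[P2]_y f (x, y).
Proof.
rewrite {1}/Rintegral -(integral12_prod_meas1 ifx) /Rintegral; congr fine.
apply: eq_integral => x _; rewrite fineK//; exact: (integrable_fin_num _ (inx x)).
Qed.

Lemma Rintegral_prod2 : \int[(P1 \x P2)%E]_z f z = \int[P2]_y \int[P1]_x f (x, y).
Proof.
rewrite {1}/Rintegral -(integral21_prod_meas1 ifx) /Rintegral; congr fine.
apply: eq_integral => x _; rewrite fineK//; exact: (integrable_fin_num _ (iny x)).
Qed.

End fubini_bounded.

(** * From characteristic functions to Laplace transforms of squares *)

Section laplace_of_charfun.
Context {d} {T : measurableType d} {R : realType} (P : probability T R).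
Local Notation gauss := (@normal_prob R 0 1).

(** The Laplace transform at r^2/2 of the chi-square law with one degree of freedom, that is (1 +
    r^2)^(-1/2). The closed form is never computed: the same factor occurs in the limit and in
    [laplace_chi_square]. *)
Definition gauss_laplace (r : R) : R := \int[gauss]_g expR (- ((r * g) ^+ 2 / 2)).

(** For fixed w this is [gauss_cos] with phase A(w) and frequency r z(w); Fubini applies because the
    joint integrand is bounded by M. *)
Lemma Ex_gauss_randomize (W A z : T -> R) (r M : R) :
  measurable_fun [set: T] W -> (forall w, `|W w| <= M) ->
  measurable_fun [set: T] A -> measurable_fun [set: T] z ->
  \int[P]_w (W w * (cos (A w) * expR (- ((r * z w) ^+ 2 / 2)))) =
  \int[gauss]_g \int[P]_w (W w * cos (A w + (r * g) * z w)) /\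
  measurable_fun [set: R] (fun g => \int[P]_w (W w * cos (A w + (r * g) * z w))).
Proof.
move=> mW WM mA mz.
pose f (x : T * measurableTypeR R) := W x.1 * cos (A x.1 + (r * x.2) * z x.1).
have mf : measurable_fun [set: T * measurableTypeR R] f.
  have m1 : measurable_fun [set: T * measurableTypeR R] fst := measurable_fst.
  have m2 : measurable_fun [set: T * measurableTypeR R] snd := measurable_snd.
  apply: measurable_funM; first exact: (measurableT_comp mW m1).
  apply: measurable_cos; apply: measurable_funD; first exact: (measurableT_comp mA m1).
  apply: measurable_funM; last exact: (measurableT_comp mz m1).
  by apply: measurable_funM.
have fM x : `|f x| <= M.
  by rewrite /f normrM (le_trans _ (WM x.1))// ler_piMr// cos_max.
split; last exact: (@measurable_Rintegral_section _ _ T (measurableTypeR R) R P gauss f mf M fM).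
rewrite -(@Rintegral_prod2 _ _ T (measurableTypeR R) R P gauss f mf M fM).
rewrite (@Rintegral_prod1 _ _ T (measurableTypeR R) R P gauss f mf M fM).
apply: eq_Rintegral => w _; rewrite -gauss_cos -ExZ.
  by apply: eq_Rintegral => g _; rewrite /f /= addrC mulrAC.
apply: (@bm_intble _ (measurableTypeR R) R gauss); apply: bm_cos.
by apply: measurable_funD => //; exact: measurable_funM.
Qed.

(* Since E cos (s g) = expR (- (s^2 / 2)) for a standard Gaussian g, a Gaussian
   average over t of the characteristic functions produces the Laplace transform
   of the squares, one coordinate at a time. *)
Theorem laplace_of_charfun (z : nat -> nat -> T -> R) (r : R) :
  (forall n j, measurable_fun [set: T] (z n j)) ->
  forall k (A : nat -> T -> R) (tau : R),
  (forall n, measurable_fun [set: T] (A n)) ->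
  (forall t : nat -> R,
    \int[P]_w cos (A n w + \sum_(j < k) t j * z n j w) @[n --> \oo] -->
      expR (- ((tau + \sum_(j < k) t j ^+ 2) / 2))) ->
  \int[P]_w (expR (- (\sum_(j < k) (r * z n j w) ^+ 2 / 2)) * cos (A n w)) @[n --> \oo]
    --> gauss_laplace r ^+ k * expR (- (tau / 2)).
Proof.
move=> mz; elim=> [|k IH] A tau mA H.
  have := H (fun=> 0); rewrite big_ord0 addr0 expr0 mul1r.
  apply: cvg_trans; apply: near_eq_cvg; apply: nearW => n.
  by apply: eq_Rintegral => w _; rewrite !big_ord0 addr0 oppr0 expR0 mul1r.
pose W n w := expR (- (\sum_(j < k) (r * z n j w) ^+ 2 / 2)).
have mW n : measurable_fun [set: T] (W n).
  apply: measurable_expR; apply: measurable_funN; apply: measurable_sum => j.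
  by apply: measurable_funM => //; apply: measurable_funX; exact: measurable_funM.
have W1 n w : `|W n w| <= 1.
  rewrite ger0_norm ?expR_ge0// expR_le1 oppr_le0 sumr_ge0// => j _.
  by rewrite divr_ge0// sqr_ge0.
have Ek n : \int[P]_w (expR (- (\sum_(j < k.+1) (r * z n j w) ^+ 2 / 2)) * cos (A n w)) =
    \int[gauss]_g \int[P]_w (W n w * cos (A n w + (r * g) * z n k w)).
  rewrite -(proj1 (Ex_gauss_randomize r (mW n) (W1 n) (mA n) (mz n k))).
  apply: eq_Rintegral => w _; rewrite big_ord_recr/= opprD expRD -/(W n w).
  by ring.
under eq_fun do rewrite Ek.
have -> : gauss_laplace r ^+ k.+1 * expR (- (tau / 2)) =
  \int[gauss]_g (gauss_laplace r ^+ k * expR (- ((tau + (r * g) ^+ 2) / 2))).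
  rewrite exprSr -mulrA {2}/gauss_laplace.
  rewrite [X in _ * X]mulrC -(@ExZ _ (measurableTypeR R) R gauss) -?(@ExZ _ (measurableTypeR R) R gauss); last 2 first.
  - apply: (@bm_intble _ (measurableTypeR R) R gauss); apply: bmZ.
    apply: (@bm_expRN _ (measurableTypeR R) R) => //.
      by apply: measurable_funM => //; apply: measurable_funX; exact: measurable_funM.
    by move=> w; rewrite divr_ge0// sqr_ge0.
  - apply: (@bm_intble _ (measurableTypeR R) R gauss).
    apply: (@bm_expRN _ (measurableTypeR R) R) => //.
      by apply: measurable_funM => //; apply: measurable_funX; exact: measurable_funM.
    by move=> w; rewrite divr_ge0// sqr_ge0.
  apply: eq_Rintegral => g _; rewrite mulrDl opprD expRD; ring.
apply: (@Rintegral_dominated_cvg _ (measurableTypeR R) R gauss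
  (fun n g => \int[P]_w (W n w * cos (A n w + (r * g) * z n k w)))
  (fun g => gauss_laplace r ^+ k * expR (- ((tau + (r * g) ^+ 2) / 2))) (fun=> 1)).
- by move=> n; exact: (proj2 (Ex_gauss_randomize r (mW n) (W1 n) (mA n) (mz n k))).
- apply: measurable_funM => //; apply: (@measurable_expR _ (measurableTypeR R)).
  apply: measurable_funN; apply: measurable_funM => //.
  by apply: measurable_funD => //; apply: measurable_funX; exact: measurable_funM.
(* For fixed g the last variable joins the phase, which becomes A + r g z_k, and [tau] grows by (r
   g)^2; the hypothesis is used with the k-th frequency equal to r g. This is why [A] and [tau] are
   generalized in the induction. *)
- move=> g; apply: (IH (fun n w => A n w + (r * g) * z n k w)).
    by move=> n; apply: measurable_funD => //; exact: measurable_funM.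
  move=> t; have := H (fun j => if (j < k)%N then t j else r * g).
  rewrite big_ord_recr/= ltnn.
  under eq_bigr => j _ do rewrite ltn_ord.
  rewrite [_ + (r * g) ^+ 2]addrC addrA.
  apply: cvg_trans; apply: near_eq_cvg; apply: nearW => n.
  apply: eq_Rintegral => w _; rewrite big_ord_recr/= ltnn.
  under [in LHS]eq_bigr => j _ do rewrite ltn_ord.
  by congr cos; ring.
- exact: (@intble_cst _ (measurableTypeR R) R gauss 1).
- move=> n g; rewrite -[leRHS](Ex_cst P 1); apply: Ex_norm_le.
  + apply: bm_intble; apply: bmM; first by split => //; exists 1.
    by apply: bm_cos; apply: measurable_funD => //; exact: measurable_funM.
  + exact: intble_cst.
  + by move=> w; rewrite normrM (le_trans _ (W1 n w))// ler_piMr// cos_max.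
Qed.

End laplace_of_charfun.

(** * Support and Laplace transform of the chi-square law *)

Section chi_square_facts.
Context {R : realType}.
Local Notation gauss := (@normal_prob R 0 1).

Lemma chi_square_lt0 k : chi_square (R := R) k `]-oo, 0[%classic = 0%E.
Proof.
elim: k => [|k IH] /=.
  by rewrite diracE memNset//= in_itv/= ltxx.
apply/eqP; rewrite eq_le measure_ge0 andbT.
rewrite -[leRHS](_ : (chi_square k \x gauss)%E (`]-oo, 0[%classic `*` setT) = _).
  apply: le_measure; rewrite ?inE.
  - by apply: measurable_funPTI; exact: measurable_itv.
  - by apply: measurableX.
  - move=> [x y]; rewrite /= /add_sq /= !in_itv /= => h; split => //.
    by rewrite (le_lt_trans _ h)// lerDl sqr_ge0.
rewrite product_measure1E//; transitivity (0 * gauss setT)%E; last by rewrite mul0e.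
by congr (_ * _)%E; exact: IH.
Qed.

(** Stated in the extended reals so that it also supplies the finiteness from which integrability
    under the chi-square law is later deduced. *)
Lemma laplace_chi_square k (r : R) :
  (\int[chi_square k]_s (expR (- (r ^+ 2 * s / 2)))%:E = (gauss_laplace r ^+ k)%:E)%E.
Proof.
have mE : measurable_fun [set: measurableTypeR R] (fun s : R => expR (- (r ^+ 2 * s / 2))).
  apply: (@measurable_expR _ (measurableTypeR R)).
  by apply: measurable_funN; apply: measurable_funM => //; exact: measurable_funM.
have mE' : measurable_fun [set: measurableTypeR R]
    (fun s : R => (expR (- (r ^+ 2 * s / 2)))%:E) by exact/measurable_EFinP.
elim: k => [|k IH].
  rewrite expr0 /= integral_dirac//.
  by rewrite diracE mem_set// mul1e mulr0 mul0r oppr0 expR0.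
rewrite /= ge0_integral_distribution//.
pose f (x : measurableTypeR R * measurableTypeR R) : \bar R :=
  (expR (- (r ^+ 2 * (add_sq x) / 2)))%:E.
have mf : measurable_fun [set: measurableTypeR R * measurableTypeR R] f.
  exact: (measurableT_comp mE').
have f0 x : (0 <= f x)%E by rewrite lee_fin expR_ge0.
transitivity (\int[chi_square k]_x \int[gauss]_y f (x, y))%E.
  exact: (@fubini_tonelli1 _ _ _ _ R (chi_square k) gauss f mf f0).
pose e2 (y : measurableTypeR R) := expR (- ((r * y) ^+ 2 / 2)).
have me2 : measurable_fun [set: measurableTypeR R] e2.
  apply: (@measurable_expR _ (measurableTypeR R)).
  apply: measurable_funN; apply: measurable_funM => //.
  by apply: measurable_funX; exact: measurable_funM.
have ie2 : intble gauss e2.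
  apply: (@bm_intble _ (measurableTypeR R) R gauss); split => //.
  exists 1 => y; rewrite ger0_norm ?expR_ge0// expR_le1 oppr_le0.
  by rewrite divr_ge0// sqr_ge0.
have Ee2 : (\int[gauss]_y (e2 y)%:E = (gauss_laplace r)%:E)%E.
  by rewrite /gauss_laplace /Rintegral fineK//; exact: integrable_fin_num.
transitivity (\int[chi_square k]_x ((expR (- (r ^+ 2 * x / 2)))%:E * (gauss_laplace r)%:E))%E.
  apply: eq_integral => x _; rewrite -Ee2 -ge0_integralZl//.
  - apply: eq_integral => y _; rewrite /f /add_sq/= -EFinM; congr EFin.
    by rewrite /e2 -expRD; congr expR; rewrite exprMn; field.
  - exact/measurable_EFinP.
  - by move=> y _; rewrite lee_fin expR_ge0.
rewrite ge0_integralZr//.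
- by rewrite IH -EFinM -exprSr.
- by rewrite lee_fin Ex_ge0// => y; rewrite expR_ge0.
Qed.

End chi_square_facts.

(** * Inversion of Laplace transforms *)

Section laplace_inversion.
Context {R : realType}.

(* With v = e^(-l m s) and N = 2^m, the polynomial 1 - (1 - v)^N tends to the
   indicator of s < (ln 2)/l. *)
Definition soft_step (l : R) (m : nat) (s : R) : R :=
  1 - (1 - expR (- (l * m%:R * s))) ^+ (2 ^ m).

Lemma bernoulli_le (u : R) N : 0 <= u -> 1 + N%:R * u <= (1 + u) ^+ N.
Proof.
move=> u0; elim: N => [|N IH]; first by rewrite expr0 mul0r addr0.
rewrite exprS -natr1; have : 0 <= N%:R * u * u by rewrite !mulr_ge0.
have : (1 + u) * (1 + N%:R * u) <= (1 + u) * (1 + u) ^+ N by rewrite ler_pM2l//; lra.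
by nra.
Qed.

Lemma bernoulliN_le (u : R) N : 0 <= u <= 1 -> 1 - N%:R * u <= (1 - u) ^+ N.
Proof.
move=> /andP[u0 u1]; elim: N => [|N IH]; first by rewrite expr0 mul0r subr0.
rewrite exprS -natr1; have : 0 <= N%:R * u * u by rewrite !mulr_ge0.
have : (1 - u) * (1 - N%:R * u) <= (1 - u) * (1 - u) ^+ N by rewrite ler_wpM2l//; lra.
by nra.
Qed.

Let natr2X m : (2 ^ m)%:R = expR (m%:R * ln 2) :> R.
Proof. by rewrite expRM_natl lnK ?posrE// natrX. Qed.

Lemma soft_step_bounds l m s : 0 <= l -> 0 <= s -> 0 <= soft_step l m s <= 1.
Proof.
move=> l0 s0; set v := expR (- (l * m%:R * s)).
have v1 : v <= 1 by rewrite expR_le1 oppr_le0 !mulr_ge0.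
have v0 : 0 < v := expR_gt0 _.
rewrite /soft_step -/v subr_ge0 lerBlDr lerDl exprn_ge0 ?andbT ?subr_ge0//.
by rewrite exprn_ile1// ?subr_ge0// lerBlDr lerDl ltW.
Qed.

(** The threshold is the midpoint a of x and y, with l = ln 2 / a, so that N v = exp(m l (a - s))
    for N = 2^m. When s <= x this is at least 1/eta, and (1 - v)^N (1 + v)^N <= 1 with Bernoulli's
    inequality gives (1 - v)^N <= eta. When s >= y it is at most eta, and Bernoulli's inequality for
    1 - v gives 1 - (1 - v)^N <= N v. *)
Lemma soft_step_approx (x y eta : R) : 0 < x -> x < y -> 0 < eta ->
  exists l m, [/\ 0 < l, forall s, 0 <= s -> s <= x -> 1 - eta <= soft_step l m s &
    forall s, 0 <= s -> y <= s -> soft_step l m s <= eta].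
Proof.
move=> x0 xy eta0; pose a := (x + y) / 2; pose l := ln 2 / a.
have a0 : 0 < a by rewrite divr_gt0//; lra.
have ln20 : 0 < ln 2 :> R by rewrite ln_gt0//; lra.
have l0 : 0 < l by rewrite divr_gt0.
pose del := (y - x) / 2.
have del0 : 0 < del by rewrite divr_gt0//; lra.
have ld0 : 0 < l * del by exact: mulr_gt0.
have [m mP] : exists m : nat, eta^-1 <= m%:R * (l * del).
  exists (Num.truncn (eta^-1 / (l * del))).+1.
  rewrite -ler_pdivrMr//; exact/ltW/truncnS_gt.
have ge1 (c : R) : del <= c -> eta^-1 <= expR (m%:R * (l * c)).
  move=> dc; rewrite (le_trans _ (expR_ge1Dx _))//.
  have : m%:R * (l * del) <= m%:R * (l * c) by rewrite ler_wpM2l// ler_pM2l.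
  by lra.
have NV s : (2 ^ m)%:R * expR (- (l * m%:R * s)) = expR (m%:R * (l * (a - s))).
  by rewrite natr2X -expRD; congr expR; rewrite /l; field; rewrite gt_eqF.
exists l, m; split=> // s s0 xs.
  rewrite /soft_step lerD2l lerN2.
  set v := expR (- (l * m%:R * s)).
  have lv : 0 <= l * m%:R * s := mulr_ge0 (mulr_ge0 (ltW l0) (ler0n _ _)) s0.
have v1 : v <= 1 by rewrite expR_le1 oppr_le0.
  have v0 : 0 < v := expR_gt0 _.
  have N1 : eta^-1 <= (2 ^ m)%:R * v by rewrite NV; apply: ge1; rewrite /del /a; lra.
  have B := bernoulli_le (2 ^ m) (ltW v0).
  have P0 : 0 <= (1 - v) ^+ (2 ^ m) by rewrite exprn_ge0// subr_ge0.
  have P1 : (1 - v) ^+ (2 ^ m) * (1 + v) ^+ (2 ^ m) <= 1.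
    rewrite -exprMn exprn_ile1//; first by nra.
    by nra.
  have e1 : eta * eta^-1 = 1 by rewrite divff// gt_eqF.
  have ei : 0 < eta^-1 by rewrite invr_gt0.
  have : (1 - v) ^+ (2 ^ m) * eta^-1 <= 1.
    rewrite (le_trans _ P1)// ler_wpM2l// (le_trans _ B)//; lra.
  by rewrite ler_pdivrMr// mul1r.
rewrite /soft_step; set v := expR (- (l * m%:R * s)).
have lv : 0 <= l * m%:R * s := mulr_ge0 (mulr_ge0 (ltW l0) (ler0n _ _)) s0.
have v1 : v <= 1 by rewrite expR_le1 oppr_le0.
have v0 : 0 < v := expR_gt0 _.
have v01 : 0 <= v <= 1 by rewrite ltW.
have B := bernoulliN_le (2 ^ m) v01.
suff : (2 ^ m)%:R * v <= eta by lra.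
rewrite NV (_ : m%:R * _ = - (m%:R * (l * (s - a)))); last by ring.
rewrite expRN -[leRHS]invrK lef_pV2 ?posrE ?expR_gt0 ?invr_gt0//.
by apply: ge1; rewrite /del /a; lra.
Qed.

Section cdf.
Context {d} {T : measurableType d} (P : probability T R).
Variables (X : nat -> T -> R) (Q : probability (measurableTypeR R) R).
Hypothesis mX : forall n, measurable_fun [set: T] (X n).
Hypothesis X0 : forall n w, 0 <= X n w.
Hypothesis Q0 : Q `]-oo, 0[%classic = 0%E.
Hypothesis iQ : forall l, 0 <= l -> intble Q (fun s : R => expR (- (l * s))).
Hypothesis hL : forall l, 0 <= l ->
  \int[P]_w expR (- (l * X n w)) @[n --> \oo] --> \int[Q]_s expR (- (l * s)).

Let iexpX n l : 0 <= l -> intble P (fun w => expR (- (l * X n w))).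
Proof.
move=> l0; apply/bm_intble/bm_expRN; first exact: measurable_funM.
by move=> w; rewrite mulr_ge0.
Qed.

(** Carrying an extra factor V^i through an induction on the exponent N replaces the binomial
    expansion: V^i (1-V)^(N+1) = V^i (1-V)^N - V^(i+1) (1-V)^N. At N = 0 the power V^i is again an
    exponential, covered by the hypothesis on Laplace transforms. *)
Lemma cvg_soft_step l m : 0 <= l ->
  intble Q (soft_step l m) /\
  \int[P]_w soft_step l m (X n w) @[n --> \oo] --> \int[Q]_s soft_step l m s.
Proof.
move=> l0.
pose V s : R := expR (- (l * m%:R * s)).
have H N : forall i,
  [/\ intble Q (fun s => V s ^+ i * (1 - V s) ^+ N),
   forall n, intble P (fun w => V (X n w) ^+ i * (1 - V (X n w)) ^+ N) &
   \int[P]_w (V (X n w) ^+ i * (1 - V (X n w)) ^+ N) @[n --> \oo] -->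
     \int[Q]_s (V s ^+ i * (1 - V s) ^+ N)].
  elim: N => [|N IH] i.
    have VE s : V s ^+ i * (1 - V s) ^+ 0 = expR (- ((i%:R * (l * m%:R)) * s)).
      by rewrite expr0 mulr1 /V -expRM_natl; congr expR; ring.
    have c0 : 0 <= i%:R * (l * m%:R) by rewrite !mulr_ge0.
    split.
    - rewrite (_ : (fun s => _) = (fun s => expR (- ((i%:R * (l * m%:R)) * s)))).
        exact: iQ.
      by apply/funext => s; rewrite VE.
    - move=> n; rewrite (_ : (fun w => _) = (fun w => expR (- ((i%:R * (l * m%:R)) * X n w)))).
        exact: iexpX.
      by apply/funext => s; rewrite VE.
    - under eq_Rintegral do rewrite VE.
      apply: cvg_ext (hL c0) => n.
      by apply: eq_Rintegral => w _; rewrite VE.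
  have [i1 i2 i3] := IH i; have [j1 j2 j3] := IH i.+1.
  have VE s : V s ^+ i * (1 - V s) ^+ N.+1 =
      V s ^+ i * (1 - V s) ^+ N - V s ^+ i.+1 * (1 - V s) ^+ N.
    by rewrite !exprS; ring.
  split.
  - rewrite (_ : (fun s => _) = (fun s => V s ^+ i * (1 - V s) ^+ N - V s ^+ i.+1 * (1 - V s) ^+ N)).
      exact: intbleB.
    by apply/funext => s; rewrite VE.
  - move=> n; rewrite (_ : (fun w => _) = (fun w => V (X n w) ^+ i * (1 - V (X n w)) ^+ N - V (X n w) ^+ i.+1 * (1 - V (X n w)) ^+ N)).
      exact: intbleB.
    by apply/funext => s; rewrite VE.
  - under eq_Rintegral do rewrite VE.
    rewrite ExB//.
    apply: cvg_ext (cvgB i3 j3) => n /=.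
    by rewrite -[LHS]ExB//; apply: eq_Rintegral => w _; rewrite VE.
have [h1 h2 h3] := H (2 ^ m)%N 0%N.
have sE s : soft_step l m s = 1 - V s ^+ 0 * (1 - V s) ^+ (2 ^ m).
  by rewrite expr0 mul1r.
split.
  rewrite (_ : soft_step l m = (fun s => 1 - V s ^+ 0 * (1 - V s) ^+ (2 ^ m))).
    by apply: intbleB => //; exact: intble_cst.
  by apply/funext.
under eq_Rintegral do rewrite sE.
rewrite ExB//; last exact: intble_cst.
apply: cvg_ext (cvgB (cvg_cst (\int[Q]_s 1)) h3) => n /=.
under [in RHS]eq_Rintegral do rewrite sE.
by rewrite ExB//; [rewrite !Ex_cst|exact: intble_cst].
Qed.

Let cdfX n x := fine (P [set w | X n w <= x]).
Let cdfQ x := fine (Q `]-oo, x]%classic).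

(** The soft step is within eta/4 of 1 up to x and within eta/4 of 0 from y on, so its expectation
    separates a distribution function at x from another one at y. The gap between x and y takes the
    place of a continuity assumption on Q. *)
Lemma laplace_cdf x y eta : 0 < x -> x < y -> 0 < eta ->
  (\forall n \near \oo, cdfX n x <= cdfQ y + eta) /\
  (\forall n \near \oo, cdfQ x <= cdfX n y + eta).
Proof.
move=> x0 xy eta0.
have e4 : 0 < eta / 4 by rewrite divr_gt0.
have [l [m [l0 h1 h2]]] := soft_step_approx x0 xy e4.
have [iS cS] := cvg_soft_step m (ltW l0).
have SX n w : 0 <= soft_step l m (X n w) <= 1 by apply: soft_step_bounds; rewrite // ltW.
have iSX n : intble P (fun w => soft_step l m (X n w)).
  apply: bm_intble; split; last first.
    by exists 1 => w; have /andP[a b] := SX n w; rewrite ger0_norm.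
  apply: (measurableT_comp _ (mX n)) => //; exact: (intble_measurable iS).
have mAX n c : measurable [set w | X n w <= c] by apply: measurable_set_le.
have XA n : cdfX n x - eta / 4 <= \int[P]_w soft_step l m (X n w).
  rewrite /cdfX -Ex_indic// -(Ex_cst P (eta / 4)) -ExB//.
  - apply: le_Ex => //; first by apply: intbleB; [exact/bm_intble/bm_indic|exact: intble_cst].
    move=> w; rewrite indicE; have /andP[a b] := SX n w.
    case: (boolP (w \in _)); rewrite ?inE/= => hw; last by rewrite /=; lra.
    by have := h1 _ (X0 n w) hw; rewrite /=; lra.
  - exact/bm_intble/bm_indic.
  - exact: intble_cst.
have XB n : \int[P]_w soft_step l m (X n w) <= cdfX n y + eta / 4.
  rewrite /cdfX -Ex_indic// -(Ex_cst P (eta / 4)) -ExD//.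
  - apply: le_Ex => //; first by apply: intbleD; [exact/bm_intble/bm_indic|exact: intble_cst].
    move=> w; rewrite indicE; have /andP[a b] := SX n w.
    case: (boolP (w \in _)); rewrite ?inE/= => hw; first by rewrite /=; lra.
    have yX : y <= X n w by move: hw; rewrite notin_setE/= => /negP; rewrite -ltNge => /ltW.
    by have := h2 _ (X0 n w) yX; rewrite /=; lra.
  - exact/bm_intble/bm_indic.
  - exact: intble_cst.
have m0 : measurable (`[0, +oo[%classic : set R) by exact: measurable_itv.
have N0 : Q (~` `[0, +oo[%classic) = 0%E by rewrite setCitvr; exact: Q0.
have mI c : measurable (`]-oo, c]%classic : set (measurableTypeR R)) by exact: measurable_itv.
have ge0 (s : R) : `[0, +oo[%classic s -> 0 <= s by rewrite /= in_itv/= andbT.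
have iI c : intble Q (\1_(`]-oo, c]%classic)).
  by apply: (@bm_intble _ (measurableTypeR R)); exact: bm_indic.
have QA : cdfQ x - eta / 4 <= \int[Q]_s soft_step l m s.
  rewrite /cdfQ -Ex_indic// -(Ex_cst Q (eta / 4)) -ExB//; last exact: intble_cst.
  apply: (@le_Ex_ae _ _ _ Q _ _ _ m0 N0) => //.
    by apply: intbleB => //; exact: intble_cst.
  move=> s /ge0 s0; have /andP[a b] := soft_step_bounds m (ltW l0) s0.
  rewrite indicE; case: (boolP (s \in _)); rewrite ?inE/= ?in_itv/= => hs.
    by have := h1 s s0 hs; rewrite /=; lra.
  by rewrite /=; lra.
have QB : \int[Q]_s soft_step l m s <= cdfQ y + eta / 4.
  rewrite /cdfQ -Ex_indic// -(Ex_cst Q (eta / 4)) -ExD//; last exact: intble_cst.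
  apply: (@le_Ex_ae _ _ _ Q _ _ _ m0 N0) => //.
    by apply: intbleD => //; exact: intble_cst.
  move=> s /ge0 s0; have /andP[a b] := soft_step_bounds m (ltW l0) s0.
  rewrite indicE; case: (boolP (s \in _)); rewrite ?inE/= => hs.
    by rewrite /=; lra.
  have ys : y <= s by move: hs; rewrite notin_setE/= in_itv/= => /negP; rewrite -ltNge => /ltW.
  by have := h2 _ s0 ys; rewrite /=; lra.
have /cvgrPdist_le/(_ _ e4) cS' := cS.
by split; move: cS'; apply: filterS => n; rewrite ler_norml => /andP[a b];
  have := XA n; have := XB n; lra.
Qed.

End cdf.
End laplace_inversion.

(** * Weak law of large numbers and convergence in probability *)

Section weak_law.
Context {d d'} {T : measurableType d} {S : measurableType d'} {R : realType}.
Variables (P : probability T R) (Y : nat -> {RV P >-> S}).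
Hypothesis hindep : mutually_independent P Y.

Let mY k : measurable_fun [set: T] (Y k).
Proof. exact: measurable_funPT. Qed.

Lemma bm_comp_RV (g : S -> R) k :
  bounded_measurable g -> bounded_measurable (g \o Y k).
Proof.
move=> [mg [N gN]]; split; first exact: measurableT_comp.
by exists N => w; exact: gN.
Qed.

(** The cross term factors by [Ex_iotM] and vanishes, so each summand adds at most N^2. *)
Lemma Ex_sqr_sum_centered (g : nat -> S -> R) (N : R) :
  (forall i, measurable_fun [set: S] (g i)) -> (forall i y, `|g i y| <= N) ->
  (forall i, \int[P]_w g i (Y i w) = 0) ->
  forall n, \int[P]_w ((\sum_(i < n) g i (Y i w)) ^+ 2) <= n%:R * N ^+ 2.
Proof.
move=> mg gN g0.
have bg i : bounded_measurable (g i) by split => //; exists N.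
have iotS n : independent_of_tail Y n (fun w => \sum_(i < n) g i (Y i w)).
  elim: n => [|n IH].
    rewrite (_ : (fun w => _) = (fun=> 0)); first exact: iot_cst.
    by apply/funext => w; rewrite big_ord0.
  rewrite (_ : (fun w => _) = (fun w => \sum_(i < n) g i (Y i w) + 1 * g n (Y n w))).
    apply: iotD; last by apply: iotM => //; exact: iot_cst.
    by split; [exact: iot_bm IH|case: IH => _ h I A mA In; apply: h => // i /In /ltnW].
  by apply/funext => w; rewrite big_ord_recr/= mul1r.
elim=> [|n IH].
  under eq_Rintegral do rewrite big_ord0 expr0n.
  by rewrite Ex_cst mul0r.
have bS := iot_bm (iotS n); have bgn := bm_comp_RV n (bg n).
have b1 : bounded_measurable (fun w => (\sum_(i < n) g i (Y i w)) ^+ 2) by exact: bmM.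
have b2 : bounded_measurable (fun w => (\sum_(i < n) g i (Y i w)) * g n (Y n w)).
  exact: bmM.
have b3 : bounded_measurable (fun w => g n (Y n w) ^+ 2) by exact: bmM.
have -> : \int[P]_w ((\sum_(i < n.+1) g i (Y i w)) ^+ 2) =
    \int[P]_w ((\sum_(i < n) g i (Y i w)) ^+ 2 +
   (2 * ((\sum_(i < n) g i (Y i w)) * g n (Y n w)) + g n (Y n w) ^+ 2)).
  by apply: eq_Rintegral => w _; rewrite big_ord_recr/=; ring.
rewrite ExD; [|exact: bm_intble|apply: bm_intble; apply: bmD => //; exact/bmZ/bmM].
rewrite ExD; [|apply: bm_intble; exact/bmZ/bmM|exact: bm_intble].
rewrite ExZ; last by apply: bm_intble; exact: bmM.
rewrite (Ex_iotM hindep (iotS n) (bg n)) g0 !mulr0 add0r -natr1 mulrDl mul1r.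
rewrite lerD// -[leRHS](Ex_cst P); apply: le_Ex.
- exact: bm_intble.
- exact: intble_cst.
- by move=> w; rewrite -real_normK ?num_real// lerXn2r// nnegrE (le_trans _ (gN n (Y n w))).
Qed.

(** Each variable is cut at a common level N: the centred truncated parts obey a variance bound, and
    the tails are small in L1 on average by uniform integrability. No moment beyond the first is
    required. *)
Theorem weak_law_L1 (x : nat -> S -> R) :
  (forall i, measurable_fun [set: S] (x i)) ->
  (forall i, intble P (x i \o Y i)) ->
  (forall eta : R, 0 < eta -> exists2 N : R, 0 <= N & forall n, (1 < n)%N ->
    n%:R^-1 * \sum_(i < n) \int[P]_w (`|x i (Y i w)| *
       \1_[set y | N < `|x i y|] (Y i w)) <= eta) ->
  \int[P]_w `|n%:R^-1 * \sum_(i < n) (x i (Y i w) - \int[P]_v x i (Y i v))| @[n --> \oo]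
    --> 0.
Proof.
move=> mx ix UI; apply/cvgrPdist_le => /= e e0.
pose eta := e / 4; have eta0 : 0 < eta by rewrite divr_gt0.
have [N N0 hN] := UI _ eta0.
have mI i : measurable [set y | N < `|x i y|].
  by apply: measurable_set_lt => //; exact: measurableT_comp.
pose t i y : R := x i y * \1_[set y | N < `|x i y|] y.
pose s i y : R := x i y - t i y.
have tE i y : t i y = if N < `|x i y| then x i y else 0.
  rewrite /t indicE; case: ifP => h.
    by rewrite mem_set ?mulr1.
  by rewrite memNset ?mulr0//= h.
have sN i y : `|s i y| <= N.
  rewrite /s tE; case: ltP => h; first by rewrite subrr normr0.
  by rewrite subr0.
have mt i : measurable_fun [set: S] (t i).
  by apply: measurable_funM => //; exact: measurable_indic.
have ms i : measurable_fun [set: S] (s i) by exact: measurable_funB.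
have bs i : bounded_measurable (s i \o Y i).
  by apply: bm_comp_RV; split => //; exists N.
have tx i y : `|t i y| = `|x i y| * \1_[set y | N < `|x i y|] y.
  by rewrite /t normrM (ger0_norm (_ : 0 <= \1__ _))// indicE.
have it i : intble P (t i \o Y i).
  apply: le_intble (intble_norm (ix i)); first exact: measurableT_comp.
  by move=> w /=; rewrite tx ler_piMr// indicE; case: (_ \in _).
pose c i y := s i y - \int[P]_v s i (Y i v).
have EsN i : `|\int[P]_v s i (Y i v)| <= N.
  rewrite -[leRHS](Ex_cst P); apply: Ex_norm_le.
  - exact: (bm_intble P (bs i)).
  - exact: intble_cst.
  - by move=> w; exact: sN.
have cN i y : `|c i y| <= 2 * N.
  rewrite (le_trans (ler_normB _ _))// (_ : 2 * N = N + N); last by ring.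
  by rewrite lerD.
have mc i : measurable_fun [set: S] (c i) by exact: measurable_funB.
have Ec i : \int[P]_w c i (Y i w) = 0.
  rewrite /c ExB ?Ex_cst ?subrr//; first exact: (bm_intble P (bs i)).
  exact: intble_cst.
have V n := Ex_sqr_sum_centered mc cN Ec n.
have bc i : bounded_measurable (c i \o Y i).
  by apply: bm_comp_RV; split => //; exists (2 * N).
have bSc n : bounded_measurable (fun w => \sum_(i < n) c i (Y i w)).
  elim: n => [|n IH].
    rewrite (_ : (fun w => _) = (fun=> 0)); first exact: bm_cst.
    by apply/funext => w; rewrite big_ord0.
  rewrite (_ : (fun w => _) = (fun w => \sum_(i < n) c i (Y i w) + (c n \o Y n) w)).
    exact: bmD.
  by apply/funext => w; rewrite big_ord_recr.
near=> n.
have n1 : (1 < n)%N by near: n; exact: nbhs_infty_gt.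
have n0 : (0 : R) < n%:R by rewrite ltr0n (ltn_trans _ n1).
have nb : 4 * N ^+ 2 / eta <= eta * n%:R.
  rewrite [leRHS]mulrC -ler_pdivrMr//; near: n; exact: nbhs_infty_ger.
rewrite sub0r normrN ger0_norm; last exact: Ex_ge0.
(* The inequality |a| <= eta/2 + a^2/(2 eta) converts the variance bound 4 N^2 / n <= eta^2 of the
   truncated average into a contribution eta to the mean. The centred tails contribute at most 2
   eta, and 3 eta <= e. *)
pose G w := (eta / 2 + (2 * eta)^-1 * ((n%:R^-1) ^+ 2 * (\sum_(i < n) c i (Y i w)) ^+ 2)) +
  n%:R^-1 * \sum_(i < n) (`|t i (Y i w)| + \int[P]_v `|t i (Y i v)|).
have iG1 : intble P (fun w => \sum_(i < n) (`|t i (Y i w)| + \int[P]_v `|t i (Y i v)|)).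
  apply: intble_sum => i; apply: intbleD; last exact: intble_cst.
  exact: (intble_norm (it i)).
have iG2 : intble P (fun w => (\sum_(i < n) c i (Y i w)) ^+ 2).
  by apply: bm_intble; exact: bmM.
have iG : intble P G.
  apply: intbleD; last exact: intbleZ.
  by apply: intbleD; [exact: intble_cst|do 2 apply: intbleZ].
apply: (@le_trans _ _ (\int[P]_w G w)).
  apply: le_Ex => //.
    apply: intble_norm; apply: intbleZ; apply: intble_sum => i.
    by apply: intbleB; [exact: ix|exact: intble_cst].
  move=> w; rewrite /G.
  have -> : n%:R^-1 * \sum_(i < n) (x i (Y i w) - \int[P]_v x i (Y i v)) =
      n%:R^-1 * (\sum_(i < n) c i (Y i w)) +
      n%:R^-1 * (\sum_(i < n) (t i (Y i w) - \int[P]_v t i (Y i v))).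
    rewrite -mulrDr -big_split/=; congr (_ * _); apply: eq_bigr => i _.
    have -> : \int[P]_v x i (Y i v) = \int[P]_v s i (Y i v) + \int[P]_v t i (Y i v).
      rewrite -ExD; [|exact: (bm_intble P (bs i))|exact: (it i)].
      by apply: eq_Rintegral => v _; rewrite /s subrK.
    by rewrite /c /s; ring.
  rewrite (le_trans (ler_normD _ _))// lerD//.
    set A := _ * _; have -> : (n%:R^-1) ^+ 2 * (\sum_(i < n) c i (Y i w)) ^+ 2 = `|A| ^+ 2.
      by rewrite real_normK ?num_real// /A exprMn.
    have := sqr_ge0 (`|A| - eta); set a := `|A|.
    rewrite invfM => h.
    have -> : eta / 2 + 2^-1 / eta * a ^+ 2 = a + (2^-1 / eta) * (a - eta) ^+ 2.
      by field; rewrite gt_eqF.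
    by rewrite lerDl mulr_ge0// mulr_ge0// ?invr_ge0 ltW.
  rewrite normrM ger0_norm ?invr_ge0 ?(ltW n0)// ler_wpM2l ?invr_ge0 ?(ltW n0)//.
  rewrite (le_trans (ler_norm_sum _ _ _))// ler_sum// => i _.
  rewrite (le_trans (ler_normB _ _))// lerD2l; exact: (Ex_norm (it i)).
rewrite /G ExD; [|by apply: intbleD; [exact: intble_cst|do 2 apply: intbleZ]|exact: intbleZ].
rewrite ExD; [|exact: intble_cst|by do 2 apply: intbleZ].
rewrite Ex_cst !ExZ//; last exact: intbleZ.
rewrite Ex_sum; last first.
  by move=> i; apply: intbleD; [exact: (intble_norm (it i))|exact: intble_cst].
have -> : \sum_(i < n) \int[P]_w (`|t i (Y i w)| + \int[P]_v `|t i (Y i v)|) =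
   2 * \sum_(i < n) \int[P]_w (`|x i (Y i w)| * \1_[set y | N < `|x i y|] (Y i w)).
  rewrite mulr_sumr; apply: eq_bigr => i _.
  rewrite ExD ?Ex_cst; [|exact: (intble_norm (it i))|exact: intble_cst].
  rewrite mulrDl mul1r; congr (_ + _); apply: eq_Rintegral => w _; exact: tx.
have h1 := hN n n1.
rewrite [n%:R^-1 * (2 * _)]mulrCA.
have h2 : (2 * eta)^-1 * (n%:R^-1 ^+ 2 * \int[P]_w (\sum_(i < n) c i (Y i w)) ^+ 2) <= eta / 2.
  have : n%:R^-1 ^+ 2 * \int[P]_w (\sum_(i < n) c i (Y i w)) ^+ 2 <= n%:R^-1 * (4 * N ^+ 2).
    rewrite expr2 -mulrA ler_pM2l ?invr_gt0// ler_pdivrMl// (le_trans (V n))//.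
    by rewrite exprMn; lra.
  move=> h; rewrite invfM -mulrA mulrC ler_pM2r// ler_pdivrMl//.
  rewrite (le_trans h)// ler_pdivrMl//.
  move: nb; rewrite ler_pdivrMr// => /le_trans; apply.
  by rewrite [leRHS](_ : _ = eta * n%:R * eta)//; ring.
rewrite /eta in h1 h2 *; lra.
Unshelve. all: by end_near. Qed.

End weak_law.

(** * Events of high probability and Slutsky's lemma *)

Section with_high_probability.
Context {d} {T : measurableType d} {R : realType} (P : probability T R).

(** A measurable cover of the complement replaces the measure of A n, which need not be measurable.
    Keeping delta fixed allows events whose very definition depends on delta, such as {|Z_n| <= K}
    with K from tightness, to be intersected with the others. *)
Definition near_cover delta (A : nat -> set T) := \forall n \near \oo,
  exists C, [/\ measurable C, fine (P C) <= delta & ~` A n `<=` C].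

Definition whp (A : nat -> set T) := forall delta : R, 0 < delta -> near_cover delta A.

Lemma fine_measureU (A B : set T) : measurable A -> measurable B ->
  fine (P (A `|` B)) <= fine (P A) + fine (P B).
Proof.
move=> mA mB; rewrite -fineD ?fin_num_measure//; apply: fine_le.
- by rewrite fin_num_measure//; exact: measurableU.
- by rewrite fin_numD !fin_num_measure.
- exact: measureU2.
Qed.

Lemma le_fine_measure (A B : set T) : measurable A -> measurable B ->
  A `<=` B -> fine (P A) <= fine (P B).
Proof.
move=> mA mB AB; apply: fine_le; rewrite ?fin_num_measure//.
by apply: le_measure; rewrite ?inE.
Qed.

Lemma near_coverI d1 d2 (A B : nat -> set T) : near_cover d1 A -> near_cover d2 B ->
  near_cover (d1 + d2) (fun n => A n `&` B n).
Proof.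
move=> cA cB; near=> n.
have [C [mC PC AC]] : exists C, [/\ measurable C, fine (P C) <= d1 & ~` A n `<=` C].
  by near: n; exact: cA.
have [D [mD PD BD]] : exists D, [/\ measurable D, fine (P D) <= d2 & ~` B n `<=` D].
  by near: n; exact: cB.
exists (C `|` D); split; first exact: measurableU.
- by apply: (le_trans (fine_measureU mC mD)); exact: lerD.
- by rewrite setCI => w [/AC|/BD]; [left|right].
Unshelve. all: by end_near. Qed.

Lemma near_cover_sub delta (A B : nat -> set T) : (\forall n \near \oo, A n `<=` B n) ->
  near_cover delta A -> near_cover delta B.
Proof.
move=> AB cA; near=> n.
have [C [mC PC AC]] : exists C, [/\ measurable C, fine (P C) <= delta & ~` A n `<=` C].
  by near: n; exact: cA.
exists C; split => // w nB; apply: AC; apply: contra_not nB.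
by move: w; near: n; exact: AB.
Unshelve. all: by end_near. Qed.

Lemma near_cover_markov (F : nat -> T -> R) (c delta K : R) : 0 < K ->
  (forall n, intble P (F n)) -> (forall n w, 0 <= F n w) ->
  (\forall n \near \oo, \int[P]_w F n w <= c) -> c <= K * delta ->
  near_cover delta (fun n => [set w | F n w < K]).
Proof.
move=> K0 iF F0 Fc cK; apply: filterS Fc => n Fc.
have mF := intble_measurable (iF n).
exists [set w | K <= F n w]; split.
- exact: measurable_set_le.
- by rewrite (le_trans (Ex_markov (iF n) (F0 n) K0))// ler_pdivrMr// (le_trans Fc)// mulrC.
- by move=> w /negP; rewrite -leNgt.
Qed.

Lemma whp_markov (F : nat -> T -> R) (e : R) : 0 < e ->
  (forall n, intble P (F n)) -> (forall n w, 0 <= F n w) ->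
  \int[P]_w F n w @[n --> \oo] --> 0 -> whp (fun n => [set w | F n w < e]).
Proof.
move=> e0 iF F0 cF delta d0.
have ed : 0 < e * delta by exact: mulr_gt0.
apply: (near_cover_markov e0 iF F0 _ (lexx (e * delta))).
move/cvgrPdist_le: cF => /(_ _ ed); apply: filterS => n.
by rewrite sub0r normrN; exact: le_trans (ler_norm _).
Qed.

Lemma whp_of_with_probability (A : nat -> set T) :
  with_probability_tending_to_one P A -> whp A.
Proof.
move=> [B [mB BA cB]] delta d0.
have cB' : fine (P (B n)) @[n --> \oo] --> (1 : R) by exact: (fine_cvg cB).
move/cvgrPdist_le: cB' => /(_ _ d0); apply: filterS => n H.
exists (~` B n); split; first exact: measurableC.
  rewrite probability_setC// fineB// ?fin_num_measure//=.
  by rewrite (le_trans _ H)// ler_norm.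
by apply: subsetC; exact: BA.
Qed.

Lemma whp_of_cvg_in_probability p (X : nat -> T -> 'rV[R]_p) (x : 'rV[R]_p) (e : R) :
  (forall n, measurable [set w | e < norm2 (X n w - x)]) ->
  cvg_in_probability P X x -> 0 < e -> whp (fun n => [set w | norm2 (X n w - x) <= e]).
Proof.
move=> mX cX e0 delta d0.
have := cX e e0 => /fine_cvg /cvgrPdist_le /(_ _ d0); apply: filterS => n.
rewrite sub0r normrN ger0_norm ?fine_ge0// => H.
exists [set w | e < norm2 (X n w - x)]; split => //.
by move=> w /= /negP; rewrite -ltNge.
Qed.

Lemma whp_ae (A : set T) : measurable A -> P (~` A) = 0%E -> whp (fun=> A).
Proof.
move=> mA A0 delta d0; apply: nearW => _; exists (~` A); split => //.
  exact: measurableC.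
by rewrite A0 ltW.
Qed.

(** The comparison hypothesis concerns positive points, so the others are treated apart. If x < 0,
    closeness to a nonnegative X n excludes W n <= x. If x <= 0, the limiting distribution function
    vanishes to the left of x and is small at x by continuity. Elsewhere x is moved once for the
    distance from W n to X n and once for the gap of the comparison, and continuity at x absorbs
    both moves. *)
Lemma slutsky_cdf (W X : nat -> T -> R) (Q : probability (measurableTypeR R) R) :
  (forall n, measurable_fun [set: T] (W n)) ->
  (forall n, measurable_fun [set: T] (X n)) ->
  (forall n w, 0 <= X n w) -> Q `]-oo, 0[%classic = 0%E ->
  (forall x y eta, 0 < x -> x < y -> 0 < eta ->
   (\forall n \near \oo, fine (P [set w | X n w <= x]) <= fine (Q `]-oo, y]%classic) + eta) /\
   (\forall n \near \oo, fine (Q `]-oo, x]%classic) <= fine (P [set w | X n w <= y]) + eta)) ->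
  (forall e, 0 < e -> whp (fun n => [set w | `|W n w - X n w| <= e])) ->
  cvg_in_law P W Q.
Proof.
move=> mW mX X0 Q0 hX hW x cQ.
pose q t := fine (Q `]-oo, t]%classic).
have finQ t : Q `]-oo, t]%classic \is a fin_num by rewrite fin_num_measure.
have mAW n c : measurable [set w | W n w <= c] by apply: measurable_set_le.
have mAX n c : measurable [set w | X n w <= c] by apply: measurable_set_le.
suff H : fine (P [set w | W n w <= x]) @[n --> \oo] --> q x.
  rewrite -(fineK (finQ x)).
  apply: cvg_trans (cvg_EFin (nearW _ (fun n => fin_num_measure P _ (mAW n x))) H).
  exact: cvg_id.
have cq : {for x, continuous q}.
  have cQ' : Q `]-oo, t]%classic @[t --> x] --> (q x)%:E by rewrite /q fineK.
  exact: fine_cvg cQ'.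
apply/cvgrPdist_le => /= eta eta0.
have e4 : 0 < eta / 4 by rewrite divr_gt0.
move/cvgrPdist_le: cq => /(_ _ e4) [rho /= rho0 hrho].
have qx t : `|x - t| < rho -> q x <= q t + eta / 4 /\ q t <= q x + eta / 4.
  by move=> /hrho; rewrite ler_norml => /andP[a b]; split; lra.
have goodset (A : nat -> set T) (B C : set T) n delta : measurable B -> measurable C ->
   (exists D, [/\ measurable D, fine (P D) <= delta & ~` A n `<=` D]) ->
   A n `&` B `<=` C -> fine (P B) <= fine (P C) + delta.
  move=> mB mC [D [mD D1 D2]] ABC.
  apply: (@le_trans _ _ (fine (P (C `|` D)))).
    apply: le_fine_measure => //; first exact: measurableU.
    move=> w Bw; have [Aw|nA] := pselect (A n w); first by left; apply: ABC.
    by right; apply: D2.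
  by rewrite (le_trans (fine_measureU mC mD))// lerD2l.
have up : \forall n \near \oo, fine (P [set w | W n w <= x]) <= q x + eta.
  have [x0|x0] := ltP x 0.
    have x2 : 0 < - x / 2 by rewrite divr_gt0// oppr_gt0.
    have := hW _ x2 _ eta0; apply: filterS => n h.
    apply: le_trans (goodset (fun n => [set w | `|W n w - X n w| <= - x / 2])
      _ set0 n _ (mAW n x) measurable0 h _) _.
      move=> w [/=]; rewrite ler_norml => /andP[a _] b.
      by have := X0 n w; lra.
    by rewrite measure0/= add0r lerDr fine_ge0.
  have r4 : 0 < rho / 4 by rewrite divr_gt0.
  have y0 : 0 < x + rho / 4 by lra.
  have yy : x + rho / 4 < x + rho / 2 by lra.
  have [h1 _] := hX _ _ _ y0 yy e4.
  near=> n.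
  have := @goodset (fun n => [set w | `|W n w - X n w| <= rho / 4]) [set w | W n w <= x]
     [set w | X n w <= x + rho / 4] n (eta / 4) (mAW _ _) (mAX _ _).
  have h2 : exists D : set T,
     [/\ d.-measurable D, fine (P D) <= eta / 4 & ~` [set w | `|W n w - X n w| <= rho / 4] `<=` D].
    by near: n; exact: hW.
  move=> /(_ h2) h3.
  have h4 : fine (P [set w | W n w <= x]) <= fine (P [set w | X n w <= x + rho / 4]) + eta / 4.
    by apply: h3 => w [/=]; rewrite ler_norml => /andP[a b] c; lra.
  have h5 : fine (P [set w | X n w <= x + rho / 4]) <= q (x + rho / 2) + eta / 4.
    by near: n.
  have [_ h6] : q x <= q (x + rho / 2) + eta / 4 /\ q (x + rho / 2) <= q x + eta / 4.
    by apply: qx; rewrite opprD addNKr normrN ger0_norm; lra.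
  lra.
have lo : \forall n \near \oo, q x <= fine (P [set w | W n w <= x]) + eta.
  have [x0|x0] := leP x 0.
    apply: nearW => n.
    have [+ _] : q x <= q (x - rho / 2) + eta / 4 /\ q (x - rho / 2) <= q x + eta / 4.
      by apply: qx; rewrite opprB addrC subrK ger0_norm; lra.
    have -> : q (x - rho / 2) = 0.
      apply/eqP; rewrite eq_le fine_ge0// andbT -[leRHS](_ : fine (Q `]-oo, 0[%classic) = _).
        apply: fine_le; rewrite ?fin_num_measure//; apply: le_measure; rewrite ?inE//.
        by move=> t /=; rewrite !in_itv/=; lra.
      by rewrite Q0.
    have : (0 : R) <= fine (P [set w | W n w <= x]) := fine_ge0 (measure_ge0 P _).
    by lra.
  (* The minimum with x keeps both x - r/2 and x - r/4 positive. *)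
  pose r := Num.min rho x.
  have r0 : 0 < r by rewrite lt_min rho0.
  have rr : r <= rho by rewrite ge_min lexx.
  have rx : r <= x by rewrite ge_min lexx orbT.
  have r4 : 0 < r / 4 by rewrite divr_gt0.
  have y0 : 0 < x - r / 2 by lra.
  have yy : x - r / 2 < x - r / 4 by lra.
  have [_ h1] := hX _ _ _ y0 yy e4.
  near=> n.
  have h2 : exists D : set T,
     [/\ d.-measurable D, fine (P D) <= eta / 4 & ~` [set w | `|W n w - X n w| <= r / 4] `<=` D].
    by near: n; exact: hW.
  have h4 : fine (P [set w | X n w <= x - r / 4]) <= fine (P [set w | W n w <= x]) + eta / 4.
    apply: (@goodset (fun n => [set w | `|W n w - X n w| <= r / 4]) _ _ n _ _ _ h2) => //.
    by move=> w [/=]; rewrite ler_norml => /andP[a b] c; lra.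
  have h5 : q (x - r / 2) <= fine (P [set w | X n w <= x - r / 4]) + eta / 4.
    by near: n.
  have [h6 _] : q x <= q (x - r / 2) + eta / 4 /\ q (x - r / 2) <= q x + eta / 4.
    by apply: qx; rewrite opprB addrC subrK ger0_norm; lra.
  lra.
near=> n; rewrite ler_norml; apply/andP; split.
  have : fine (P [set w | W n w <= x]) <= q x + eta by near: n.
  by lra.
have : q x <= fine (P [set w | W n w <= x]) + eta by near: n.
by lra.
Unshelve. all: by end_near. Qed.

End with_high_probability.

(** * Matrices *)

Section matrix_norms.
Context {R : realType}.

Lemma le_mx_norm_coord m n (A : 'M[R]_(m, n)) i j : `|A i j| <= `|A|.
Proof. by rewrite /Num.norm/= mx_normrE; exact: (le_bigmax _ _ (i, j)). Qed.

Lemma mx_norm_leP m n (A : 'M[R]_(m, n)) c : 0 <= c ->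
  (forall i j, `|A i j| <= c) -> `|A| <= c.
Proof.
by move=> c0 Ac; rewrite /Num.norm/= mx_normrE; apply: bigmax_le => // i _; exact: Ac.
Qed.

(** The norm is the largest absolute value of an entry, hence the factor n. *)
Lemma mx_norm_mul m n k (A : 'M[R]_(m, n)) (B : 'M[R]_(n, k)) :
  `|A *m B| <= n%:R * `|A| * `|B|.
Proof.
apply: mx_norm_leP => [|i j]; first by rewrite !mulr_ge0.
rewrite mxE (le_trans (ler_norm_sum _ _ _))//.
apply: (@le_trans _ _ (\sum_(l < n) `|A| * `|B|)).
  by apply: ler_sum => l _; rewrite normrM ler_pM// le_mx_norm_coord.
by rewrite sumr_const card_ord -mulrA mulr_natl.
Qed.

Lemma mx_norm_tr m n (A : 'M[R]_(m, n)) : `|A^T| <= `|A|.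
Proof. by apply: mx_norm_leP => // i j; rewrite mxE le_mx_norm_coord. Qed.

Lemma sqr_norm2 p (x : 'rV[R]_p) : norm2 x ^+ 2 = \sum_j x 0 j ^+ 2.
Proof. by rewrite sqr_sqrtr// sumr_ge0// => j _; rewrite sqr_ge0. Qed.

Lemma norm2_ge0 p (x : 'rV[R]_p) : 0 <= norm2 x.
Proof. exact: sqrtr_ge0. Qed.

Lemma mulmx_trE p (x y : 'rV[R]_p) : (x *m y^T) 0 0 = \sum_j x 0 j * y 0 j.
Proof. by rewrite mxE; apply: eq_bigr => j _; rewrite mxE. Qed.

Lemma mulmx_tr_norm2 p (x : 'rV[R]_p) : (x *m x^T) 0 0 = norm2 x ^+ 2.
Proof. by rewrite mulmx_trE sqr_norm2; apply: eq_bigr => j _. Qed.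

Lemma coord_le_norm2 p (x : 'rV[R]_p) j : `|x 0 j| <= norm2 x.
Proof.
rewrite -sqrtr_sqr ler_wsqrtr// (bigD1 j)//= lerDl sumr_ge0// => i _.
exact: sqr_ge0.
Qed.

Lemma mx_norm_le_norm2 p (x : 'rV[R]_p) : `|x| <= norm2 x.
Proof.
apply: mx_norm_leP => [|i j]; first exact: norm2_ge0.
by rewrite ord1; exact: coord_le_norm2.
Qed.

Lemma norm2_eq0 p (x : 'rV[R]_p) : norm2 x = 0 -> x = 0.
Proof.
move=> x0; apply/rowP => j; rewrite mxE; apply/normr0_eq0/eqP.
by rewrite eq_le normr_ge0 andbT -x0 coord_le_norm2.
Qed.

Lemma norm2Z p c (x : 'rV[R]_p) : norm2 (c *: x) = `|c| * norm2 x.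
Proof.
rewrite /norm2 -sqrtr_sqr -sqrtrM ?sqr_ge0// mulr_sumr; congr Num.sqrt.
by apply: eq_bigr => j _; rewrite mxE exprMn.
Qed.

Lemma mx11_tr (A : 'M[R]_1) : A^T 0 0 = A 0 0.
Proof. by rewrite mxE. Qed.

End matrix_norms.

Lemma continuous_sum_at (R : realType) (T : topologicalType) (I : Type) (r : seq I)
    (f : I -> T -> R) (x : T) : (forall i, {for x, continuous (f i)}) ->
  {for x, continuous (fun y => \sum_(i <- r) f i y)}.
Proof.
move=> cf; elim: r => [|i r IH].
  rewrite (_ : (fun y => _) = (fun=> 0)); first exact: cvg_cst.
  by apply/funext => y; rewrite big_nil.
rewrite (_ : (fun y => _) = (fun y => f i y + \sum_(j <- r) f j y)).
  by apply: cvgD; [exact: cf|exact: IH].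
by apply/funext => y; rewrite big_cons.
Qed.

(** * The minimum eigenvalue as a lower bound of the quadratic form *)

Section min_eigenvalue.
Context {R : realType} {p : nat}.
Implicit Types (A : 'M[R]_p) (x y : 'rV[R]_p).

Let form A x y := (x *m A *m y^T) 0 0.

Let formDl A x y z : form A (x + y) z = form A x z + form A y z.
Proof. by rewrite /form !mulmxDl mxE. Qed.

Let formDr A x y z : form A x (y + z) = form A x y + form A x z.
Proof. by rewrite /form linearD mulmxDr mxE. Qed.

Let formZl A c x y : form A (c *: x) y = c * form A x y.
Proof. by rewrite /form -!scalemxAl mxE. Qed.

Let formZr A c x y : form A x (c *: y) = c * form A x y.
Proof. by rewrite /form linearZ -scalemxAr mxE. Qed.

Let formC A x y : A^T = A -> form A x y = form A y x.
Proof.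
move=> At; rewrite /form -[LHS]mx11_tr !trmx_mul trmxK At.
by rewrite mulmxA.
Qed.

(** With y = x A, nonnegativity of the form at x - e y reads 2 |y|^2 <= e A(y, y) for every e > 0.
    If y were nonzero, e = |y|^2 / (1 + A(y, y)) would contradict this. *)
Lemma psd_isotropic A x : A^T = A -> (forall y, 0 <= form A y y) ->
  form A x x = 0 -> x *m A = 0.
Proof.
move=> At A0 Ax; pose y := x *m A.
have bE : form A x y = norm2 y ^+ 2 by rewrite -mulmx_tr_norm2.
have H e : 0 < e -> 2 * norm2 y ^+ 2 <= e * form A y y.
  move=> e0; have := A0 (x + (- e) *: y).
  rewrite formDl !formDr !formZl !formZr Ax -/y (formC y x At) bE.
  rewrite add0r => h.
  have : 0 <= e * (e * form A y y - 2 * norm2 y ^+ 2) by move: h; nra.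
  by rewrite pmulr_rge0// subr_ge0.
apply: norm2_eq0; apply/eqP; rewrite -sqrf_eq0; apply/eqP.
apply/eqP; rewrite eq_le sqr_ge0 andbT leNgt; apply/negP => y0.
have c0 : 0 <= form A y y := A0 y.
have e0 : 0 < norm2 y ^+ 2 / (1 + form A y y) by rewrite divr_gt0//; lra.
have := H _ e0; rewrite mulrAC ler_pdivlMr; last by lra.
by nra.
Qed.

(** The form attains its minimum m on the unit sphere, which is nonempty because p > 0. At a
    minimizer A - m is positive semidefinite and isotropic, so the minimizer is an eigenvector for
    m. As [min_eigenvalue] is an infimum, it is at most m once the spectrum is known to be bounded
    below, here by 0. *)
Lemma min_eigenvalue_le A : (0 < p)%N -> posdefmx A ->
  0 <= min_eigenvalue A /\ forall x, min_eigenvalue A * norm2 x ^+ 2 <= form A x x.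
Proof.
move=> p0 [At A0].
pose K : set 'rV[R]_p := [set x | \sum_j x 0 j ^+ 2 = 1].
have ccoord j : continuous (fun x : 'rV[R]_p => x 0 j) by exact: coord_continuous.
have csum : continuous (fun x : 'rV[R]_p => \sum_j x 0 j ^+ 2).
  move=> x; apply: continuous_sum_at => j.
  exact: (cvgM (ccoord j x) (ccoord j x)).
have cform : continuous (fun x => form A x x).
  rewrite (_ : (fun x => _) = (fun x : 'rV[R]_p => \sum_j (\sum_i x 0 i * A i j) * x 0 j)).
    move=> x; apply: continuous_sum_at => j.
    have cin : {for x, continuous (fun y : 'rV[R]_p => \sum_i y 0 i * A i j)}.
      by apply: continuous_sum_at => i; exact: (cvgM (ccoord i x) (cvg_cst (A i j))).
    exact: (cvgM cin (ccoord j x)).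
  by apply/funext => x; rewrite /form mulmx_trE; apply: eq_bigr => j _; rewrite mxE.
have cK : compact K.
  apply: bounded_closed_compact.
    exists 1; split => // M M1 x /= Kx; rewrite (le_trans _ (ltW M1))//.
    rewrite (le_trans (mx_norm_le_norm2 x))// -[leRHS]sqrtr1 /norm2 Kx.
    exact: lexx.
  rewrite (_ : K = (fun x : 'rV[R]_p => \sum_j x 0 j ^+ 2) @^-1` [set 1]) //.
  by apply: preimage_closed => //; exact: closed_eq.
have K0 : K !=set0.
  exists (delta_mx 0 (Ordinal p0)); rewrite /K /= (bigD1 (Ordinal p0))//= mxE !eqxx.
  rewrite expr1n big1 ?addr0// => j jp; rewrite mxE (negbTE jp) andbF expr0n//.
have [x0 + x0min] := EVT_min_rV K0 cK (continuous_subspaceT cform).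
rewrite inE /K /= => Kx0.
pose m := form A x0 x0.
have Hm y : m * norm2 y ^+ 2 <= form A y y.
  have [->|y0] := eqVneq y 0.
    by rewrite -(scale0r y) norm2Z formZl normr0 !mul0r expr0n mulr0.
  have ny : 0 < norm2 y.
    rewrite lt_neqAle norm2_ge0 andbT eq_sym; apply: contra y0 => /eqP/norm2_eq0 ->.
    exact: eqxx.
  have : (norm2 y)^-1 *: y \in K.
    rewrite inE /K /= -sqr_norm2 norm2Z ger0_norm ?invr_ge0 ?norm2_ge0//.
    by rewrite mulVf ?expr1n// gt_eqF.
  move=> /x0min; rewrite -/m formZl formZr mulrA -expr2 exprVn.
  by rewrite mulrC ler_pdivlMr// exprn_gt0.
have nx0 : norm2 x0 = 1 by rewrite /norm2 Kx0 sqrtr1.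
have formB y z : form (A - m%:M) y z = form A y z - m * (y *m z^T) 0 0.
  by rewrite /form mulmxBr mul_mx_scalar mulmxBl -scalemxAl !mxE.
have x0A : x0 *m (A - m%:M) = 0.
  apply: psd_isotropic.
  - by rewrite linearB/= tr_scalar_mx At.
  - by move=> y; rewrite formB mulmx_tr_norm2 subr_ge0.
  - by rewrite formB mulmx_tr_norm2 nx0 expr1n mulr1 subrr.
have em : eigenvalue A m.
  apply/eigenvalueP; exists x0.
    by move/eqP: x0A; rewrite mulmxBr mul_mx_scalar subr_eq0 => /eqP.
  apply/eqP => x00; move: nx0; rewrite x00 -(scale0r (0 : 'rV[R]_p)) norm2Z normr0 mul0r.
  by move/eqP; rewrite eq_sym oner_eq0.
have lb : lbound [set a | eigenvalue A a] 0.
  move=> a /= /eigenvalueP[v va v0].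
  have := A0 v v0; rewrite va -scalemxAl mxE mulmx_tr_norm2 => h.
  rewrite leNgt; apply/negP => a0; move: h; rewrite ltNge; apply/negP; rewrite negbK.
  by rewrite mulr_le0_ge0 ?(ltW a0) ?sqr_ge0.
split; first by apply: lb_le_inf => //; exists m.
move=> x; apply: le_trans (Hm x); rewrite ler_wpM2r ?sqr_ge0//.
by apply: ge_inf => //; exists 0.
Qed.

Lemma posdef_unitmx A : posdefmx A -> A \in unitmx.
Proof.
move=> [At A0]; rewrite -row_free_unit -kermx_eq0; apply/eqP/row_matrixP => i.
rewrite row0; apply/eqP/negPn/negP => /A0.
by rewrite -row_mul mulmx_ker row0 mul0mx mxE ltxx.
Qed.

(** If x is the i-th row of the inverse, then x A is the i-th unit vector, so c |x|^2 <= x_i <=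
    |x|. *)
Lemma invmx_bound A c : 0 < c -> posdefmx A ->
  (forall x, c * norm2 x ^+ 2 <= form A x x) -> `|invmx A| <= c^-1.
Proof.
move=> c0 pA Ac; have uA := posdef_unitmx pA.
apply: mx_norm_leP => [|i j]; first by rewrite invr_ge0 ltW.
pose x := row i (invmx A).
have xA : x *m A = delta_mx 0 i by rewrite /x rowE -mulmxA mulVmx// mulmx1.
have := Ac x; rewrite /form xA -rowE mxE [(x^T) _ _]mxE => h.
have xx : c * norm2 x ^+ 2 <= norm2 x.
  by rewrite (le_trans h)// (le_trans (ler_norm _))// coord_le_norm2.
have : `|x 0 j| <= c^-1.
  rewrite (le_trans (coord_le_norm2 x j))//.
  have [->|nx] := eqVneq (norm2 x) 0; first by rewrite invr_ge0 ltW.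
  have nx0 : 0 < norm2 x by rewrite lt_neqAle eq_sym nx norm2_ge0.
  rewrite -[leRHS]mul1r ler_pdivlMr// -(ler_pM2r nx0) mul1r.
  by move: xx; rewrite expr2; lra.
by rewrite /x mxE.
Qed.

End min_eigenvalue.

(** * Convergence of inverses and of the sandwich form *)

Section inverse_limit.
Context {R : realType} {p : nat}.

(** From S^(-1) - Sg^(-1) = S^(-1) (Sg - S) Sg^(-1). The first bound in [eta] makes the right-hand
    side at most half of |S^(-1)|, which yields |S^(-1)| <= 2 |Sg^(-1)|; the second then brings the
    difference below e. The constant [q] is p^2, one factor p per product. *)
Lemma cvg_invmx (S_ : nat -> 'M[R]_p) (Sg : 'M[R]_p) :
  (forall n, (0 < n)%N -> S_ n \in unitmx) -> Sg \in unitmx ->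
  S_ n @[n --> \oo] --> Sg ->
  forall e, 0 < e -> \forall n \near \oo, `|invmx (S_ n) - invmx Sg| <= e.
Proof.
move=> uS uSg cS e e0; pose a := `|invmx Sg|.
have a0 : 0 <= a by exact: normr_ge0.
pose q : R := p%:R ^+ 2.
have q0 : 0 <= q by exact: sqr_ge0.
pose eta := Num.min (1 / (2 * (1 + q * a))) (e / (2 * (1 + q * a * a))).
have p1 : 0 < 1 + q * a by nra.
have p2 : 0 < 1 + q * a * a by nra.
have eta0 : 0 < eta.
  by rewrite lt_min !divr_gt0// mulr_gt0.
move/cvgrPdist_le: cS => /(_ _ eta0) cS; near=> n.
have n0 : (0 < n)%N by near: n; exact: nbhs_infty_gt.
have hd : `|Sg - S_ n| <= eta by near: n.
have idE : invmx (S_ n) - invmx Sg = invmx (S_ n) *m (Sg - S_ n) *m invmx Sg.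
  by rewrite mulmxBr mulmxBl mulVmx ?uS// mul1mx mulmxK.
pose b := `|invmx (S_ n)|.
have hb : `|invmx (S_ n) - invmx Sg| <= q * b * eta * a.
  rewrite idE (le_trans (mx_norm_mul _ _))//.
  have := mx_norm_mul (invmx (S_ n)) (Sg - S_ n); rewrite -/b => h.
  have : p%:R * b * `|Sg - S_ n| <= p%:R * b * eta by rewrite ler_wpM2l// mulr_ge0// normr_ge0.
  move=> h'; have h'' := le_trans h h'.
  rewrite -/a /q expr2 [leRHS](_ : _ = p%:R * (p%:R * b * eta) * a); last by ring.
  by rewrite ler_wpM2r// ler_wpM2l.
have b0 : 0 <= b by exact: normr_ge0.
have h1 : eta * (2 * (1 + q * a)) <= 1.
  by rewrite -ler_pdivlMr ?mulr_gt0// ge_min lexx.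
have h2 : eta * (2 * (1 + q * a * a)) <= e.
  by rewrite -ler_pdivlMr ?mulr_gt0// ge_min lexx orbT.
have hb2 : b <= 2 * a.
  have : b <= a + q * b * eta * a.
    rewrite (le_trans _ (lerD (lexx _) hb))// /b /a -[X in `|X| <= _](subrK (invmx Sg)).
    by rewrite addrC (le_trans (ler_normD _ _)).
  have : b * (eta * (2 * (1 + q * a))) <= b * 1 by rewrite ler_wpM2l.
  have := mulr_ge0 b0 (ltW eta0).
  by move=> X1 X2 X3; nra.
rewrite (le_trans hb)//.
have : q * b * eta * a <= q * (2 * a) * eta * a.
  by rewrite ler_wpM2r// ler_wpM2r ?(ltW eta0)// ler_wpM2l.
move=> /le_trans; apply; rewrite (le_trans _ h2)//.
by have := mulr_ge0 q0 (mulr_ge0 a0 a0); nra.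
Unshelve. all: by end_near. Qed.

Variables (Psi_ Om B : nat -> 'M[R]_p) (Sg : 'M[R]_p) (C : R).
Hypothesis uPsi : forall n, (0 < n)%N -> Psi_ n \in unitmx.
Hypothesis sPsi : forall n, (0 < n)%N -> (Psi_ n)^T = Psi_ n.
Hypothesis bPsi : forall n, (0 < n)%N -> `|invmx (Psi_ n)| <= C.
Hypothesis hB : forall n, (0 < n)%N -> is_invsqrtmx (Om n) (B n).
Hypothesis cS : invmx (Psi_ n) *m Om n *m invmx (Psi_ n) @[n --> \oo] --> Sg.
Hypothesis uSg : Sg \in unitmx.

(* M^T M is the sandwich matrix, so M Sg^-1 M^T tends to the identity. *)
Lemma sandwich_quadratic_form (K e : R) : 0 <= K -> 0 < e ->
  exists2 eta, 0 < eta & \forall n \near \oo, forall (z u : 'rV[R]_p) (E : 'M[R]_p),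
    `|z| <= K -> `|E| <= eta -> u *m (Psi_ n + E) = z *m invmx (B n) ->
    `|(u *m invmx Sg *m u^T) 0 0 - (z *m z^T) 0 0| <= e.
Proof.
move=> K0 e0.
pose S_ n := invmx (Psi_ n) *m Om n *m invmx (Psi_ n).
pose M n := invmx (B n) *m invmx (Psi_ n).
have uB n : (0 < n)%N -> B n \in unitmx by move=> /hB[_ /posdef_unitmx].
have uM n : (0 < n)%N -> M n \in unitmx.
  by move=> n0; rewrite unitmx_mul !unitmx_inv uB//= uPsi.
have MM n : (0 < n)%N -> (M n)^T *m M n = S_ n.
  move=> n0; have [uO [Bt _] BB] := hB n0.
  rewrite /M trmx_mul !trmx_inv Bt sPsi// /S_ !mulmxA; congr (_ *m _).
  rewrite -!mulmxA; congr (_ *m _).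
  have OB : Om n *m B n *m B n = 1%:M by rewrite -mulmxA BB mulmxV.
  by rewrite -[RHS](mulmxK (uB n n0)) -[Om n *m B n](mulmxK (uB n n0)) OB mul1mx.
have uS n : (0 < n)%N -> S_ n \in unitmx.
  by move=> n0; rewrite -MM// unitmx_mul unitmx_tr uM.
pose q : R := p%:R; pose g := `|invmx Sg|.
have q0 : 0 <= q by [].
have g0 : 0 <= g by exact: normr_ge0.
have C0 : 0 <= C := le_trans (normr_ge0 _) (bPsi (n := 1%N) isT).
pose CM := 2 + `|Sg|; have CM0 : 0 <= CM by rewrite addr_ge0// normr_ge0.
pose Cz := q * K * CM; have Cz0 : 0 <= Cz by rewrite !mulr_ge0.
pose d := e / (2 * (1 + q ^+ 2 * Cz ^+ 2)).
have d0 : 0 < d.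
  by rewrite divr_gt0// mulr_gt0// ltr_pwDl// mulr_ge0// sqr_ge0.
(* With r = u - z M = - u E Psi_n^(-1), the constant A1 is such that |r| <= A1 eta |u| <= |u| / 2.
   Hence |u| <= 2 Cz, where Cz bounds |z M|. The constant A2 collects the two cross terms containing
   r, one against z M and one against u, whence the factor 3 = 1 + 2. *)
pose A1 := q ^+ 2 * C; have A10 : 0 <= A1 by rewrite mulr_ge0// sqr_ge0.
pose A2 := q ^+ 2 * g * Cz * 3 * (q ^+ 2 * (2 * Cz) * C).
have A20 : 0 <= A2 by rewrite !mulr_ge0// sqr_ge0.
pose eta := Num.min (1 / (2 * (1 + A1))) (e / (2 * (1 + A2))).
have eta0 : 0 < eta by rewrite lt_min !divr_gt0// mulr_gt0// ltr_pwDl.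
have h1 : A1 * eta <= 2^-1.
  have : eta * (2 * (1 + A1)) <= 1.
    by rewrite -ler_pdivlMr ?mulr_gt0 ?ltr_pwDl// ge_min lexx.
  by lra.
have h2 : A2 * eta <= e / 2.
  have : eta * (2 * (1 + A2)) <= e.
    by rewrite -ler_pdivlMr ?mulr_gt0 ?ltr_pwDl// ge_min lexx orbT.
  by lra.
have h3 : q ^+ 2 * Cz ^+ 2 * d <= e / 2.
  have : d * (2 * (1 + q ^+ 2 * Cz ^+ 2)) <= e.
    rewrite -ler_pdivlMr// mulr_gt0// ltr_pwDl// mulr_ge0// sqr_ge0//.
  by lra.
exists eta => //.
have := cvg_invmx uS uSg cS d0; move/cvgrPdist_le: cS => /(_ _ ltr01) bS HG.
near=> n => z u E zK Ee uE.
have n0 : (0 < n)%N by near: n; exact: nbhs_infty_gt.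
have Gd : `|invmx (S_ n) - invmx Sg| <= d by near: n.
have SgS : `|Sg - S_ n| <= 1 by near: n.
have S1 : `|S_ n| <= `|Sg| + 1.
  rewrite -[S_ n](subrK Sg) addrC (le_trans (ler_normD _ _))// lerD2l distrC//.
(* The diagonal of M^T M = S_n holds the sums of squares of the columns of M, so every squared entry
   is at most |S_n| <= |Sg| + 1; then a <= 1 + a^2 avoids a square root. *)
have MCM : `|M n| <= CM.
  apply: mx_norm_leP => // i j.
  apply: (@le_trans _ _ (1 + `|S_ n|)); last by rewrite /CM; lra.
  have : M n i j ^+ 2 <= `|S_ n|.
    have diag_ge (A : 'M[R]_p) : A i j ^+ 2 <= (A^T *m A) j j.
      rewrite mxE (bigD1 i)//= mxE -expr2 lerDl sumr_ge0// => l _.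
      by rewrite mxE -expr2 sqr_ge0.
    by rewrite (le_trans (diag_ge _))// MM// (le_trans (ler_norm _))// le_mx_norm_coord.
  have -> : M n i j ^+ 2 = `|M n i j| ^+ 2 by rewrite real_normK ?num_real.
  by have := sqr_ge0 (`|M n i j| - 1); have := normr_ge0 (M n i j); rewrite !expr2; nra.
have form_le (x y : 'rV[R]_p) (A : 'M[R]_p) :
    `|(x *m A *m y^T) 0 0| <= q ^+ 2 * `|x| * `|A| * `|y|.
  rewrite (le_trans (le_mx_norm_coord _ _ _))// (le_trans (mx_norm_mul _ _))//.
  rewrite [leRHS](_ : _ = q * (q * `|x| * `|A|) * `|y|); last by ring.
  by rewrite ler_pM ?mulr_ge0 ?normr_ge0// ?mx_norm_tr// ler_wpM2l ?mx_norm_mul.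
pose zM := z *m M n; pose r := u - zM.
have zMle : `|zM| <= Cz.
  by rewrite (le_trans (mx_norm_mul _ _))// ler_pM ?mulr_ge0 ?normr_ge0// ler_wpM2l.
have rE : r = - (u *m E *m invmx (Psi_ n)).
  rewrite /r /zM /M mulmxA -uE mulmxDr mulmxDl mulmxK ?uPsi//.
  by rewrite opprD addrA subrr add0r.
have rle : `|r| <= q ^+ 2 * C * eta * `|u|.
  rewrite rE normrN (le_trans (mx_norm_mul _ _))//.
  rewrite [leRHS](_ : _ = q * (q * `|u| * eta) * C); last by ring.
  rewrite ler_pM ?mulr_ge0 ?normr_ge0 ?bPsi// ler_wpM2l//.
  by rewrite (le_trans (mx_norm_mul _ _))// ler_wpM2l ?mulr_ge0 ?normr_ge0.
have ule : `|u| <= 2 * Cz.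
  have : `|u| <= Cz + `|r|.
    by rewrite -[u](subrK zM) addrC (le_trans (ler_normD _ _))// lerD2r.
  have : A1 * eta * `|u| <= 2^-1 * `|u| by rewrite ler_wpM2r ?normr_ge0.
  by move: rle; rewrite /A1; lra.
have rle2 : `|r| <= q ^+ 2 * (2 * Cz) * C * eta.
  rewrite (le_trans rle)// [leRHS](_ : _ = q ^+ 2 * C * eta * (2 * Cz)); last by ring.
  by rewrite ler_wpM2l// !mulr_ge0 ?sqr_ge0// ltW.
have decomp : (u *m invmx Sg *m u^T) 0 0 - (z *m z^T) 0 0 =
    (zM *m (invmx Sg - invmx (S_ n)) *m zM^T) 0 0 +
    ((r *m invmx Sg *m zM^T) 0 0 + (u *m invmx Sg *m r^T) 0 0).
  have zz : z *m z^T = zM *m invmx (S_ n) *m zM^T.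
    have MGM : M n *m invmx (S_ n) *m (M n)^T = 1%:M.
      have E1 : M n *m invmx (S_ n) *m (M n)^T *m M n = M n.
        by rewrite -mulmxA MM// -mulmxA mulVmx ?uS// mulmx1.
      by rewrite -[LHS](mulmxK (uM n n0)) E1 mulmxV ?uM.
    transitivity (z *m (M n *m invmx (S_ n) *m (M n)^T) *m z^T).
      by rewrite MGM mulmx1.
    have aux (m G : 'M[R]_p) : z *m (m *m G *m m^T) *m z^T = (z *m m) *m G *m (z *m m)^T.
      by rewrite trmx_mul !mulmxA.
    exact: aux.
  have uu : u = zM + r by rewrite /r addrC subrK.
  rewrite zz mulmxBr mulmxBl -[(u *m _) *m r^T](_ : u *m invmx Sg *m (u^T - zM^T) = _).
    rewrite mulmxBr {1}/r !mulmxBl !mxE; ring.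
  by congr (_ *m _); rewrite /r !raddfB.
rewrite decomp (le_trans (ler_normD _ _))// [leRHS]splitr lerD//.
  rewrite (le_trans (form_le _ _ _))// (le_trans _ h3)//.
  rewrite distrC.
  rewrite [leRHS](_ : _ = q ^+ 2 * Cz * d * Cz); last by ring.
  rewrite ler_pM ?mulr_ge0 ?normr_ge0 ?sqr_ge0//.
  by rewrite ler_pM ?mulr_ge0 ?normr_ge0 ?sqr_ge0// ler_wpM2l ?sqr_ge0.
rewrite (le_trans (ler_normD _ _))// (le_trans _ h2)//.
rewrite (_ : A2 * eta = q ^+ 2 * (q ^+ 2 * (2 * Cz) * C * eta) * g * Cz +
    q ^+ 2 * (2 * Cz) * g * (q ^+ 2 * (2 * Cz) * C * eta)); last by rewrite /A2; ring.
rewrite lerD// (le_trans (form_le _ _ _))//.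
  rewrite ler_pM ?mulr_ge0 ?normr_ge0 ?sqr_ge0//.
  by rewrite ler_wpM2r// ler_wpM2l ?sqr_ge0.
rewrite ler_pM ?mulr_ge0 ?normr_ge0 ?sqr_ge0//.
by rewrite ler_wpM2r// ler_wpM2l ?sqr_ge0.
Unshelve. all: by end_near. Qed.

End inverse_limit.

(** * Differential calculus *)

Section directional.
Context {R : realType} {p : nat}.
Implicit Types (g h : 'rV[R]_p -> R) (t v : 'rV[R]_p).

(** Both difference quotients are the same function. This brings the one-variable chain rule and
    mean value theorem to partial derivatives. *)
Lemma is_derive_lineP g t v (d s : R) :
  is_derive s 1 (fun r : R => g (r *: v + t)) d <-> is_derive (s *: v + t) v g d.
Proof.
have E : (fun r : R => r^-1 *: ((g \o shift (s *: v + t)) (r *: v) - g (s *: v + t))) =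
    (fun r : R => r^-1 *: (((fun r : R => g (r *: v + t)) \o shift s) (r *: (1 : R)) - g (s *: v + t))).
  apply/funext => r /=; congr (_ *: (g _ - _)).
  by rewrite /GRing.scale /= mulr1 addrA -scalerDl.
split=> [[dr dv]|[dr dv]]; apply: DeriveDef; move: dr dv;
  rewrite /derivable /derive; [rewrite -E|rewrite -E|rewrite E|rewrite E];
  by [].
Qed.

Lemma is_derive_comp1 (phi : R -> R) g t v dphi dg :
  is_derive (g t) 1 phi dphi -> is_derive t v g dg ->
  is_derive t v (phi \o g) (dphi * dg).
Proof.
move=> hphi hg.
have t0 : t = 0 *: v + t by rewrite scale0r add0r.
rewrite [X in is_derive X _ _ _]t0; apply/is_derive_lineP.
apply: (@is_derive1_comp _ phi (fun r : R => g (r *: v + t)) 0 dphi dg) => /=.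
  by rewrite -t0.
by apply/is_derive_lineP; rewrite -t0.
Qed.

(** Only existence of the iterated partial derivatives on U is recorded, not their continuity. The
    recursive form, equivalent to [thrice_derivable] at order 3, is what makes closure under
    products, inverses and compositions provable by induction. *)
Fixpoint smooth_on (U : set 'rV[R]_p) (m : nat) g : Prop :=
  if m is m'.+1 then
    (forall t, U t -> forall j, derivable g t (delta_mx 0 j)) /\
    (forall j, smooth_on U m' (partial j g))
  else True.

Lemma thrice_derivableP U g : thrice_derivable U g <-> smooth_on U 3 g.
Proof.
split=> [H|H].
  split=> [t Ut j|l]; first by have [] := H t Ut j j j.
  split=> [t Ut k|k]; first by have [] := H t Ut k k l.
  by split=> // t Ut j; have [] := H t Ut j k l.
move=> t Ut j k l; case: H => H1 H2.
by split; [exact: H1|case: (H2 l) => H3 _; exact: H3|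
  case: (H2 l) => _ H3; case: (H3 k) => H4 _; exact: H4].
Qed.

Variable U : set 'rV[R]_p.
Hypothesis oU : open U.

Let nearU t : U t -> \forall s \near t, U s.
Proof. by move=> Ut; exact: open_nbhs_nbhs. Qed.

Lemma partial_congr g h : (forall t, U t -> g t = h t) ->
  forall t, U t -> forall j, partial j g t = partial j h t.
Proof.
move=> gh t Ut j; rewrite /partial; apply: near_eq_derive.
by apply: filterS (nearU Ut) => s; exact: gh.
Qed.

Lemma smooth_on_congr m g h : (forall t, U t -> g t = h t) ->
  smooth_on U m g -> smooth_on U m h.
Proof.
elim: m g h => [//|m IH] g h gh [dg pg]; split=> [t Ut j|j].
  apply: near_eq_derivable (dg t Ut j).
  by apply: filterS (nearU Ut) => s; exact: gh.
by apply: IH (pg j) => t Ut; exact: partial_congr.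
Qed.

Lemma smooth_onS m g : smooth_on U m.+1 g -> smooth_on U m g.
Proof.
elim: m g => [//|m IH] g [dg pg]; split=> // j.
by apply: IH; exact: pg.
Qed.

Lemma smooth_on_partial m g j : smooth_on U m.+1 g -> smooth_on U m (partial j g).
Proof. by move=> [_ h]; exact: h. Qed.

Lemma smooth_on_derivable m g t j : smooth_on U m.+1 g -> U t ->
  is_derive t (delta_mx 0 j) g (partial j g t).
Proof. by move=> [dg _] Ut; apply: DeriveDef => //; exact: dg. Qed.

(** The gradient is given by formulas valid on U only; since U is open, a formula may be
    differentiated again in place of the derivative itself. *)
Lemma smooth_on_step m g (dg : 'I_p -> 'rV[R]_p -> R) :
  (forall t, U t -> forall j, is_derive t (delta_mx 0 j) g (dg j t)) ->
  (forall j, smooth_on U m (dg j)) -> smooth_on U m.+1 g.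
Proof.
move=> H1 H2; split=> [t Ut j|j]; first by have [] := H1 t Ut j.
apply: smooth_on_congr (H2 j) => t Ut; rewrite /partial.
by have [_ ->] := H1 t Ut j.
Qed.

Lemma smooth_on_cst m c : smooth_on U m (fun=> c).
Proof.
elim: m c => [//|m IH] c; by apply: (@smooth_on_step _ _ (fun _ _ => 0)).
Qed.

Lemma smooth_onD m g h : smooth_on U m g -> smooth_on U m h ->
  smooth_on U m (fun t => g t + h t).
Proof.
elim: m g h => [//|m IH] g h sg sh.
apply: (@smooth_on_step _ _ (fun j t => partial j g t + partial j h t)).
  move=> t Ut j; have dg := smooth_on_derivable j sg Ut.
  have dh := smooth_on_derivable j sh Ut; exact: is_deriveD.
by move=> j; apply: IH; exact: smooth_on_partial.
Qed.

Lemma smooth_onM m g h : smooth_on U m g -> smooth_on U m h ->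
  smooth_on U m (fun t => g t * h t).
Proof.
elim: m g h => [//|m IH] g h sg sh.
apply: (@smooth_on_step _ _ (fun j t => g t * partial j h t + h t * partial j g t)).
  move=> t Ut j; have dg := smooth_on_derivable j sg Ut.
  have dh := smooth_on_derivable j sh Ut; exact: is_deriveM.
by move=> j; apply: smooth_onD; apply: IH; do ?[exact: smooth_onS|exact: smooth_on_partial].
Qed.

Lemma smooth_onZ m c g : smooth_on U m g -> smooth_on U m (fun t => c * g t).
Proof. by move=> sg; apply: smooth_onM => //; exact: smooth_on_cst. Qed.

Lemma smooth_on_expR m g : smooth_on U m g -> smooth_on U m (fun t => expR (g t)).
Proof.
elim: m g => [//|m IH] g sg.
apply: (@smooth_on_step _ _ (fun j t => expR (g t) * partial j g t)).
  move=> t Ut j; have dg := smooth_on_derivable j sg Ut.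
  exact: is_derive_comp1.
by move=> j; apply: smooth_onM; [apply: IH; exact: smooth_onS|exact: smooth_on_partial].
Qed.

Lemma smooth_onV m g : (forall t, U t -> 0 < g t) -> smooth_on U m g ->
  smooth_on U m (fun t => (g t)^-1).
Proof.
move=> g0; elim: m => [//|m IH] sg.
apply: (@smooth_on_step _ _ (fun j t => - 1 * ((g t)^-1 * (g t)^-1) * partial j g t)).
  move=> t Ut j; have dg := smooth_on_derivable j sg Ut.
  have gn : g t != 0 by rewrite gt_eqF// g0.
  have dV : is_derive (g t) 1 (fun x : R => x^-1) (- (g t) ^- 2 *: 1).
    by apply: is_deriveV.
  apply: is_derive_eq (is_derive_comp1 dV dg) _.
  by rewrite /GRing.scale /=; field.
move=> j; apply: smooth_onM; last exact: smooth_on_partial.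
by apply: smooth_onZ; apply: smooth_onM; apply: IH; exact: smooth_onS.
Qed.

Lemma smooth_on_ln m g : (forall t, U t -> 0 < g t) -> smooth_on U m g ->
  smooth_on U m (fun t => ln (g t)).
Proof.
move=> g0; case: m => [//|m] sg.
apply: (@smooth_on_step _ _ (fun j t => (g t)^-1 * partial j g t)).
  move=> t Ut j; have dg := smooth_on_derivable j sg Ut.
  by apply: is_derive_comp1; apply: is_derive1_ln; exact: g0.
move=> j; apply: smooth_onM; last exact: smooth_on_partial.
by apply: smooth_onV => //; exact: smooth_onS.
Qed.

Lemma smooth_on_powR m g a : (forall t, U t -> 0 < g t) -> smooth_on U m g ->
  smooth_on U m (fun t => g t `^ a).
Proof.
move=> g0 sg; apply: (@smooth_on_congr _ (fun t => expR (a * ln (g t)))).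
  by move=> t Ut; rewrite /powR gt_eqF// g0.
by apply: smooth_on_expR; apply: smooth_onZ; exact: smooth_on_ln.
Qed.

Lemma is_derive_powR g a t j dg : 0 < g t -> is_derive t (delta_mx 0 j) g dg ->
  is_derive t (delta_mx 0 j) (fun s => g s `^ a) (a * g t `^ (a - 1) * dg).
Proof.
move=> g0 h; apply: (@is_derive_comp1 (fun x => x `^ a)) h.
have := powR_derive1 a; move=> /(_ (g t)).
rewrite in_itv/= andbT => /(_ g0) E.
apply: DeriveDef; first by apply: derivable_powR; rewrite in_itv/= andbT.
by rewrite -derive1E E.
Qed.

End directional.

(** * Expansion along coordinate paths *)

Section coordinate_path.
Context {R : realType} {p : nat}.
Implicit Types (F G : 'rV[R]_p -> R) (a b t : 'rV[R]_p).

Lemma mvt_unordered (h dh : R -> R) (d : R) :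
  (forall s : R, `|s| <= `|d| -> is_derive s 1 h (dh s)) ->
  exists2 c, `|c| <= `|d| & h d - h 0 = dh c * d.
Proof.
move=> H.
have cont x y : (forall s, x <= s <= y -> `|s| <= `|d|) -> {within `[x, y], continuous h}.
  move=> xy; apply: derivable_within_continuous => s; rewrite in_itv/= => sxy.
  by have [] := H s (xy s sxy).
have [d0|d0] := leP 0 d.
  have sub s : 0 <= s <= d -> `|s| <= `|d|.
    by move=> /andP[s0 sd]; rewrite !ger0_norm.
  have [||c cd E] := @MVT_segment _ h dh 0 d d0.
  - move=> s; rewrite in_itv/= => /andP[s0 sd]; apply: H; apply: sub.
    by rewrite !ltW.
  - exact: cont.
  by exists c; [apply: sub; move: cd; rewrite in_itv|rewrite E subr0].
have sub s : d <= s <= 0 -> `|s| <= `|d|.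
  by move=> /andP[s0 sd]; rewrite !ler0_norm ?lerN2// ltW.
have [||c cd E] := @MVT_segment _ h dh d 0 (ltW d0).
- move=> s; rewrite in_itv/= => /andP[s0 sd]; apply: H; apply: sub.
  by rewrite !ltW.
- exact: cont.
exists c; first by apply: sub; move: cd; rewrite in_itv.
by rewrite -opprB E sub0r mulrN opprK.
Qed.

Variables (a : 'rV[R]_p) (rho : R).
Let W : set 'rV[R]_p := [set t | forall j, `|t 0 j - a 0 j| < rho].

(** Existence of partial derivatives alone gives no mean value theorem along the segment from a to
    b. The path therefore changes one coordinate at a time, with a one-variable mean value theorem
    on each leg. The intermediate points depend on k but remain in the box, which is why W is a
    box. *)
Lemma coordinate_path_mvt F (dF : 'I_p -> 'rV[R]_p -> R) b : W b ->
  (forall t, W t -> forall k, is_derive t (delta_mx 0 k) F (dF k t)) ->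
  exists xi : 'I_p -> 'rV[R]_p,
    (forall k j, `|xi k 0 j - a 0 j| <= `|b 0 j - a 0 j|) /\
    F b - F a = \sum_k dF k (xi k) * (b 0 k - a 0 k).
Proof.
move=> Wb hF.
pose c (k : nat) : 'rV[R]_p := \row_j (if (j < k)%N then b 0 j else a 0 j).
have c0 : c 0%N = a by apply/rowP => j; rewrite mxE.
have cp : c p = b by apply/rowP => j; rewrite mxE ltn_ord.
have cS (k : 'I_p) : c k.+1 = (b 0 k - a 0 k) *: delta_mx 0 k + c k.
  apply/rowP => j; rewrite !mxE eqxx/= ltnS leq_eqVlt eq_sym.
  have [<-|kj] := eqVneq k j; first by rewrite !eqxx ltnn mulr1 subrK.
  rewrite mulr0 add0r.
  by case: eqP => [/val_inj kj'|//]; move: kj; rewrite kj' eqxx.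
have step (k : 'I_p) : exists x : 'rV[R]_p,
    (forall j, `|x 0 j - a 0 j| <= `|b 0 j - a 0 j|) /\
    F (c k.+1) - F (c k) = dF k x * (b 0 k - a 0 k).
  pose d := b 0 k - a 0 k.
  have inW s : `|s| <= `|d| ->
      forall j, `|(s *: delta_mx 0 k + c k) 0 j - a 0 j| <= `|b 0 j - a 0 j|.
    move=> sd j; rewrite !mxE eqxx/=.
    have [->|jk] := eqVneq j k; first by rewrite ltnn mulr1 addrK.
    rewrite mulr0 add0r; case: ifP => // _.
    by rewrite subrr normr0.
  have [s sd E] := @mvt_unordered (fun s => F (s *: delta_mx 0 k + c k))
    (fun s => dF k (s *: delta_mx 0 k + c k)) d (fun s sd =>
      (is_derive_lineP _ _ _ _ _).2 (hF _ (fun j => le_lt_trans (inW s sd j) (Wb j)) k)).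
  exists (s *: delta_mx 0 k + c k); split; first exact: inW.
  by rewrite cS -E scale0r add0r.
exists (fun k => sval (cid (step k))); split.
  by move=> k j; case: cid => x /= [].
rewrite -{1}cp -[X in _ - F X]c0 -(telescope_sumr (fun k => F (c k)) (leq0n p)) big_mkord.
by apply: eq_bigr => k _; case: cid => x /= [].
Qed.

(** The derivatives at the intermediate points are compared with those at a by a second use of the
    mean value theorem. The error is left inside the coefficients of the increment, so that it can
    be read as a perturbation of the Hessian. *)
Lemma taylor1_coordinate G (dG : 'I_p -> 'rV[R]_p -> R)
    (ddG : 'I_p -> 'I_p -> 'rV[R]_p -> R) (M : 'I_p -> 'I_p -> R) b : W b ->
  (forall t, W t -> forall k, is_derive t (delta_mx 0 k) G (dG k t)) ->
  (forall t, W t -> forall k j, is_derive t (delta_mx 0 j) (dG k) (ddG j k t)) ->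
  (forall t, W t -> forall j k, `|ddG j k t| <= M j k) ->
  exists r : 'I_p -> R,
    (forall k, `|r k| <= (\sum_j M j k) * `|b - a|) /\
    G b - G a = \sum_k (dG k a + r k) * (b 0 k - a 0 k).
Proof.
move=> Wb h1 h2 h3.
have [xi [xib E]] := coordinate_path_mvt Wb h1.
have Wxi k : W (xi k) by move=> j; exact: le_lt_trans (xib k j) (Wb j).
exists (fun k => dG k (xi k) - dG k a); split=> [k|]; last first.
  by rewrite E; apply: eq_bigr => k _; rewrite [dG k a + _]addrC subrK.
have [eta [etab ->]] := coordinate_path_mvt (Wxi k) (fun t Wt j => h2 t Wt k j).
rewrite (le_trans (ler_norm_sum _ _ _))// mulr_suml ler_sum// => j _.
rewrite normrM ler_pM//.
  by apply: h3 => i; exact: le_lt_trans (etab j i) (Wxi k i).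
rewrite (le_trans (xib k j))//.
have -> : b 0 j - a 0 j = (b - a) 0 j by rewrite !mxE.
rewrite /Num.norm/= mx_normrE; exact: (le_bigmax _ _ (ord0, j)).
Qed.

End coordinate_path.

(* The library sets +oo - +oo = -oo, so a finite value of the integral bounds
   both the positive and the negative part. *)
Lemma fin_num_integrable {d} {T : measurableType d} {R : realType}
    (mu : {measure set T -> \bar R}) (g : T -> R) :
  measurable_fun [set: T] g -> (\int[mu]_x (g x)%:E)%E \is a fin_num ->
  mu.-integrable [set: T] (EFin \o g).
Proof.
move=> mg; rewrite integralE fin_numB => /andP[fp fn].
have mgE : measurable_fun [set: T] (EFin \o g) by exact/measurable_EFinP.
apply/integrableP; split=> //.
rewrite (_ : (fun x => `|(EFin \o g) x|%E) = ((EFin \o g)^\+ \+ (EFin \o g)^\-)%E); last first.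
  exact: fune_abse.
rewrite ge0_integralD//.
- by rewrite lte_add_pinfty// -ge0_fin_numE// integral_ge0.
- exact: measurable_funepos.
- exact: measurable_funeneg.
Qed.

(** * Integrands that may fail to be measurable *)

Section nonmeasurable_integrand.
Context {d} {S : measurableType d} {R : realType} (mu : {measure set S -> \bar R}).
Local Open Scope ereal_scope.
Import HBNNSimple.

(** A simple function below F1, multiplied by the indicator of the complement of N, lies below F2
    everywhere and keeps its integral. *)
Let ge0_le_integral_off_null (N : set S) (F1 F2 : S -> \bar R) :
  measurable N -> mu N = 0 -> (forall y, 0 <= F1 y) -> (forall y, 0 <= F2 y) ->
  (forall y, ~ N y -> F1 y = F2 y) -> \int[mu]_y F1 y <= \int[mu]_y F2 y.
Proof.
move=> mN N0 F10 F20 F12; rewrite !ge0_integralTE//.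
apply: ge_ereal_sup => _ [h /= hF1 <-].
apply: (@le_trans _ _ (sintegral mu (proj_nnsfun h (measurableC mN)))); last first.
  apply: ereal_sup_ubound; exists (proj_nnsfun h (measurableC mN)) => //= y.
  rewrite /= /mindic indicE.
  have [Ny|Ny] := boolP (y \in ~` N).
    by rewrite mulr1 -F12 ?hF1//; move: Ny; rewrite inE.
  by rewrite mulr0.
rewrite -!integralT_nnsfun.
rewrite (ge0_ae_eq_integral (g := fun y => (proj_nnsfun h (measurableC mN) y)%:E))//.
- exact/measurable_EFinP.
- exact/measurable_EFinP.
- by move=> y _; rewrite lee_fin.
- by move=> y _; rewrite lee_fin.
exists N; split => // y /=; apply: contra_notP => Ny _.
by rewrite /mindic indicE mem_set// mulr1.
Qed.

(* The integral of a nonmeasurable function is a difference of suprema over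
   simple functions, so no completeness of mu is needed. *)
Lemma integral_eq_off_null (N : set S) (F1 F2 : S -> \bar R) :
  measurable N -> mu N = 0 ->
  (forall y, ~ N y -> F1 y = F2 y) -> \int[mu]_y F1 y = \int[mu]_y F2 y.
Proof.
move=> mN N0 F12; rewrite integralE [RHS]integralE; congr (_ - _); apply/eqP; rewrite eq_le;
  apply/andP; split; apply: (ge0_le_integral_off_null mN N0) => // y Ny;
  by rewrite ?funeposE ?funenegE F12.
Qed.

End nonmeasurable_integrand.

Section measurable_partial.
Context {d} {S : measurableType d} {R : realType} {p : nat}.
Local Open Scope ring_scope.

(** On G the derivative is the limit of difference quotients with steps 1/(n+1). The sequence starts
    at an index m beyond which the displaced points lie in U, where measurability of phi is known;
    off G both sides are zero. *)
Lemma measurable_partial (U : set 'rV[R]_p) (G : set S) (phi : S -> 'rV[R]_p -> R)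
    (j : 'I_p) (t : 'rV[R]_p) :
  open U -> U t -> measurable G ->
  (forall s, U s -> measurable_fun [set: S] (fun y => phi y s * \1_G y)) ->
  (forall y, G y -> derivable (phi y) t (delta_mx 0 j)) ->
  measurable_fun [set: S] (fun y => partial j (phi y) t * \1_G y).
Proof.
move=> oU Ut mG mphi dphi.
pose h (n : nat) : R := n.+1%:R^-1.
have h0 n : h n != 0 by rewrite invr_neq0.
have ch : h n @[n --> \oo] --> (0 : R) by exact: cvg_harmonic.
pose tn n := h n *: delta_mx 0 j + t.
have ctn : tn n @[n --> \oo] --> t.
  rewrite -[X in _ --> X]add0r -(scale0r (delta_mx 0 j)).
  by apply: cvgD; [apply: cvgZr_tmp|exact: cvg_cst].
have [m _ Hm] : \forall n \near \oo, U (tn n).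
  by apply: ctn; exact: open_nbhs_nbhs.
pose q (n : nat) y := (h (n + m)%N)^-1 * (phi y (tn (n + m)%N) * \1_G y - phi y t * \1_G y).
apply: (@measurable_fun_cvg _ _ _ _ q) => //.
  move=> n; apply: measurable_funM => //; apply: measurable_funB.
    by apply: mphi; apply: Hm => /=; rewrite leq_addl.
  exact: mphi.
move=> y _; have [Gy|Gy] := boolP (y \in G); last first.
  rewrite (_ : q ^~ y = (fun=> 0)); last first.
    by apply/funext => n; rewrite /q indicE (negbTE Gy) !mulr0 subrr mulr0.
  by rewrite indicE (negbTE Gy) mulr0; exact: cvg_cst.
rewrite indicE Gy mulr1.
have dy := dphi y (set_mem Gy).
have : (fun r : R => r^-1 *: ((phi y \o shift t) (r *: delta_mx 0 j) - phi y t)) r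
   @[r --> 0^'] --> partial j (phi y) t by exact: dy.
move=> /cvgr_dnbhsP /(_ (fun n => h (n + m)%N)) H.
have := H (conj (fun n => h0 _) _).
rewrite cvg_shiftn => /(_ ch); apply: cvg_trans.
apply: near_eq_cvg; apply: nearW => n /=.
by rewrite /q indicE Gy !mulr1.
Qed.

End measurable_partial.

(** * Vector central limit theorem *)

Lemma measurable_norm2 d (T : measurableType d) (R : realType) p (F : T -> 'rV[R]_p) :
  (forall k, measurable_fun [set: T] (fun w => F w 0 k)) ->
  measurable_fun [set: T] (fun w => norm2 (F w)).
Proof.
move=> mF; rewrite (_ : (fun w => _) = (fun w => (\sum_j F w 0 j ^+ 2) `^ 2^-1)).
  apply: (measurableT_comp (measurable_powR _)).
  by apply: measurable_sum => k; exact: measurable_funX.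
by apply/funext => w; rewrite powR12_sqrt// sumr_ge0// => j _; exact: sqr_ge0.
Qed.

Section vector_clt.
Context {d d'} {T : measurableType d} {S : measurableType d'} {R : realType} {p : nat}.
Variables (P : probability T R) (Y : nat -> {RV P >-> S}).
Hypothesis hindep : mutually_independent P Y.
Variables (psi : nat -> 'I_p -> S -> R) (Om B : nat -> 'M[R]_p).
Hypothesis mpsi : forall i j, measurable_fun [set: S] (psi i j).
Hypothesis psi1 : forall i j, intble P (psi i j \o Y i).
Hypothesis psi0 : forall i j, \int[P]_w psi i j (Y i w) = 0.
Hypothesis psi2 : forall i j, intble P (fun w => psi i j (Y i w) ^+ 2).
Hypothesis OmE : forall n, (0 < n)%N -> Om n =
  n%:R^-1 *: \sum_(i < n) \matrix_(j, k) \int[P]_w (psi i j (Y i w) * psi i k (Y i w)).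
Hypothesis BOm : forall n, (0 < n)%N -> B n *m Om n *m (B n)^T = 1%:M.

Definition standardized i n y : 'rV[R]_p := (\row_j psi i j y) *m (B n)^T.
Local Notation xi := standardized.

Hypothesis lind : forall eps, 0 < eps ->
  n%:R^-1 * \sum_(i < n) \int[P]_w (norm2 (xi i n (Y i w)) ^+ 2 *
    \1_[set y | eps * Num.sqrt n%:R < norm2 (xi i n y)] (Y i w)) @[n --> \oo] --> 0.

Definition standardized_sum n w : 'rV[R]_p :=
  (Num.sqrt n%:R)^-1 *: \sum_(i < n) xi i n (Y i w).
Local Notation Z := standardized_sum.

Let mY k : measurable_fun [set: T] (Y k).
Proof. exact: measurable_funPT. Qed.

Lemma standardizedE i n y k : xi i n y 0 k = \sum_j B n k j * psi i j y.
Proof. by rewrite mxE; apply: eq_bigr => j _; rewrite !mxE mulrC. Qed.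

Lemma measurable_standardized i n k : measurable_fun [set: S] (fun y => xi i n y 0 k).
Proof.
rewrite (_ : (fun y => _) = (fun y => \sum_j B n k j * psi i j y)); last first.
  by apply/funext => y; rewrite standardizedE.
by apply: measurable_sum => j; apply: measurable_funM.
Qed.

Lemma standardized_sumE n w k :
  Z n w 0 k = (Num.sqrt n%:R)^-1 * \sum_(i < n) xi i n (Y i w) 0 k.
Proof. by rewrite mxE summxE. Qed.

Lemma measurable_standardized_sum n k : measurable_fun [set: T] (fun w => Z n w 0 k).
Proof.
rewrite (_ : (fun w => _) =
  (fun w => (Num.sqrt n%:R)^-1 * \sum_(i < n) xi i n (Y i w) 0 k)); last first.
  by apply/funext => w; rewrite standardized_sumE.
apply: measurable_funM => //; apply: measurable_sum => i.
exact: (measurableT_comp (measurable_standardized i n k)).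
Qed.

Let psi12 i j k : intble P (fun w => psi i j (Y i w) * psi i k (Y i w)).
Proof.
apply: (le_intble _ _ (intbleD (psi2 i j) (psi2 i k))).
  by apply: measurable_funM; exact: (measurableT_comp (mpsi _ _)).
move=> w; rewrite normrM -(real_normK (num_real (psi i j _))) -(real_normK (num_real (psi i k _))).
have := normr_ge0 (psi i j (Y i w)); have := normr_ge0 (psi i k (Y i w)).
by move: `|_| `|_| => a b a0 b0; nra.
Qed.

Section linear_combination.
Variable t : nat -> R.

Let c n : 'rV[R]_p := (\row_(k < p) t k) *m B n.
Let x n i y : R := (Num.sqrt n%:R)^-1 * \sum_j c n 0 j * psi i j y.

Let xE n i y : x n i y = (Num.sqrt n%:R)^-1 * \sum_(k < p) t k * xi i n y 0 k.
Proof.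
congr (_ * _); under [RHS]eq_bigr do rewrite standardizedE mulr_sumr.
rewrite exchange_big; apply: eq_bigr => j _.
by rewrite mxE mulr_suml; apply: eq_bigr => k _; rewrite mxE mulrA.
Qed.

Let mx n i : measurable_fun [set: S] (x n i).
Proof.
by apply: measurable_funM => //; apply: measurable_sum => j; exact: measurable_funM.
Qed.

Let x2E n i y : x n i y ^+ 2 =
  n%:R^-1 * \sum_j \sum_k c n 0 j * c n 0 k * (psi i j y * psi i k y).
Proof.
rewrite exprMn exprVn sqr_sqrtr//; congr (_ * _).
rewrite expr2 mulr_suml; apply: eq_bigr => j _; rewrite mulr_sumr.
by apply: eq_bigr => k _; ring.
Qed.

Let x2I n i : intble P (fun w => x n i (Y i w) ^+ 2).
Proof.
under eq_fun do rewrite x2E.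
apply: intbleZ; apply: intble_sum => j; apply: intble_sum => k.
exact: (intbleZ _ (psi12 i j k)).
Qed.

(** The sum is t B_n Omega_n B_n^T t^T, equal to |t|^2 for every positive n and not only in the
    limit; this is the exact variance condition of [lindeberg_cos]. *)
Let x2_sum n : (0 < n)%N ->
  \sum_(i < n) \int[P]_w (x n i (Y i w) ^+ 2) = \sum_(j < p) t j ^+ 2.
Proof.
move=> n0; pose tr : 'rV[R]_p := \row_(k < p) t k.
transitivity ((c n *m Om n *m (c n)^T) 0 0); last first.
  rewrite trmx_mul -!mulmxA (mulmxA (B n)) (mulmxA (B n *m _)) BOm// mul1mx.
  by rewrite mulmx_trE; apply: eq_bigr => j _; rewrite mxE -expr2.
rewrite OmE// -scalemxAr -scalemxAl mxE mulmx_sumr mulmx_suml summxE mulr_sumr.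
apply: eq_bigr => i _; under eq_Rintegral do rewrite x2E.
have iJ j : intble P (fun w => \sum_k c n 0 j * c n 0 k * (psi i j (Y i w) * psi i k (Y i w))).
  by apply: intble_sum => k; exact: (intbleZ _ (psi12 i j k)).
rewrite ExZ; last exact: intble_sum.
congr (_ * _); rewrite Ex_sum// mxE.
under [RHS]eq_bigr => k _ do rewrite mxE mulr_suml.
rewrite exchange_big; apply: eq_bigr => j _.
rewrite Ex_sum; last by move=> k; exact: (intbleZ _ (psi12 i j k)).
by apply: eq_bigr => k _; rewrite ExZ// !mxE mulrAC.
Qed.

Let x0 n i : \int[P]_w x n i (Y i w) = 0.
Proof.
rewrite ExZ; last by apply: intble_sum => j; exact: (intbleZ _ (psi1 i j)).
rewrite Ex_sum; last by move=> j; exact: (intbleZ _ (psi1 i j)).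
rewrite big1 ?mulr0// => j _; rewrite ExZ ?psi0 ?mulr0//; exact: psi1.
Qed.

(** The added 1 keeps L positive when t = 0. *)
Let L := 1 + \sum_(k < p) `|t k|.
Let L0 : 0 < L.
Proof. by rewrite ltr_wpDr// sumr_ge0. Qed.

Let xL n i y : (0 < n)%N -> `|x n i y| * Num.sqrt n%:R <= L * norm2 (xi i n y).
Proof.
move=> n0; have sn0 : 0 < Num.sqrt n%:R :> R by rewrite sqrtr_gt0 ltr0n.
rewrite xE normrM gtr0_norm ?invr_gt0// mulrAC mulVf ?gt_eqF// mul1r.
rewrite (le_trans (ler_norm_sum _ _ _))// mulrDl mul1r mulr_suml.
rewrite ler_wpDl ?norm2_ge0// ler_sum// => k _.
by rewrite normrM ler_wpM2l// coord_le_norm2.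
Qed.

(** Since |x| sqrt(n) <= L |xi|, the event |x| > e forces |xi| > (e/L) sqrt(n). The vector Lindeberg
    condition at level e/L, multiplied by L^2, therefore dominates. *)
Let x_lind e : 0 < e -> \sum_(i < n) \int[P]_w (x n i (Y i w) ^+ 2 *
      \1_[set w | e < `|x n i (Y i w)|] w) @[n --> \oo] --> 0.
Proof.
move=> e0; have eL : 0 < e / L by exact: divr_gt0.
pose g n i y := norm2 (xi i n y) ^+ 2 *
  \1_[set z | e / L * Num.sqrt n%:R < norm2 (xi i n z)] y : R.
have mn n i : measurable_fun [set: S] (fun y => norm2 (xi i n y)).
  by apply: measurable_norm2 => k; exact: measurable_standardized.
have n2E n i y : norm2 (xi i n y) ^+ 2 =
    \sum_k \sum_j \sum_l B n k j * B n k l * (psi i j y * psi i l y).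
  rewrite sqr_norm2; apply: eq_bigr => k _; rewrite standardizedE.
  rewrite expr2 mulr_suml; apply: eq_bigr => j _; rewrite mulr_sumr.
  by apply: eq_bigr => l _; ring.
have n2I n i : intble P (fun w => norm2 (xi i n (Y i w)) ^+ 2).
  under eq_fun do rewrite n2E.
  apply: intble_sum => k; apply: intble_sum => j; apply: intble_sum => l.
  exact: (intbleZ _ (psi12 i j l)).
have gI n i : intble P (fun w => g n i (Y i w)).
  apply: (le_intble _ _ (n2I n i)).
    apply: (measurableT_comp (f := g n i)) => //.
    apply: measurable_funM; first exact: measurable_funX.
    by apply: measurable_indic; exact: measurable_set_lt.
  move=> w; rewrite normrM ger0_norm ?sqr_ge0// ler_piMr ?sqr_ge0// indicE.
  by case: (_ \in _); rewrite ?normr1 ?normr0.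
apply: (@squeeze_cvgr _ _ _ _ (fun=> 0)
  (fun n => L ^+ 2 * (n%:R^-1 * \sum_(i < n) \int[P]_w g n i (Y i w)))); last 2 first.
- exact: cvg_cst.
- rewrite -[X in _ --> X](mulr0 (L ^+ 2)); apply: cvgM; first exact: cvg_cst.
  exact: lind.
near=> n; have n0 : (0 < n)%N by near: n; exact: nbhs_infty_gt.
apply/andP; split.
  by apply: sumr_ge0 => i _; apply: Ex_ge0 => w; rewrite mulr_ge0 ?sqr_ge0// indicE.
rewrite mulrA mulr_sumr ler_sum// => i _; rewrite -ExZ//.
apply: le_Ex; last first.
- move=> w; set y := Y i w; rewrite [X in _ * X]indicE.
  have rhs0 : 0 <= L ^+ 2 / n%:R * g n i y.
    by rewrite mulr_ge0 ?divr_ge0 ?sqr_ge0// mulr_ge0 ?sqr_ge0// indicE.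
  have [/set_mem/= ex|_] := boolP (_ \in _); last by rewrite mulr0.
  have sn0 : 0 < Num.sqrt n%:R :> R by rewrite sqrtr_gt0 ltr0n.
  rewrite mulr1 /g indicE mem_set ?mulr1; last first.
    rewrite /= mulrAC ltr_pdivrMr// mulrC.
    by rewrite [ltRHS]mulrC (lt_le_trans _ (xL i y n0))// mulrC ltr_pM2r.
  rewrite -mulrA [_^-1 * _]mulrC mulrA -exprMn ler_pdivlMr ?ltr0n//.
  rewrite -[X in _ * X](@sqr_sqrtr _ n%:R)// -exprMn -real_normK ?num_real//.
  rewrite normrM (gtr0_norm sn0); apply: lerXn2r; rewrite ?nnegrE ?mulr_ge0 ?norm2_ge0 ?(ltW L0) ?(ltW sn0)//.
  exact: xL.
- exact: intbleZ.
- apply: (le_intble _ _ (x2I n i)).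
    apply: measurable_funM; first by apply: measurable_funX; exact: (measurableT_comp (mx n i)).
    apply: measurable_indic; apply: measurable_set_lt => //.
    by apply: measurableT_comp => //; exact: (measurableT_comp (mx n i)).
  move=> w; rewrite normrM ger0_norm ?sqr_ge0// ler_piMr ?sqr_ge0// indicE.
  by case: (_ \in _); rewrite ?normr1 ?normr0.
Unshelve. all: by end_near. Qed.

Lemma vector_clt_cos :
  \int[P]_w cos (\sum_(k < p) t k * Z n w 0 k) @[n --> \oo] -->
    expR (- (\sum_(j < p) t j ^+ 2 / 2)).
Proof.
have := lindeberg_cos hindep mx (fun n i _ => x2I n i) (fun n i _ => x0 n i) x2_sum x_lind.
rewrite mulr_suml; apply: cvg_ext => n; apply: eq_Rintegral => w _; congr cos.
under eq_bigr do rewrite xE.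
rewrite -mulr_sumr exchange_big/= mulr_sumr; apply: eq_bigr => k _.
by rewrite standardized_sumE mulrCA; congr (_ * _); rewrite mulr_sumr.
Qed.

End linear_combination.

Local Notation chi := (@chi_square R p).

Lemma vector_clt_laplace (l : R) : 0 <= l ->
  \int[P]_w expR (- (l * norm2 (Z n w) ^+ 2)) @[n --> \oo] -->
  \int[chi]_s expR (- (l * s)).
Proof.
move=> l0; pose r := Num.sqrt (2 * l).
have r2 : r ^+ 2 = 2 * l by rewrite sqr_sqrtr// mulr_ge0.
have lE (s : R) : l * s = r ^+ 2 * s / 2 by rewrite r2; field.
(* [laplace_of_charfun] indexes coordinates by natural numbers, so the coordinates are extended by
   zero beyond p. *)
pose z n j w : R := if insub j is Some k then Z n w 0 k else 0.
have zE n (k : 'I_p) w : z n k w = Z n w 0 k by rewrite /z valK.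
have mz n j : measurable_fun [set: T] (z n j).
  rewrite /z; case: insub => [k|]; last exact: measurable_cst.
  exact: measurable_standardized_sum.
have := @laplace_of_charfun _ T R P z r mz p (fun _ _ => 0) 0.
move=> /(_ (fun=> measurable_cst _)) H.
have H' : \int[P]_w (expR (- \sum_(j < p) (r * z n j w) ^+ 2 / 2) * cos 0) @[n --> \oo] -->
    gauss_laplace r ^+ p * expR (- (0 / 2)).
  apply: H => t; rewrite add0r mulr_suml.
  apply: cvg_ext (@vector_clt_cos t) => n.
  apply: eq_Rintegral => w _; rewrite add0r; congr cos.
  by apply: eq_bigr => k _; rewrite zE.
rewrite (_ : \int[chi]_s _ = gauss_laplace r ^+ p * expR (- (0 / 2))); last first.
  rewrite mul0r oppr0 expR0 mulr1 /Rintegral.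
  under eq_integral do rewrite lE.
  by rewrite laplace_chi_square.
apply: cvg_ext H' => n; apply: eq_Rintegral => w _.
rewrite cos0 mulr1 lE sqr_norm2 mulr_sumr mulr_suml; congr (expR (- _)).
by apply: eq_bigr => k _; rewrite zE exprMn.
Qed.

Let X n w := norm2 (Z n w) ^+ 2.

Lemma measurable_sqr_standardized_sum n : measurable_fun [set: T] (X n).
Proof.
apply: measurable_funX; apply: measurable_norm2 => k.
exact: measurable_standardized_sum.
Qed.

Lemma vector_clt_cdf (x y eta : R) : 0 < x -> x < y -> 0 < eta ->
  (\forall n \near \oo, fine (P [set w | norm2 (Z n w) ^+ 2 <= x]) <=
     fine (chi `]-oo, y]%classic) + eta) /\
  (\forall n \near \oo, fine (chi `]-oo, x]%classic) <=
     fine (P [set w | norm2 (Z n w) ^+ 2 <= y]) + eta).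
Proof.
apply: (@laplace_cdf _ _ _ P X chi).
- exact: measurable_sqr_standardized_sum.
- by move=> n w; exact: sqr_ge0.
- exact: chi_square_lt0.
- move=> l l0; pose r := Num.sqrt (2 * l).
  have lE (s : R) : l * s = r ^+ 2 * s / 2.
    by rewrite /r sqr_sqrtr ?mulr_ge0//; field.
  apply: fin_num_integrable.
    apply: measurable_expR; apply: measurable_funN; exact: measurable_funM.
  by under eq_integral do rewrite lE; rewrite laplace_chi_square.
- exact: vector_clt_laplace.
Qed.

Lemma standardized_sum_tight (delta : R) : 0 < delta ->
  exists2 K : R, 0 <= K & \forall n \near \oo, exists C : set T,
    [/\ measurable C, fine (P C) <= delta & ~` [set w | `|Z n w| <= K] `<=` C].
Proof.
move=> d0; have d2 : 0 < delta / 2 by exact: divr_gt0.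
have [x x0 hx] : exists2 x : R, 0 < x & 1 - delta / 2 <= fine (chi `]-oo, x]%classic).
  have : chi `]-oo, n%:R]%classic @[n --> \oo] --> 1%E.
    rewrite -(@probability_setT _ _ _ chi).
    have -> : [set: measurableTypeR R] = \bigcup_n `]-oo, (n%:R : R)]%classic.
      apply/seteqP; split=> // s _; exists (Num.bound `|s : R|) => //=.
      rewrite in_itv/= (le_trans (ler_norm (s : R)))// ltW//.
      exact: archi_boundP.
    apply: nondecreasing_cvg_mu => //.
      by apply: bigcup_measurable.
    move=> m n mn; apply/subsetPset => s; rewrite /= !in_itv/= => /le_trans; apply.
    by rewrite ler_nat.
  move=> /fine_cvg /cvgrPdist_le /(_ _ d2) [n _ Hn].
  exists n.+1%:R; first by rewrite ltr0n.
  by have /ler_normlP[_ +] := Hn n.+1 (leqnSn n); rewrite /= ; lra.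
(* By a <= 1 + a^2, the bound |Z_n|^2 <= x + 1 implies |Z_n| <= 1 + (x + 1). *)
exists (1 + (x + 1)); first by lra.
have xx1 : x < x + 1 by rewrite ltrDl.
have [_ H] := vector_clt_cdf x0 xx1 d2.
apply: filterS H => n H.
have mX := measurable_sqr_standardized_sum n.
have mA : measurable [set w | X n w <= x + 1] by exact: measurable_set_le.
exists (~` [set w | X n w <= x + 1]); split.
- exact: measurableC.
- rewrite probability_setC// fineB ?fin_num_measure//=.
  by move: H hx; rewrite /X; lra.
- apply: subsetC => w /= Xw; rewrite (le_trans (mx_norm_le_norm2 _))//.
  have := norm2_ge0 (Z n w); move: Xw; rewrite /X; nra.
Qed.

End vector_clt.

(** * The statistical model *)

Section ereal_averages.
Context {R : realType}.

(** [C6_uniform_integrability] and [C7_lindeberg] speak of averages in the extended reals. A finite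
    bound on an average of nonnegative terms makes every term finite, which is where the
    integrability of the individual derivatives comes from. *)
Lemma average_le_fin (t : nat -> \bar R) (n : nat) (eta : R) :
  (forall i, 0%E <= t i)%E -> (0 < n)%N ->
  ((n%:R^-1)%:E * \sum_(i < n) t i <= eta%:E)%E ->
  (forall i, (i < n)%N -> t i \is a fin_num) /\
  n%:R^-1 * \sum_(i < n) fine (t i) <= eta.
Proof.
move=> t0 n0 H; have n1 : 0 < n%:R^-1 :> R by rewrite invr_gt0 ltr0n.
have finS : \sum_(i < n) t i \is a fin_num.
  rewrite ge0_fin_numE; last by apply: sume_ge0 => i _.
  rewrite ltNge leye_eq; apply/eqP => S1; move: H; rewrite S1.
  by rewrite mulry gtr0_sg// mul1e leye_eq.
have fint i : (i < n)%N -> t i \is a fin_num.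
  move=> ni; rewrite ge0_fin_numE//; apply: le_lt_trans (_ : \sum_(i < n) t i < +oo)%E.
    by rewrite (bigD1 (Ordinal ni))//= leeDl// sume_ge0.
  by rewrite -ge0_fin_numE// sume_ge0.
split=> //; rewrite -lee_fin EFinM (le_trans _ H)// lee_pmul2l//.
rewrite -sumEFin; apply: lee_sum => i _; rewrite fineK// fint//.
Qed.

Lemma cvge0_near {I : Type} (F : set_system I) {FF : Filter F} (u : I -> \bar R) (eta : R) :
  u @ F --> 0%E -> 0 < eta -> \forall x \near F, (u x <= eta%:E)%E.
Proof.
move=> /fine_cvgP[fu cu] eta0.
move/cvgrPdist_le: cu => /(_ _ eta0) cu; near=> x.
have ux : u x \is a fin_num by near: x.
have : `|0 - fine (u x)| <= eta by near: x.
by rewrite -(fineK ux) lee_fin sub0r normrN => /(le_trans (ler_norm _)).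
Unshelve. all: by end_near. Qed.

End ereal_averages.

Section model.
Context {R : realType} {p : nat} {dS dT : measure_display}
  {S : measurableType dS} {T : measurableType dT}.
Variables (mu : {measure set S -> \bar R}) (P : probability T R).
Variables (alpha : R) (halpha : 0 <= alpha).
Variables (Theta : set 'rV[R]_p) (ts : 'rV[R]_p) (hts : Theta ts).
Variables (f : nat -> S -> 'rV[R]_p -> R) (hf : density_model mu f Theta).
Variables (Y : nat -> {RV P >-> S}).
Hypothesis hY : forall (i : nat) (A : set S), measurable A ->
    distribution P (Y i) A = (\int[mu]_(y in A) (f i y ts)%:E)%E.
Variables (U : set 'rV[R]_p) (X : set S).
Hypothesis h1 : C1_common_support f Theta X.
Hypotheses (oU : open U) (UTheta : U `<=` Theta) (Uts : U ts).
Hypothesis h3 : C3_differentiation_under_integral mu f alpha U.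
Variables (N : set S) (mN : measurable N) (N0 : mu N = 0%E).
Hypothesis hsm : forall y, ~ N y -> X y -> forall i, smooth_on U 3 (f i y).

Local Notation V := (V mu f alpha).
Local Notation power_int := (power_int mu f alpha).

(** Here all densities are positive on U and smooth. Each [Y i] lies in this set almost surely: off
    the null set N, its complement carries density zero. *)
Definition good_set : set S := X `&` ~` N.
Local Notation G := good_set.

Let mY k : measurable_fun [set: T] (Y k).
Proof. exact: measurable_funPT. Qed.

Let mf i t : Theta t -> measurable_fun [set: S] (f i ^~ t).
Proof. by move=> /(hf i)[]. Qed.

Let f_ge0 i t y : Theta t -> 0 <= f i y t.
Proof. by move=> /(hf i)[]. Qed.

Let f_gt0 i t y : Theta t -> X y -> 0 < f i y t.
Proof. by move=> Tt; rewrite -(h1 i Tt). Qed.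

Let f_eq0 i t y : Theta t -> ~ X y -> f i y t = 0.
Proof.
move=> Tt; rewrite -(h1 i Tt) /= => /negP; rewrite -leNgt => fy.
by apply/eqP; rewrite eq_le fy f_ge0.
Qed.

Lemma measurable_good_set : measurable G.
Proof.
apply: measurableI; last exact: measurableC.
rewrite -(h1 0%N hts); apply: measurable_set_lt => //; exact: mf.
Qed.
Local Notation mG := measurable_good_set.

Let notG i t y : Theta t -> ~ G y -> ~ N y -> f i y t = 0.
Proof. by move=> Tt nG nN; apply: f_eq0 => // Xy; apply: nG. Qed.

Let eqA i (A : set S) : measurable A ->
  (\int[P]_(w in Y i @^-1` A) 1%:E = \int[mu]_(w in id @^-1` A) (f i w ts)%:E)%E.
Proof.
move=> mA; rewrite integral_cst; last exact: measurable_funPTI.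
by rewrite mul1e; exact: hY.
Qed.

(** The integrand [g0] may be nonmeasurable or meaningless off G. Outside G and N the density is
    zero, so both weighted integrands agree off the null set N, and [g0] can be replaced by a
    measurable [g] before passing to P. *)
Lemma expect_P i (g0 g : S -> R) : measurable_fun [set: S] g ->
  (forall y, G y -> g0 y = g y) ->
  (expect mu f i ts g0 = \int[P]_w (g (Y i w))%:E)%E.
Proof.
move=> mg gg; rewrite /expect.
rewrite (@integral_eq_off_null _ _ _ mu N _ (fun y => (g y * f i y ts)%:E)) //; last first.
  move=> y Ny; have [Gy|nG] := pselect (G y); first by rewrite gg.
  by rewrite (notG _ hts nG Ny) !mulr0.
rewrite -(@integral_transfer _ _ _ _ _ _ _ P mu (Y i) id (fun=> 1) (fun y => f i y ts)) //.
- by apply: eq_integral => w _; rewrite mulr1.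
- exact: mf.
- by move=> y; exact: f_ge0.
- exact: eqA.
Qed.

Lemma Rexpect_P i (g0 g : S -> R) : measurable_fun [set: S] g ->
  (forall y, G y -> g0 y = g y) ->
  fine (expect mu f i ts g0) = \int[P]_w g (Y i w).
Proof. by move=> mg gg; rewrite (expect_P i mg gg). Qed.

Lemma good_set_ae i : P (~` (Y i @^-1` G)) = 0%E.
Proof.
have -> : P (~` (Y i @^-1` G)) = distribution P (Y i) (~` G) by [].
rewrite hY; last by apply: measurableC; exact: mG.
rewrite integral_mkcond (@integral_eq_off_null _ _ _ mu N _ (cst 0%E)) ?integral0//.
move=> y Ny; rewrite patchE; case: ifPn => // /set_mem nG.
by rewrite (notG _ hts nG Ny).
Qed.

Lemma intble_of_ge0 i (g : S -> R) : measurable_fun [set: S] g ->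
  (forall y, 0 <= g y) -> (\int[P]_w (g (Y i w))%:E)%E \is a fin_num ->
  intble P (fun w => g (Y i w)).
Proof.
move=> mg g0 gfin; apply/integrableP; split.
  by apply/measurable_EFinP; exact: measurableT_comp.
under eq_integral do rewrite /= ger0_norm//.
by rewrite -ge0_fin_numE// integral_ge0// => w _; rewrite lee_fin.
Qed.

(** If the integral vanished, f would be zero almost everywhere, contradicting total mass 1. The
    finiteness clause of [C3_differentiation_under_integral] rules out the other way in which a
    real-valued integral is 0, namely [fine +oo]. *)
Lemma power_int_gt0 i t : U t -> 0 < power_int i t.
Proof.
move=> Ut; have Tt := UTheta Ut; have [lty _ _] := h3 i.
have a1 : 0 < alpha + 1 by rewrite ltr_wpDl.
have mfa : measurable_fun [set: S] (fun y => (f i y t `^ (alpha + 1))%:E).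
  apply/measurable_EFinP.
  by apply: (measurableT_comp (measurable_powR _)); exact: mf.
rewrite lt_neqAle Rintegral_ge0 ?andbT; last by move=> y _; exact: powR_ge0.
apply/eqP => /esym I0.
have int0 : (\int[mu]_y (f i y t `^ (alpha + 1))%:E = 0)%E.
  move: I0; rewrite /Defs.power_int /Rintegral => I0.
  rewrite -[LHS]fineK ?I0// ge0_fin_numE; first exact: lty.
  by apply: integral_ge0 => y _; rewrite lee_fin powR_ge0.
have : (\int[mu]_y `|(f i y t `^ (alpha + 1))%:E| = 0)%E.
  rewrite -[RHS]int0; apply: eq_integral => y _.
  by rewrite /= ger0_norm ?powR_ge0.
move/(ae_eq_integral_abs mu measurableT mfa) => ae0.
have [_ _ int1] := hf i Tt.
have : (\int[mu]_y (f i y t)%:E = 0)%E.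
  rewrite (ae_eq_integral (cst 0%E)) ?integral0//.
  - by apply/measurable_EFinP; exact: mf.
  - apply: filterS ae0 => y /(_ I) [] H _; congr EFin; move/eqP: H.
    by rewrite powR_eq0 => /andP[/eqP].
by rewrite int1 => /eqP; rewrite eqe oner_eq0.
Qed.

Let smooth_power_int i : smooth_on U 3 (power_int i).
Proof. by have [_ /thrice_derivableP] := h3 i. Qed.

Lemma smooth_V y i : G y -> smooth_on U 3 (V i y).
Proof.
move=> [Xy Ny]; have sf := hsm Ny Xy i.
have f0 t : U t -> 0 < f i y t by move=> /UTheta Tt; exact: f_gt0.
case: (boolP (alpha == 0)) => a0.
  rewrite (_ : V i y = fun t => ln (f i y t)); first exact: (smooth_on_ln oU f0 sf).
  by apply/funext => t; rewrite /Defs.V a0.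
rewrite (_ : V i y =
  fun t => f i y t `^ alpha * (power_int i t `^ (alpha / (alpha + 1)))^-1); last first.
  by apply/funext => t; rewrite /Defs.V (negbTE a0).
apply: (smooth_onM oU); first exact: smooth_on_powR.
apply: (smooth_onV oU).
  by move=> t Ut; rewrite powR_gt0// power_int_gt0.
apply: (smooth_on_powR oU); last exact: smooth_power_int.
by move=> t; exact: power_int_gt0.
Qed.

Lemma measurable_V i t : Theta t -> measurable_fun [set: S] (fun y => V i y t).
Proof.
move=> Tt; rewrite /Defs.V; case: (alpha == 0).
  by apply: (measurableT_comp (@measurable_ln R)); exact: mf.
apply: measurable_funM => //.
by apply: (measurableT_comp (measurable_powR _)); exact: mf.
Qed.

Let mVG i t : U t -> measurable_fun [set: S] (fun y => V i y t * \1_G y).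
Proof.
move=> Ut; apply: measurable_funM; first by apply: measurable_V; exact: UTheta.
by apply: measurable_indic; exact: mG.
Qed.

Lemma measurable_partial1 i j t : U t ->
  measurable_fun [set: S] (fun y => partial j (V i y) t * \1_G y).
Proof.
move=> Ut; apply: (measurable_partial oU Ut mG).
  by move=> s Us; exact: mVG.
by move=> y Gy; have [+ _] := smooth_V i Gy; exact.
Qed.

Lemma measurable_partial2 i k l t : U t ->
  measurable_fun [set: S] (fun y => partial k (partial l (V i y)) t * \1_G y).
Proof.
move=> Ut; apply: (measurable_partial oU Ut mG (phi := fun y => partial l (V i y))).
  by move=> s Us; exact: measurable_partial1.
by move=> y Gy; have [_ /(_ l) [+ _]] := smooth_V i Gy; exact.
Qed.

(* The partial derivatives of V i y are only known to exist off the null set N,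
   hence the indicator of G, which makes psi and hess measurable. *)
Definition psi i j y := partial j (V i y) ts * \1_G y.
Definition hess i k l y := partial k (partial l (V i y)) ts * \1_G y.

Lemma measurable_psi i j : measurable_fun [set: S] (psi i j).
Proof. exact: measurable_partial1. Qed.

Lemma measurable_hess i k l : measurable_fun [set: S] (hess i k l).
Proof. exact: measurable_partial2. Qed.

Let onG y : G y -> \1_G y = 1 :> R.
Proof. by move=> Gy; rewrite indicE mem_set. Qed.

Lemma psiE i j y : G y -> partial j (V i y) ts = psi i j y.
Proof. by move=> Gy; rewrite /psi onG// mulr1. Qed.

Lemma hessE i k l y : G y -> partial k (partial l (V i y)) ts = hess i k l y.
Proof. by move=> Gy; rewrite /hess onG// mulr1. Qed.

Lemma cesaro_P (D0 D : nat -> S -> R) : (forall i, measurable_fun [set: S] (D i)) ->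
  (forall i y, G y -> D0 i y = D i y) ->
  cesaro_uniformly_integrable mu f ts D0 ->
  (forall i, intble P (D i \o Y i)) /\
  (forall eta : R, 0 < eta -> exists2 K : R, 0 <= K & forall n, (1 < n)%N ->
    n%:R^-1 * \sum_(i < n) \int[P]_w (`|D i (Y i w)| *
       \1_[set y | K < `|D i y|] (Y i w)) <= eta).
Proof.
move=> mD DD UI.
pose g K i y := `|D i y| * \1_[set y | K < `|D i y|] y : R.
have mg K i : measurable_fun [set: S] (g K i).
  apply: measurable_funM; first exact: measurableT_comp.
  by apply: measurable_indic; apply: measurable_set_lt => //; exact: measurableT_comp.
have g0 K i y : 0 <= g K i y by rewrite mulr_ge0// indicE.
pose t K i : \bar R := (\int[P]_w (g K i (Y i w))%:E)%E.
have t0 K i : (0 <= t K i)%E by apply: integral_ge0 => w _; rewrite lee_fin.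
have tE K i : expect mu f i ts (fun y => `|D0 i y| * \1_[set z | (K < `|D0 i z|)%R] y) = t K i.
  apply: expect_P => // y Gy; rewrite /g DD//; congr (_ * _).
  by rewrite !indicE; congr (_%:R); congr nat_of_bool; apply/idP/idP; rewrite !inE/= DD.
have main eta : 0 < eta -> exists2 K : R, 0 <= K & forall n, (1 < n)%N ->
    ((n%:R^-1)%:E * \sum_(i < n) t K i <= eta%:E)%E.
  move=> eta0; have H := @cvge0_near R _ _ (@filter_filter _ _ proper_pinfty_nbhs) _ _ UI eta0.
  have [K [K0 HK]] : exists K : R, 0 <= K /\ (ereal_sup [set ((n%:R^-1)%:E * \sum_(i < n)
      expect mu f i ts (fun y => `|D0 i y| * \1_[set z | (K < `|D0 i z|)%R] y)%R)%E
      | n in [set n | (1 < n)%N]] <= eta%:E)%E.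
    have [K0 [_ HK]] := H; exists (Num.max 0 (K0 + 1)).
    split; first by rewrite le_max lexx.
    by apply: HK; rewrite lt_max ltrDl ltr01 orbT.
  exists K => // n n1; apply: le_trans HK.
  apply: ereal_sup_ubound; exists n => //; congr (_ * _)%E.
  by apply: eq_bigr => i _; rewrite tE.
have real eta : 0 < eta -> exists2 K : R, 0 <= K & forall n, (1 < n)%N ->
    (forall i, (i < n)%N -> t K i \is a fin_num) /\
    n%:R^-1 * \sum_(i < n) fine (t K i) <= eta.
  move=> /main [K K0 HK]; exists K => // n n1.
  by apply: average_le_fin; [exact: t0|exact: ltn_trans n1|exact: HK].
split=> [i|eta eta0]; last first.
  have [K K0 HK] := real eta eta0; exists K => // n n1.
  by have [_] := HK n n1.
have [K K0 HK] := real 1 ltr01.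
(* The average must have more than one term and include index i. *)
have [/(_ i) + _] := HK i.+2 isT.
move=> /(_ (ltnW (ltnSn i.+1))) fint.
have ig := intble_of_ge0 (mg K i) (g0 K i) fint.
apply: (le_intble _ _ (intbleD (intble_cst P K) ig)).
  exact: measurableT_comp.
move=> w /=; rewrite /g indicE.
have [DK|DK] := ltP K `|D i (Y i w)|.
  by rewrite mem_set// mulr1 lerDr.
by rewrite memNset ?mulr0 ?addr0//=; apply/negP; rewrite -leNgt.
Qed.


(* On G, the score times the density is
   c1 * partial j (f ^ (alpha + 1)) - c2 * f ^ (alpha + 1) with constants c1, c2,
   and C3 integrates both terms. *)
Lemma score_mean0 i j : \int[P]_w psi i j (Y i w) = 0.
Proof.
pose fa y s := f i y s `^ (alpha + 1).
pose I := power_int i ts; pose dI := partial j (power_int i) ts.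
have I0 : 0 < I by exact: power_int_gt0.
have a1 : alpha + 1 != 0 by rewrite gt_eqF// ltr_wpDl.
have [Ilty _ /(_ _ Uts j j j)[dIE _ _]] := h3 i.
have mfa s : U s -> measurable_fun [set: S] (fun y => fa y s).
  move=> Us; apply: (measurableT_comp (measurable_powR _)).
  by apply: mf; exact: UTheta.
have sfa y : G y -> smooth_on U 3 (fa y).
  move=> [Xy Ny]; apply: (smooth_on_powR oU); last exact: hsm.
  by move=> t /UTheta Tt; exact: f_gt0.
pose dfa y := partial j (fa y) ts * \1_G y.
have mdfa : measurable_fun [set: S] dfa.
  apply: (measurable_partial oU Uts mG (phi := fa)).
    move=> s Us; apply: measurable_funM; first exact: mfa.
    by apply: measurable_indic; exact: mG.
  by move=> y Gy; have [+ _] := sfa y Gy; exact.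
have fa0 y s : U s -> ~ X y -> fa y s = 0.
  by move=> Us nX; rewrite /fa (f_eq0 i (UTheta Us) nX) powR0.
have int_dfa : (\int[mu]_y (dfa y)%:E = dI%:E)%E.
  rewrite dIE; apply: (integral_eq_off_null mN N0) => y Ny; rewrite /dfa.
  have [Xy|nX] := pselect (X y); first by rewrite onG ?mulr1.
  rewrite indicE memNset ?mulr0; last by case.
  (* The support does not depend on the parameter, so off X the power of the density is identically
     zero on U, and so is its derivative. *)
  rewrite (@partial_congr _ _ U oU (fa y) (fun=> 0) _ ts Uts) ?/partial ?derive_cst//.
  by move=> s Us; exact: fa0.
have int_fa : (\int[mu]_y (fa y ts)%:E = I%:E)%E.
  rewrite /I /Defs.power_int /Rintegral fineK//.
  rewrite ge0_fin_numE; first exact: Ilty.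
  by apply: integral_ge0 => y _; rewrite lee_fin powR_ge0.
have idfa : mu.-integrable [set: S] (EFin \o dfa).
  by apply: fin_num_integrable => //; rewrite int_dfa.
have ifa : mu.-integrable [set: S] (EFin \o (fa ^~ ts)).
  by apply: fin_num_integrable; [exact: mfa|rewrite int_fa].
have [c1 [c2 [E1 E2]]] : exists c1 c2 : R, c1 * dI - c2 * I = 0 /\
    forall y, G y -> partial j (V i y) ts * f i y ts = c1 * partial j (fa y) ts - c2 * fa y ts.
  have dfaE y : G y -> partial j (fa y) ts = (alpha + 1) * f i y ts `^ alpha * partial j (f i y) ts.
    move=> [Xy Ny]; rewrite /fa {1}/partial.
    have [_ ->] := is_derive_powR (alpha + 1) (f_gt0 i hts Xy)
      (smooth_on_derivable j (hsm Ny Xy i) Uts).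
    by rewrite addrK.
  have [a0|a0] := boolP (alpha == 0).
    (* For alpha = 0 the power integral is the total mass, constantly 1 on U, so dI = 0. *)
    exists 1, 0; split.
      rewrite mul0r subr0 mul1r /dI (@partial_congr _ _ U oU _ (fun=> 1) _ ts Uts).
        by rewrite /partial derive_cst.
      move=> s Us; rewrite /Defs.power_int /Rintegral (eqP a0) add0r.
      under eq_integral do rewrite powRr1 ?(f_ge0 i _ (UTheta Us))//.
      by have [_ _ ->] := hf i (UTheta Us).
    move=> y Gy; have [Xy Ny] := Gy.
    have fy := f_gt0 i hts Xy.
    rewrite (_ : V i y = (@ln R) \o f i y); last first.
      by apply/funext => t; rewrite /Defs.V a0.
    rewrite dfaE// mul1r mul0r subr0 (eqP a0) add0r mul1r powRr0 mul1r.
    have dl := is_derive1_ln fy.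
    have [_ +] := is_derive_comp1 dl (smooth_on_derivable j (hsm Ny Xy i) Uts).
    by rewrite /partial => ->; rewrite mulrAC mulVf ?mul1r// gt_eqF.
  (* With V = f^alpha I^(-a), the product rule and alpha f^alpha df = a d(f^(alpha+1)) give both
     constants. They satisfy c1 dI = c2 I because I^(-a) = I^(-a-1) I. *)
  pose a := alpha / (alpha + 1).
  exists (a * I `^ (- a)), (a * I `^ (- a - 1) * dI); split.
    have -> : I `^ (- a) = I `^ (- a - 1) * I.
      by rewrite -{3}(powRr1 (ltW I0)) -powRD ?subrK// (gt_eqF I0) implybT.
    by ring.
  move=> y Gy; have [Xy Ny] := Gy; rewrite dfaE//.
  have fy := f_gt0 i hts Xy.
  rewrite (_ : V i y = (fun t => f i y t `^ alpha) * (fun t => power_int i t `^ (- a))); last first.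
    by apply/funext => t; rewrite /Defs.V (negbTE a0)/= -powRN.
  have d1 := is_derive_powR alpha fy (smooth_on_derivable j (hsm Ny Xy i) Uts).
  have d2 := is_derive_powR (- a) I0 (smooth_on_derivable j (smooth_power_int i) Uts).
  have [_ dV] := is_deriveM d1 d2; rewrite [partial j (_ * _) ts]dV.
  rewrite /GRing.scale/= /fa -/I -/dI.
  have e1 : f i y ts `^ alpha = f i y ts `^ (alpha - 1) * f i y ts.
    by rewrite -{3}(powRr1 (ltW fy)) -powRD ?subrK// (gt_eqF fy) implybT.
  have e2 : f i y ts `^ (alpha + 1) = f i y ts `^ alpha * f i y ts.
    by rewrite -{3}(powRr1 (ltW fy)) -powRD// (gt_eqF fy) implybT.
  rewrite e2 e1 /a; by field.
rewrite -(Rexpect_P i (measurable_psi i j) (fun y _ => erefl)) /expect.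
rewrite (@integral_eq_off_null _ _ _ mu N _ (fun y => (c1 * dfa y - c2 * fa y ts)%:E)) //; last first.
  move=> y Ny; congr EFin; have [Xy|nX] := pselect (X y).
    have Gy : G y by [].
    by rewrite /psi /dfa !onG// !mulr1 E2.
  rewrite (f_eq0 i hts nX) fa0// /dfa indicE memNset ?mulr0 ?subrr//; by case.
rewrite -/(Rintegral _ _ _).
rewrite RintegralB//; last 2 first.
  exact: (integrableZl measurableT c1 idfa).
  exact: (integrableZl measurableT c2 ifa).
rewrite !RintegralZl// /Rintegral int_dfa int_fa; exact: E1.
Qed.

Hypothesis h6 : C6_uniform_integrability mu f alpha ts.

Lemma psi_intble i j : intble P (psi i j \o Y i).
Proof.
have [H _ _] := h6 j j j.
by have [+ _] := cesaro_P (fun i => measurable_psi i j) (fun i y => @psiE i j y) H; exact.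
Qed.

Lemma hess_intble i k l : intble P (hess i k l \o Y i).
Proof.
have [_ H _] := h6 k l l.
by have [+ _] := cesaro_P (fun i => measurable_hess i k l) (fun i y => @hessE i k l y) H; exact.
Qed.

Lemma J_hess i k l : J mu f alpha i ts k l = - \int[P]_w hess i k l (Y i w).
Proof.
by rewrite mxE (Rexpect_P i (measurable_hess i k l))// => y Gy; exact: hessE.
Qed.

Variable B : nat -> 'M[R]_p.
Hypothesis hB : forall n, (0 < n)%N -> is_invsqrtmx (Omega mu f alpha n ts) (B n).
Hypothesis hlind : forall eps : R, 0 < eps ->
    let xi i n y := gradV mu f alpha i ts y *m (B n)^T in
    ((n%:R^-1)%:E * \sum_(i < n)
      expect mu f i ts (fun y => norm2 (xi i n y) ^+ 2 *
        \1_[set z | (eps * Num.sqrt n%:R < norm2 (xi i n z))%R] y)%R)%E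
    @[n --> \oo] --> 0%E.

Local Notation xi := (standardized psi B).

Let q eps i n y : R := norm2 (xi i n y) ^+ 2 *
    \1_[set z | eps * Num.sqrt n%:R < norm2 (xi i n z)] y.

Let mxi i n : measurable_fun [set: S] (fun y => norm2 (xi i n y)).
Proof.
apply: measurable_norm2 => k; apply: measurable_standardized.
exact: measurable_psi.
Qed.

Let mq eps i n : measurable_fun [set: S] (q eps i n).
Proof.
apply: measurable_funM; first exact: measurable_funX.
by apply: measurable_indic; exact: measurable_set_lt.
Qed.

Let q0 eps i n y : 0 <= q eps i n y.
Proof. by rewrite mulr_ge0 ?sqr_ge0// indicE. Qed.

Let xiE i n y : G y -> gradV mu f alpha i ts y *m (B n)^T = xi i n y.
Proof.
by move=> Gy; congr (_ *m _); apply/rowP => j; rewrite !mxE psiE.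
Qed.

Let lind_near eps eta : 0 < eps -> 0 < eta -> \forall n \near \oo,
  (forall i, (i < n)%N -> (\int[P]_w (q eps i n (Y i w))%:E)%E \is a fin_num) /\
  n%:R^-1 * \sum_(i < n) \int[P]_w q eps i n (Y i w) <= eta.
Proof.
move=> eps0 eta0; have H := cvge0_near (hlind eps0) eta0.
near=> n.
have n0 : (0 < n)%N by near: n; exact: nbhs_infty_gt.
apply: average_le_fin => // [i|].
  by apply: integral_ge0 => w _; rewrite lee_fin q0.
have Hn : ((n%:R^-1)%:E * \sum_(i < n)
      expect mu f i ts (fun y => norm2 (gradV mu f alpha i ts y *m (B n)^T) ^+ 2 *
        \1_[set z | (eps * Num.sqrt n%:R < norm2 (gradV mu f alpha i ts z *m (B n)^T))%R] y)%R
   <= eta%:E)%E by near: n; exact: H.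
apply: le_trans Hn; rewrite le_eqVlt; apply/orP; left; apply/eqP.
congr (_ * _)%E; apply: eq_bigr => i _; apply/esym.
apply: (expect_P i (mq eps i n)) => y Gy.
congr (_ * _); first by rewrite (xiE i n Gy).
by rewrite !indicE; congr (_%:R); congr nat_of_bool; apply/idP/idP; rewrite !inE/= xiE.
Unshelve. all: by end_near. Qed.

Let Bunit n : (0 < n)%N -> B n \in unitmx.
Proof. by move=> n0; have [_ /posdef_unitmx] := hB n0. Qed.

Let Bsym n : (0 < n)%N -> (B n)^T = B n.
Proof. by move=> n0; have [_ []] := hB n0. Qed.

(** Square integrability of the score is extracted from the Lindeberg condition. For n large and
    greater than i the tail of |xi|^2 beyond sqrt(n) has finite mean, so |xi|^2, at most n plus that
    tail, is integrable; invertibility of B_n recovers psi from xi. *)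
Lemma psi_sqr_intble i j : intble P (fun w => psi i j (Y i w) ^+ 2).
Proof.
have [m _ Hm] := lind_near ltr01 ltr01.
pose n := (m + i).+1.
have n0 : (0 < n)%N by [].
have [|+ _] := Hm n; first by rewrite /= /n -addnS leq_addr.
have iltn : (i < n)%N by rewrite /n ltnS leq_addl.
move=> /(_ i iltn) qfin.
have qI := intble_of_ge0 (mq 1 i n) (q0 1 i n) qfin.
pose c := \sum_k `|invmx (B n)^T k j|.
have c0 : 0 <= c by exact: sumr_ge0.
have psiB y : `|psi i j y| <= c * norm2 (xi i n y).
  have -> : psi i j y = (xi i n y *m invmx (B n)^T) 0 j.
    by rewrite mulmxK ?mxE// unitmx_tr Bunit.
  rewrite mxE (le_trans (ler_norm_sum _ _ _))// mulr_suml ler_sum// => k _.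
  by rewrite normrM mulrC ler_wpM2l// coord_le_norm2.
have bI := intbleZ (c ^+ 2) (intbleD (intble_cst P n%:R) qI).
apply: (le_intble _ _ bI).
  by apply: measurable_funX; exact: (measurableT_comp (measurable_psi i j)).
move=> w; set y := Y i w; rewrite normrX.
apply: (@le_trans _ _ ((c * norm2 (xi i n y)) ^+ 2)).
  by rewrite lerXn2r// nnegrE// mulr_ge0// norm2_ge0.
rewrite exprMn ler_wpM2l ?sqr_ge0//= /q indicE.
have [nx|nx] := ltP (1 * Num.sqrt n%:R) (norm2 (xi i n y)).
  by rewrite mem_set// mulr1 lerDr.
rewrite memNset ?mulr0 ?addr0; last by apply/negP; rewrite -leNgt.
rewrite -[leRHS](@sqr_sqrtr _ n%:R)// lerXn2r// ?nnegrE ?norm2_ge0//.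
by rewrite -[leRHS]mul1r.
Qed.

Lemma lindeberg_P eps : 0 < eps ->
  n%:R^-1 * \sum_(i < n) \int[P]_w q eps i n (Y i w) @[n --> \oo] --> 0.
Proof.
move=> eps0; apply/cvgrPdist_le => /= r r0.
apply: filterS (lind_near eps0 r0) => n [_ H].
rewrite sub0r normrN ger0_norm// mulr_ge0// sumr_ge0// => i _.
by apply: Ex_ge0 => w; exact: q0.
Qed.

(** The means subtracted in [covar] vanish by [score_mean0]. *)
Lemma Omega_psi n : Omega mu f alpha n ts = n%:R^-1 *:
  \sum_(i < n) \matrix_(j, k) \int[P]_w (psi i j (Y i w) * psi i k (Y i w)).
Proof.
congr (_ *: _); apply: eq_bigr => i _; apply/matrixP => j k; rewrite !mxE /covar.
have m0 l : fine (expect mu f i ts (fun y => gradV mu f alpha i ts y 0 l)) = 0.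
  rewrite -(score_mean0 i l); apply: Rexpect_P; first exact: measurable_psi.
  by move=> y Gy; rewrite mxE psiE.
apply: (Rexpect_P i (g := fun y => psi i j y * psi i k y)).
  by apply: measurable_funM; exact: measurable_psi.
by move=> y Gy; rewrite !m0 !subr0 !mxE !psiE.
Qed.

Let BOm n : (0 < n)%N -> B n *m Omega mu f alpha n ts *m (B n)^T = 1%:M.
Proof.
move=> n0; have [uO _ BB] := hB n0; rewrite Bsym//.
by apply: mulmx1C; rewrite mulmxA BB mulVmx.
Qed.

Variables (M : nat -> 'I_p -> 'I_p -> 'I_p -> S -> R) (m : 'I_p -> 'I_p -> 'I_p -> R).
Hypothesis mM : forall i j k l, measurable_fun [set: S] (M i j k l).
Hypothesis hM : forall y, ~ N y -> X y -> forall i t, U t -> forall j k l,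
  `|partial j (partial k (partial l (V i y))) t| <= M i j k l y.
Hypothesis hMm : forall i j k l, expect mu f i ts (M i j k l) = (m j k l)%:E.

(** M dominates an absolute value, hence is nonnegative, only on G; the indicator makes the envelope
    nonnegative and measurable everywhere. *)
Definition envelope i j k l y := M i j k l y * \1_G y.
Local Notation Mg := envelope.

Let mMg i j k l : measurable_fun [set: S] (Mg i j k l).
Proof. by apply: measurable_funM => //; apply: measurable_indic; exact: mG. Qed.

Let Mg0 i j k l y : 0 <= Mg i j k l y.
Proof.
rewrite /envelope indicE; have [/set_mem[Xy Ny]|] := boolP (y \in G); last by rewrite mulr0.
by rewrite mulr1; exact: le_trans (hM Ny Xy i Uts j k l).
Qed.

Let EMg i j k l : (\int[P]_w (Mg i j k l (Y i w))%:E = (m j k l)%:E)%E.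
Proof.
rewrite -(hMm i); apply/esym; apply: expect_P => // y Gy.
by rewrite /envelope onG ?mulr1.
Qed.

Lemma envelope_intble i j k l : intble P (fun w => Mg i j k l (Y i w)).
Proof. by apply: intble_of_ge0 => //; rewrite EMg. Qed.

Lemma envelope_mean i j k l : \int[P]_w Mg i j k l (Y i w) = m j k l.
Proof. by rewrite /Rintegral EMg. Qed.

Local Notation Psi_ n := (Psi mu f alpha n ts).
Local Notation Z := (standardized_sum Y psi B).

(** [J] is minus the mean Hessian, so adding Psi_n centres the averaged Hessian. Entries are summed,
    rather than maximized, so that the expectation splits into the averages handled by the weak
    law. *)
Definition hess_error n w : R :=
  \sum_k \sum_l `|n%:R^-1 * \sum_(i < n) hess i k l (Y i w) + Psi_ n k l|.

Definition envelope_average n w : R :=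
  \sum_j \sum_k \sum_l n%:R^-1 * \sum_(i < n) Mg i j k l (Y i w).

Let envelope_average_part n w k l :
  \sum_j n%:R^-1 * \sum_(i < n) Mg i j k l (Y i w) <= envelope_average n w.
Proof.
apply: ler_sum => j _.
have h0 k' l' : 0 <= n%:R^-1 * \sum_(i < n) Mg i j k' l' (Y i w).
  by rewrite mulr_ge0// sumr_ge0.
rewrite (bigD1 k)//= (bigD1 l)//= -addrA lerDl addr_ge0// sumr_ge0// => k' _.
by rewrite sumr_ge0.
Qed.

(** A deterministic statement about one outcome w. Since the averaged score vanishes at b, its value
    at the true parameter equals the increment multiplied by minus the averaged Hessian with its
    Taylor corrections. E is defined as the difference between that matrix and Psi_n, so the
    equation is exact. *)
Lemma score_expansion rho n w (b : 'rV[R]_p) : (0 < n)%N ->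
  [set t : 'rV[R]_p | forall j, `|t 0 j - ts 0 j| < rho] `<=` U ->
  (forall i, G (Y i w)) -> (forall j, `|b 0 j - ts 0 j| < rho) ->
  (forall k, is_derive b (delta_mx 0 k) (H mu f alpha [tuple Y i w | i < n]) 0) ->
  exists2 E : 'M[R]_p, `|E| <= hess_error n w + envelope_average n w * `|b - ts| &
    (Num.sqrt n%:R *: (b - ts)) *m (Psi_ n + E) = Z n w *m invmx (B n).
Proof.
move=> n0 WU GY Wb root.
have sV i := smooth_V i (GY i).
pose g l t := n%:R^-1 * \sum_(i < n) partial l (V i (Y i w)) t.
pose dg l k t := n%:R^-1 * \sum_(i < n) partial k (partial l (V i (Y i w))) t.
pose ddg l j k t := n%:R^-1 * \sum_(i < n) partial j (partial k (partial l (V i (Y i w)))) t.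
have avg_derive (h : nat -> 'rV[R]_p -> R) (dh : nat -> R) t v :
    (forall i, is_derive t v (h i) (dh i)) ->
    is_derive t v (fun s => n%:R^-1 * \sum_(i < n) h i s) (n%:R^-1 * \sum_(i < n) dh i).
  move=> hd.
  rewrite (_ : (fun s => _) = n%:R^-1 *: \sum_(i < n) h i); last first.
    by apply/funext => s; rewrite fctE fct_sumE.
  by apply: is_deriveZ.
have gb0 l : g l b = 0.
  have [_ <-] := root l; apply/esym.
  rewrite (_ : H mu f alpha _ = fun t => n%:R^-1 * \sum_(i < n) V i (Y i w) t); last first.
    by apply/funext => t; congr (_ * _); apply: eq_bigr => i _; rewrite tnth_mktuple.
  have [_ +] := avg_derive _ _ b (delta_mx 0 l) (fun i => smooth_on_derivable l (sV i) (WU _ Wb)).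
  by [].
have Tay l := @taylor1_coordinate R p ts rho (g l) (dg l) (ddg l)
  (fun j k => n%:R^-1 * \sum_(i < n) Mg i j k l (Y i w)) b Wb.
have {}Tay l : exists r : 'I_p -> R,
    (forall k, `|r k| <= (\sum_j n%:R^-1 * \sum_(i < n) Mg i j k l (Y i w)) * `|b - ts|) /\
    g l b - g l ts = \sum_k (dg l k ts + r k) * (b 0 k - ts 0 k).
  apply: Tay => t /WU Ut.
  - move=> k; apply: (avg_derive (fun i => partial l (V i (Y i w)))
      (fun i => partial k (partial l (V i (Y i w))) t)) => i.
    exact: (smooth_on_derivable k (smooth_on_partial l (sV i)) Ut).
  - move=> k j; apply: (avg_derive (fun i => partial k (partial l (V i (Y i w))))
      (fun i => partial j (partial k (partial l (V i (Y i w)))) t)) => i.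
    exact: (smooth_on_derivable j (smooth_on_partial k (smooth_on_partial l (sV i))) Ut).
  - move=> j k; rewrite normrM ger0_norm// ler_wpM2l//.
    rewrite (le_trans (ler_norm_sum _ _ _))// ler_sum// => i _.
    rewrite /envelope onG// mulr1; have [Xy Ny] := GY i; exact: hM.
pose r l := sval (cid (Tay l)).
have rb l k : `|r l k| <= (\sum_j n%:R^-1 * \sum_(i < n) Mg i j k l (Y i w)) * `|b - ts|.
  by rewrite /r; case: cid => x /= [].
have rE l : - g l ts = \sum_k (dg l k ts + r l k) * (b 0 k - ts 0 k).
  by rewrite /r; case: cid => x /= [_ <-]; rewrite gb0 sub0r.
exists (\matrix_(k, l) (- (dg l k ts + r l k) - Psi_ n k l)).
  have EA : 0 <= envelope_average n w.
    by do 3 (apply: sumr_ge0 => ? _); rewrite mulr_ge0// sumr_ge0.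
  apply: mx_norm_leP => [|k l].
    by rewrite addr_ge0 ?mulr_ge0//; do 2 (apply: sumr_ge0 => ? _).
  rewrite mxE -opprD normrN addrAC (le_trans (ler_normD _ _))// lerD//; last first.
    by rewrite (le_trans (rb l k))// ler_wpM2r// envelope_average_part.
  rewrite /hess_error (bigD1 k)//= (bigD1 l)//= -addrA.
  rewrite (_ : dg l k ts = n%:R^-1 * \sum_(i < n) hess i k l (Y i w)); last first.
    by congr (_ * _); apply: eq_bigr => i _; rewrite (hessE _ _ _ (GY i)).
  by rewrite lerDl addr_ge0//; do 2? (apply: sumr_ge0 => ? _).
have uB : B n \in unitmx by exact: Bunit.
(* The standardization by B_n cancels, leaving sqrt(n) times the averaged score. *)
have -> : Z n w *m invmx (B n) = Num.sqrt n%:R *: \row_l g l ts.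
  rewrite /standardized_sum -scalemxAl mulmx_suml.
  have sn : (Num.sqrt n%:R)^-1 = Num.sqrt n%:R * n%:R^-1 :> R.
    rewrite -[X in _ = _ * X^-1](@sqr_sqrtr _ n%:R)// expr2 invfM mulrA mulfV ?mul1r//.
    by rewrite sqrtr_eq0 -ltNge ltr0n.
  rewrite sn -scalerA; congr (_ *: _); apply/rowP => l; rewrite !mxE summxE.
  congr (_ * _); apply: eq_bigr => i _.
  by rewrite /standardized Bsym// mulmxK// mxE (psiE _ _ (GY i)).
rewrite -scalemxAl; congr (_ *: _); apply/rowP => l; rewrite [RHS]mxE -[RHS]opprK rE mxE.
rewrite -sumrN; apply: eq_bigr => k _; rewrite !mxE; ring.
Qed.

Hypothesis p0 : (0 < p)%N.
Hypothesis hindep : mutually_independent P Y.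
Hypothesis h4 : C4_positive_definite mu f alpha ts.

Let hess_errorE n k l w :
  n%:R^-1 * \sum_(i < n) hess i k l (Y i w) + Psi_ n k l =
  n%:R^-1 * \sum_(i < n) (hess i k l (Y i w) - \int[P]_v hess i k l (Y i v)).
Proof.
rewrite mxE summxE -mulrDr -big_split/=; congr (_ * _); apply: eq_bigr => i _.
by rewrite J_hess.
Qed.

Let hess_error_part_intble n k l : intble P (fun w =>
  `|n%:R^-1 * \sum_(i < n) (hess i k l (Y i w) - \int[P]_v hess i k l (Y i v))|).
Proof.
apply: intble_norm; apply: intbleZ; apply: intble_sum => i; apply: intbleB.
  exact: hess_intble.
exact: intble_cst.
Qed.

Lemma hess_error_intble n : intble P (hess_error n).
Proof.
apply: intble_sum => k; apply: intble_sum => l.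
under eq_fun do rewrite hess_errorE.
exact: hess_error_part_intble.
Qed.

Lemma cvg_hess_error : \int[P]_w hess_error n w @[n --> \oo] --> 0.
Proof.
have c0 k l : \int[P]_w `|n%:R^-1 * \sum_(i < n)
    (hess i k l (Y i w) - \int[P]_v hess i k l (Y i v))| @[n --> \oo] --> 0.
  have [_ UI _] := h6 k l l.
  have [UI1 UI2] := cesaro_P (fun i => measurable_hess i k l) (fun i y => @hessE i k l y) UI.
  exact: (weak_law_L1 hindep (fun i => measurable_hess i k l) UI1 UI2).
rewrite (_ : 0 = \sum_(k < p) \sum_(l < p) 0); last by rewrite !big1.
have : \sum_k \sum_l \int[P]_w `|n%:R^-1 * \sum_(i < n)
    (hess i k l (Y i w) - \int[P]_v hess i k l (Y i v))| @[n --> \oo] -->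
    \sum_(k < p) \sum_(l < p) (0 : R).
  apply: cvg_big => [|k _]; first exact: add_continuous.
  by apply: cvg_big => [|l _]; [exact: add_continuous|exact: c0].
apply: cvg_ext => n; rewrite /hess_error.
under [RHS]eq_Rintegral do under eq_bigr do under eq_bigr do rewrite hess_errorE.
rewrite Ex_sum; last by move=> k; apply: intble_sum => l; exact: hess_error_part_intble.
by apply: eq_bigr => k _; rewrite Ex_sum// => l; exact: hess_error_part_intble.
Qed.

Let envelope_sum_intble n j k l :
  intble P (fun w => n%:R^-1 * \sum_(i < n) Mg i j k l (Y i w)).
Proof. by apply: intbleZ; apply: intble_sum => i; exact: envelope_intble. Qed.

Lemma envelope_average_intble n : intble P (envelope_average n).
Proof. by do 3 (apply: intble_sum => ?). Qed.

Lemma envelope_average_mean n : (0 < n)%N ->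
  \int[P]_w envelope_average n w = \sum_j \sum_k \sum_l m j k l.
Proof.
move=> n0; rewrite Ex_sum; last by move=> ?; do 2 (apply: intble_sum => ?).
apply: eq_bigr => j _; rewrite Ex_sum; last by move=> ?; apply: intble_sum => ?.
apply: eq_bigr => k _; rewrite Ex_sum//; apply: eq_bigr => l _.
rewrite ExZ; last by apply: intble_sum => i; exact: envelope_intble.
rewrite Ex_sum; last by move=> i; exact: envelope_intble.
under eq_bigr do rewrite envelope_mean.
by rewrite sumr_const card_ord -[X in _ * X]mulr_natl mulrA mulVf ?mul1r// pnatr_eq0 -lt0n.
Qed.

Lemma posdef_Psi n : (0 < n)%N -> posdefmx (Psi_ n).
Proof.
move=> n0; have [pJ _] := h4; split.
  rewrite /Psi linearZ/= linear_sum; congr (_ *: _); apply: eq_bigr => i _.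
  by have [] := pJ i.
move=> x x0; rewrite -scalemxAr -scalemxAl mxE mulr_gt0 ?invr_gt0 ?ltr0n//.
rewrite mulmx_sumr mulmx_suml summxE.
case: n n0 => // n _; rewrite big_ord_recl ltr_wpDr//.
  by apply: sumr_ge0 => i _; have [_ /(_ _ x0)/ltW] := pJ (lift ord0 i).
by have [_ /(_ _ x0)] := pJ 0%N.
Qed.

Let lambda0 : R := inf [set min_eigenvalue (Psi_ n) | n in [set n | (0 < n)%N]].

Lemma invmx_Psi_bound n : (0 < n)%N -> `|invmx (Psi_ n)| <= lambda0^-1.
Proof.
move=> n0; have [_ l0] := h4.
apply: invmx_bound; [exact: l0|exact: posdef_Psi|move=> x].
have [_ /(_ x)] := min_eigenvalue_le p0 (posdef_Psi n0).
apply: le_trans; rewrite ler_wpM2r ?sqr_ge0//.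
apply: ge_inf; last by exists n.
exists 0 => _ [k k0 <-]; by have [] := min_eigenvalue_le p0 (posdef_Psi k0).
Qed.

Hypothesis cSigma : cvg (sandwich mu f alpha n ts @[n --> \oo]).
Hypothesis uSigma : Sigma mu f alpha ts \in unitmx.
Variable est : forall n, n.-tuple S -> 'rV[R]_p.
Hypothesis hest : min_RP_estimator mu f alpha P Y Theta ts est.

Local Notation obs n w := [tuple Y i w | i < n].
Local Notation W n w := (wald_stat mu f alpha n (est (obs n w)) ts).

Let measurable_est n j : measurable_fun [set: T] (fun w => est (obs n w) 0 j).
Proof.
have [mest _ _] := hest; apply: (measurableT_comp (mest n j)).
apply/measurable_fun_tnthP => i.
rewrite (_ : _ \o _ = Y i)//; apply/funext => w /=.
by rewrite tnth_mktuple.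
Qed.

Let measurable_wald n : measurable_fun [set: T] (fun w => W n w).
Proof.
rewrite (_ : (fun w => _) = (fun w => n%:R * \sum_j
    (\sum_k (est (obs n w) 0 k - ts 0 k) * invmx (Sigma mu f alpha ts) k j) *
    (est (obs n w) 0 j - ts 0 j))); last first.
  apply/funext => w; rewrite /wald_stat mulmx_trE; congr (_ * _).
  apply: eq_bigr => j _; rewrite mxE; congr (_ * _); last by rewrite !mxE.
  by apply: eq_bigr => k _; rewrite !mxE.
apply: measurable_funM => //; apply: measurable_sum => j; apply: measurable_funM.
  apply: measurable_sum => k; apply: measurable_funM => //.
  by apply: measurable_funB => //; exact: measurable_est.
by apply: measurable_funB => //; exact: measurable_est.
Qed.

Let observations_good : measurable [set w | forall i, G (Y i w)] /\
  P (~` [set w | forall i, G (Y i w)]) = 0%E.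
Proof.
have -> : [set w | forall i, G (Y i w)] = \bigcap_i Y i @^-1` G.
  by apply/seteqP; split=> w /= H i; [move=> _|]; exact: H.
have mA i : measurable (Y i @^-1` G) by apply: measurable_funPTI; exact: mG.
split; first exact: bigcapT_measurable.
rewrite setC_bigcap; apply/eqP; rewrite eq_le measure_ge0 andbT.
apply: (le_trans (measure_sigma_subadditive _ _ _ (@subset_refl _ _))) => //.
- by move=> i; exact: measurableC.
- by apply: bigcup_measurable => i _; exact: measurableC.
- by rewrite eseries0// => i _ _; exact: good_set_ae.
Qed.

(** The constants are chosen in this order: K from tightness of Z_n, the tolerance eta on |E| from K
    and e, the bound L on the averaged envelope from delta, and the radius s around the true
    parameter from eta and L. The allowance delta is shared by six events: Z_n bounded, Hessian
    error small, envelope average bounded, estimator close, observations in G, and root attained. *)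
Lemma wald_near_standardized e : 0 < e ->
  whp P (fun n => [set w | `|W n w - norm2 (Z n w) ^+ 2| <= e]).
Proof.
move=> e0 delta delta0; pose d6 := delta / 6; have d60 : 0 < d6 by rewrite divr_gt0.
have [mest cest rest] := hest.
have [rho rho0 Wrho] : exists2 rho : R, 0 < rho &
    [set t : 'rV[R]_p | forall j, `|t 0 j - ts 0 j| < rho] `<=` U.
  have /nbhs_ballP[rho /= rho0 H] : nbhs ts U by exact: open_nbhs_nbhs.
  by exists rho => // t tr; apply: H; split=> // i j; rewrite ord1 /ball/= distrC.
have [K K0 tight] := standardized_sum_tight hindep measurable_psi psi_intble score_mean0
  psi_sqr_intble (fun n _ => Omega_psi n) BOm lindeberg_P d60.
have uPsi n : (0 < n)%N -> Psi_ n \in unitmx by move=> n0; exact/posdef_unitmx/posdef_Psi.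
have sPsi n : (0 < n)%N -> (Psi_ n)^T = Psi_ n by move=> n0; have [] := posdef_Psi n0.
have [eta eta0 sand] := sandwich_quadratic_form uPsi sPsi invmx_Psi_bound hB cSigma uSigma K0 e0.
have eta2 : 0 < eta / 2 by rewrite divr_gt0.
pose mtot := \sum_j \sum_k \sum_l m j k l.
have mtot0 : 0 <= mtot.
  rewrite /mtot -(@envelope_average_mean 1)//; apply: Ex_ge0 => w.
  by do 3 (apply: sumr_ge0 => ? _); rewrite mulr_ge0// sumr_ge0.
(* By Markov's inequality the envelope average, of mean [mtot], reaches L with probability at most
   mtot / L <= d6; the added 1 keeps L positive. *)
pose L := (mtot + 1) / d6; have L0 : 0 < L by rewrite divr_gt0// ltr_wpDl.
(* The first bound keeps the estimator strictly inside the box contained in U; the second keeps the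
   third-derivative contribution L s to |E| below eta/2. *)
pose s := Num.min (rho / 2) (eta / 2 / L).
have s0 : 0 < s by rewrite lt_min; apply/andP; split; exact: divr_gt0.
have A2 : near_cover P d6 (fun n => [set w | hess_error n w < eta / 2]).
  apply: (whp_markov eta2 hess_error_intble _ cvg_hess_error) => // n w.
  by do 2 (apply: sumr_ge0 => ? _).
have A3 : near_cover P d6 (fun n => [set w | envelope_average n w < L]).
  apply: (@near_cover_markov _ _ _ _ _ mtot) => //.
  - exact: envelope_average_intble.
  - by move=> n w; do 3 (apply: sumr_ge0 => ? _); rewrite mulr_ge0// sumr_ge0.
  - near=> n; rewrite envelope_average_mean//.
    by near: n; exact: nbhs_infty_gt.
  - by rewrite /L divfK ?gt_eqF// lerDl.
have A4 : near_cover P d6 (fun n => [set w | norm2 (est (obs n w) - ts) <= s]).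
  apply: (whp_of_cvg_in_probability _ cest) => // n.
  apply: measurable_set_lt => //; apply: measurable_norm2 => k.
  under eq_fun do rewrite !mxE.
  by apply: measurable_funB => //; exact: measurable_est.
have [mGood Good0] := observations_good.
have A5 := whp_ae mGood Good0 d60.
have A6 := whp_of_with_probability rest d60.
have deltaE : delta = d6 + (d6 + (d6 + (d6 + (d6 + d6)))) by rewrite /d6; field.
rewrite deltaE.
apply: near_cover_sub (near_coverI tight (near_coverI A2 (near_coverI A3
  (near_coverI A4 (near_coverI A5 A6))))).
near=> n => w [/= ZK [hs [es [bs [Gw [_ root]]]]]].
have n0 : (0 < n)%N by near: n; exact: nbhs_infty_gt.
set b := est (obs n w) in bs root *.
have bW j : `|b 0 j - ts 0 j| < rho.
  rewrite (_ : b 0 j - ts 0 j = (b - ts) 0 j); last by rewrite !mxE.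
  rewrite (le_lt_trans (coord_le_norm2 _ _))// (le_lt_trans bs)//.
  by rewrite gt_min ltr_pdivrMr// ltr_pMr// ltr1n.
have [E hE uE] := score_expansion n0 Wrho Gw bW root.
have Eeta : `|E| <= eta.
  rewrite (le_trans hE)// (splitr eta) lerD//; first exact: ltW.
  have bL : `|b - ts| <= eta / 2 / L.
    by rewrite (le_trans (mx_norm_le_norm2 _))// (le_trans bs)// ge_min lexx orbT.
  rewrite (le_trans (ler_wpM2l _ bL))//.
    by do 3 (apply: sumr_ge0 => ? _); rewrite mulr_ge0// sumr_ge0.
  have q0' : 0 <= eta / 2 / L by apply: divr_ge0; exact: ltW.
  rewrite (le_trans (ler_wpM2r q0' (ltW es)))//.
  by rewrite mulrC divfK// gt_eqF.
have sandn : forall (z u : 'rV[R]_p) (E : 'M[R]_p),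
    `|z| <= K -> `|E| <= eta -> u *m (Psi_ n + E) = z *m invmx (B n) ->
    `|(u *m invmx (Sigma mu f alpha ts) *m u^T) 0 0 - (z *m z^T) 0 0| <= e.
  by near: n; exact: sand.
have := sandn _ _ _ ZK Eeta uE; rewrite mulmx_tr_norm2 /wald_stat.
rewrite linearZ/= -!scalemxAl -scalemxAr scalerA -expr2 sqr_sqrtr// mxE.
by [].
Unshelve. all: by end_near. Qed.

Theorem wald_cvg_chi_square : cvg_in_law P (fun n w => W n w) (chi_square p).
Proof.
have clt := vector_clt_cdf hindep measurable_psi psi_intble score_mean0
  psi_sqr_intble (fun n _ => Omega_psi n) BOm lindeberg_P.
apply: (slutsky_cdf _ _ _ (chi_square_lt0 p) clt wald_near_standardized).
- exact: measurable_wald.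
- by move=> n; apply: measurable_sqr_standardized_sum; exact: measurable_psi.
- by move=> n w; exact: sqr_ge0.
Qed.

End model.

Theorem theorem4p2 (R : realType) (p : nat) (hp : (0 < p)%N)
  (dS dT : measure_display) (S : measurableType dS) (T : measurableType dT)
  (mu : {measure set S -> \bar R}) (P : probability T R)
  (alpha : R) (halpha : 0 <= alpha)
  (Theta : set 'rV[R]_p) (theta0 thetas : 'rV[R]_p) (htheta0 : Theta theta0)
  (hthetas : Theta thetas)
  (f : nat -> S -> 'rV[R]_p -> R) (hf : density_model mu f Theta)
  (Y : nat -> {RV P >-> S}) (hindep : mutually_independent P Y)
  (hY : forall (i : nat) (A : set S), measurable A ->
    distribution P (Y i) A = (\int[mu]_(y in A) (f i y thetas)%:E)%E)
  (U : set 'rV[R]_p) (X : set S)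
  (h1 : C1_common_support f Theta X) (h2 : C2_smooth_densities mu f Theta U X thetas)
  (h3 : C3_differentiation_under_integral mu f alpha U) (h4 : C4_positive_definite mu f alpha thetas)
  (h5 : C5_dominated_third_derivatives mu f alpha U X thetas) (h6 : C6_uniform_integrability mu f alpha thetas)
  (h7 : C7_lindeberg mu f alpha thetas)
  (hSigma : cvg (sandwich mu f alpha n theta0 @[n --> \oo]))
  (hSigma_unit : Sigma mu f alpha theta0 \in unitmx)
  (est : forall n : nat, n.-tuple S -> 'rV[R]_p)
  (hest : min_RP_estimator mu f alpha P Y Theta thetas est)
  (H0 : thetas = theta0) :
  cvg_in_law P
    (fun n w => wald_stat mu f alpha n (est n [tuple Y i w | i < n]) theta0)
    (chi_square p).
Proof.
have [oU UTheta Uts [N2 [mN2 N20 sm]]] := h2.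
have [M [m [mM [N5 [mN5 N50 bM]] hMm]]] := h5.
have [B [hB hlind]] := h7.
(* A single null set serves both almost-everywhere conditions. *)
have mN : measurable (N2 `|` N5) by exact: measurableU.
have N0 : mu (N2 `|` N5) = 0%E by apply: null_set_setU.
subst thetas.
apply: (wald_cvg_chi_square halpha htheta0 hf hY h1 oU UTheta Uts h3 mN N0 _ h6 hB
  hlind mM _ hMm hp hindep h4 hSigma hSigma_unit hest).
- move=> y nN Xy i; apply/thrice_derivableP.
  by apply: contrapT => H; apply: nN; left; apply: sm => /(_ Xy i).
- move=> y nN Xy; apply: contrapT => H; apply: nN; right.
  by apply: bM => /(_ Xy).
Qed.
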